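(* Let $G$ be a finite group, let $A$ be a unital $C^*$-algebra with finite decomposition rank, and let $\alpha: G \to \mathrm{Aut}(A)$ be an action with Rokhlin dimension $d$ (with $d<\infty$). Then the crossed product $A \rtimes_\alpha G$ has finite decomposition rank; in fact $$\mathrm{dr}(A \rtimes_\alpha G) \le (\mathrm{dr}(A)+1)(d+1) - 1 .$$ The respective statement is true for nuclear dimension: if $A$ is a unital $C^*$-algebra with finite nuclear dimension and $\alpha: G\to \mathrm{Aut}(A)$ is an action with Rokhlin dimension $d$, then $A\rtimes_\alpha G$ has finite nuclear dimension and $\dim_{\mathrm{nuc}}(A \rtimes_\alpha G) \le (\dim_{\mathrm{nuc}}(A)+1)(d+1) - 1$.
   Context: Rokhlin dimension for finite groups: Let $G$ be a finite group, $A$ a unital $C^*$-algebra and $\alpha: G\to\mathrm{Aut}(A)$ an action. $\alpha$ has Rokhlin dimension $d$ if $d$ is the least (non-negative) integer such that for any $\varepsilon>0$ and every finite subset $F\subset A$ there are positive contractions $(f^{(l)}_g)_{l=0,\ldots,d;\ g\in G}\subset A$ satisfying: (1) for any $l$, $\|f^{(l)}_g f^{(l)}_h\|<\varepsilon$ whenever $g\ne h$ in $G$; (2) $\|\sum_{l=0}^d\sum_{g\in G} f^{(l)}_g - 1\|<\varepsilon$; (3) $\|\alpha_h(f^{(l)}_g) - f^{(l)}_{hg}\|<\varepsilon$ for all $l\in\{0,\ldots,d\}$ and $g,h\in G$; (4) $\|[f^{(l)}_g,a]\|<\varepsilon$ for all $l$, $g\in G$ and $a\in F$. c.p. = completely positive,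 c.p.c. = completely positive contractive. A c.p. map $\varphi$ between $C^*$-algebras has order zero if $\varphi(x)\varphi(y)=0$ for all positive $x,y$ with $xy=0$. A c.p. map $\varphi:\mathcal F\to A$ from a finite-dimensional $C^*$-algebra is $n$-decomposable if $\mathcal F=\mathcal F^{(0)}\oplus\cdots\oplus\mathcal F^{(n)}$ with each restriction $\varphi^{(i)}=\varphi|_{\mathcal F^{(i)}}$ of order zero. Decomposition rank: $\mathrm{dr}(A)$ is the least integer $n$ such that for every finite $F\subset A$ and $\varepsilon>0$ there are a finite-dimensional $C^*$-algebra $\mathcal F$ and c.p.c. maps $\psi:A\to\mathcal F$, $\varphi:\mathcal F\to A$ with $\|\varphi\psi(b)-b\|<\varepsilon$ for all $b\in F$ and $\varphi$ $n$-decomposable ($\mathrm{dr}(A)=\infty$ if there is no such $n$). Nuclear dimension: $\dim_{\mathrm{nuc}}(A)$ is the least integer $n$ such that for every finite $F\subset A$ and $\varepsilon>0$ there are a finite-dimensional $\mathcal F$, a c.p.c. map $\psi:A\to\mathcal F$ and a c.p. map $\varphi:\mathcal F\to A$ with $\|\varphi\psi(b)-b\|<\varepsilon$ for all $b\in F$ and $\varphi$ $n$-decomposable with c.p.c. order zero components $\varphi^{(i)}$ ($\dim_{\mathrm{nuc}}(A)=\infty$ if there is no such $n$). *)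

(* Defs.v *)
From HB Require Import structures.
From mathcomp Require Import all_boot all_order all_algebra all_fingroup.
From mathcomp Require Import all_classical all_reals all_analysis.
From mathcomp Require Import complex.

Set Implicit Arguments.
Unset Strict Implicit.
Unset Printing Implicit Defensive.

Import Order.TTheory GRing.Theory Num.Theory.
Import numFieldNormedType.Exports.

Local Open Scope classical_set_scope.
Local Open Scope complex_scope.
Local Open Scope ring_scope.

(* Unital C*-algebras over R[i]; the zero algebra is allowed.  The norm `|x| of
   a normed module over R[i] takes its values in the nonnegative real elements
   of R[i].  This is a plain record because a Hierarchy-Builder structure
   joining normed modules and rings would have to be declared before
   numDomainType. *)
Record cstarType (R : realType) := CstarType {
  cstar_space : completeNormedModType R[i] ;
  cstar_mul : cstar_space -> cstar_space -> cstar_space ;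
  cstar_one : cstar_space ;
  cstar_star : cstar_space -> cstar_space ;
  cstar_mulA : associative cstar_mul ;
  cstar_mul1l : left_id cstar_one cstar_mul ;
  cstar_mul1r : right_id cstar_one cstar_mul ;
  cstar_mulDl : left_distributive cstar_mul +%R ;
  cstar_mulDr : right_distributive cstar_mul +%R ;
  cstar_scaleAl : forall (c : R[i]) x y,
    c *: cstar_mul x y = cstar_mul (c *: x) y ;
  cstar_scaleAr : forall (c : R[i]) x y,
    c *: cstar_mul x y = cstar_mul x (c *: y) ;
  cstar_normM : forall x y, `|cstar_mul x y| <= `|x| * `|y| ;
  cstar_starK : involutive cstar_star ;
  cstar_starD : {morph cstar_star : x y / x + y} ;
  cstar_starZ : forall (c : R[i]) x,
    cstar_star (c *: x) = Num.conj c *: cstar_star x ;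
  cstar_starM : forall x y,
    cstar_star (cstar_mul x y) = cstar_mul (cstar_star y) (cstar_star x) ;
  cstar_norm : forall x, `|cstar_mul (cstar_star x) x| = `|x| ^+ 2
}.

(* The carrier, as a constant on which both the normed module and the ring
   structure are canonical. *)
Definition cstar_sort (R : realType) (A : cstarType R) : Type := cstar_space A.
Coercion cstar_sort : cstarType >-> Sortclass.

HB.instance Definition _ (R : realType) (A : cstarType R) :=
  CompleteNormedModule.copy (cstar_sort A) (cstar_space A).
HB.instance Definition _ (R : realType) (A : cstarType R) :=
  GRing.Zmodule_isPzRing.Build (cstar_sort A) (@cstar_mulA R A)
    (@cstar_mul1l R A) (@cstar_mul1r R A) (@cstar_mulDl R A) (@cstar_mulDr R A).

Definition star (R : realType) (A : cstarType R) (x : A) : A := cstar_star x.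

Definition cstar_pos (R : realType) (A : cstarType R) (x : A) : Prop :=
  exists y : A, x = star y * y.

Definition star_hom (R : realType) (A B : cstarType R) (f : A -> B) : Prop :=
  [/\ forall (c : R[i]) (x y : A), f (c *: x + y) = c *: f x + f y,
      forall x y : A, f (x * y) = f x * f y,
      f 1 = 1 &
      forall x : A, f (star x) = star (f x)].

(* The *-algebra structure of the n x n matrices over A; positivity in it is a
   purely algebraic notion, so the C*-norm of M_n(A) is not needed. *)
Definition mx_star (R : realType) (A : cstarType R) (n : nat) (x : 'M[A]_n) :
  'M[A]_n := \matrix_(i, j) star (x j i).

Definition mx_positive (R : realType) (A : cstarType R) (n : nat)
  (x : 'M[A]_n) : Prop := exists y : 'M[A]_n, x = mx_star y *m y.

Definition completely_positive (R : realType) (A B : cstarType R)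
    (phi : {linear A -> B}) : Prop :=
  forall (n : nat) (x : 'M[A]_n), mx_positive x -> mx_positive (map_mx phi x).

Definition contractive_on (R : realType) (A B : cstarType R) (I : set A)
  (phi : A -> B) : Prop := forall x, I x -> `|phi x| <= `|x|.

Definition cpc (R : realType) (A B : cstarType R) (phi : {linear A -> B}) :
  Prop := completely_positive phi /\ contractive_on setT phi.

Definition order_zero_on (R : realType) (A B : cstarType R) (I : set A)
    (phi : A -> B) : Prop :=
  forall x y, I x -> I y -> cstar_pos x -> cstar_pos y ->
    x * y = 0 -> phi x * phi y = 0.

Definition fin_dim (R : realType) (F : cstarType R) : Prop :=
  exists (m : nat) (v : {linear F -> 'rV[R[i]]_m}), bijective v.

Definition star_ideal (R : realType) (F : cstarType R) (I : set F) : Prop :=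
  [/\ I 0,
      forall (c : R[i]) x y, I x -> I y -> I (c *: x + y),
      forall x y, I x -> I (x * y) /\ I (y * x) &
      forall x, I x -> I (star x)].

(* F is the internal direct sum of the C*-algebras I i: elements of distinct
   summands automatically multiply to 0, and an element of I i is positive in
   I i iff it is positive in F.  Zero summands are allowed. *)
Definition direct_sum (R : realType) (F : cstarType R) (n : nat)
    (I : 'I_n -> set F) : Prop :=
  (forall i, star_ideal (I i)) /\
  (forall x, exists! s : {ffun 'I_n -> F},
     (forall i, I i (s i)) /\ x = \sum_(i < n) s i).

(* F = I 0 (+) ... (+) I n, with n.+1 summands; each restriction of a c.p. map
   phi to I i is again c.p. *)
Definition decomposes (R : realType) (F A : cstarType R) (n : nat)
    (phi : F -> A) (I : 'I_n.+1 -> set F) : Prop :=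
  direct_sum I /\ forall i, order_zero_on (I i) phi.

Definition dr_le (R : realType) (A : cstarType R) (n : nat) : Prop :=
  forall (S : set A) (eps : R), finite_set S -> 0 < eps ->
  exists (F : cstarType R) (psi : {linear A -> F}) (phi : {linear F -> A}),
    [/\ fin_dim F, cpc psi, cpc phi,
        forall b, S b -> `|phi (psi b) - b| < eps%:C &
        exists I : 'I_n.+1 -> set F, decomposes phi I].

Definition dimnuc_le (R : realType) (A : cstarType R) (n : nat) : Prop :=
  forall (S : set A) (eps : R), finite_set S -> 0 < eps ->
  exists (F : cstarType R) (psi : {linear A -> F}) (phi : {linear F -> A}),
    [/\ fin_dim F, cpc psi, completely_positive phi,
        forall b, S b -> `|phi (psi b) - b| < eps%:C &
        exists I : 'I_n.+1 -> set F,
          decomposes phi I /\ forall i, contractive_on (I i) phi].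

(* The least n satisfying P, or +oo if there is none. *)
Definition least (R : realType) (P : nat -> Prop) : \bar R :=
  ereal_inf [set n%:R%:E | n in [set n | P n]].

Definition dr (R : realType) (A : cstarType R) : \bar R := least R (dr_le A).

Definition dimnuc (R : realType) (A : cstarType R) : \bar R :=
  least R (dimnuc_le A).

(* These conditions make every alpha g an automorphism, with inverse
   alpha g^-1. *)
Definition cstar_action (R : realType) (gT : finGroupType) (A : cstarType R)
    (alpha : gT -> A -> A) : Prop :=
  [/\ forall g, star_hom (alpha g),
      forall a, alpha 1%g a = a &
      forall g h a, alpha (g * h)%g a = alpha g (alpha h a)].

Definition rokhlin_le (R : realType) (gT : finGroupType) (A : cstarType R)
    (alpha : gT -> A -> A) (d : nat) : Prop :=
  forall (S : set A) (eps : R), finite_set S -> 0 < eps ->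
  exists f : 'I_d.+1 -> gT -> A,
    (forall l g, cstar_pos (f l g) /\ `|f l g| <= 1) /\
    [/\ forall l g h, g != h -> `|f l g * f l h| < eps%:C,
        `|(\sum_(l < d.+1) \sum_(g : gT) f l g) - 1| < eps%:C,
        forall l g h, `|alpha h (f l g) - f l (h * g)%g| < eps%:C &
        forall l g a, S a -> `|f l g * a - a * f l g| < eps%:C].

Definition rokhlin_dim (R : realType) (gT : finGroupType) (A : cstarType R)
  (alpha : gT -> A -> A) : \bar R := least R (rokhlin_le alpha).

Definition covariant (R : realType) (gT : finGroupType) (A C : cstarType R)
    (alpha : gT -> A -> A) (pi : A -> C) (v : gT -> C) : Prop :=
  [/\ star_hom pi,
      v 1%g = 1 /\ (forall g h, v (g * h)%g = v g * v h),
      forall g, star (v g) * v g = 1 /\ v g * star (v g) = 1 &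
      forall g a, pi (alpha g a) = v g * pi a * star (v g)].

(* The crossed product A x_alpha G, up to isomorphism: a C*-algebra B with a
   covariant pair (iota, u) that is universal among the covariant pairs and
   such that the image of C(G, A), i.e. the set of the sums of the
   iota (a g) * u g, is dense in B. *)
Definition crossed_product (R : realType) (gT : finGroupType)
    (A B : cstarType R) (alpha : gT -> A -> A) (iota : A -> B) (u : gT -> B) :
    Prop :=
  [/\ covariant alpha iota u,
      forall (C : cstarType R) (pi : A -> C) (v : gT -> C),
        covariant alpha pi v ->
        exists f : B -> C,
          [/\ star_hom f, forall a, f (iota a) = pi a &
              forall g, f (u g) = v g] &
      closure [set \sum_(g : gT) iota (a g) * u g | a in [set: gT -> A]]
        = [set: B]].

(* Main.v *)
Require Import Defs.
From HB Require Import structures.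
From mathcomp Require Import all_boot all_order all_algebra all_fingroup.
From mathcomp Require Import all_classical all_reals all_analysis.
From mathcomp Require Import complex ring lra.

Set Implicit Arguments.
Unset Strict Implicit.
Unset Printing Implicit Defensive.

Import Order.TTheory GRing.Theory Num.Theory.
Import numFieldNormedType.Exports.

Local Open Scope classical_set_scope.
Local Open Scope complex_scope.
Local Open Scope ring_scope.

(* Write B for the crossed product.  A tower (f_g) of positive contractions and
   an order zero map phi : F -> A give the row r_g u_g Z_j with r_g = f_g^(1/2),
   where phi(x) is approximately the sum of the lam(x)_jk Z_j Z_k^* for the
   regular representation lam of F.  The Gram matrix of this row nearly commutes
   with M_G(F), so that the compression x |-> Y x Y^* from M_G(F) to B is nearly
   of order zero.  It is of order zero as soon as the Gram matrix commutes with
   M_G(F), and this can be achieved by a small perturbation: if k is close to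
   y^* y, positive, and commutes with M_G(F), then after a cut-off of k near 0
   one has 0 <= k <= y^* y, and the limit of y ((y^* y)^(1/2) + e)^-1 k^(1/2) is
   an element near y whose Gram element is k.  Composing with the map from B to
   M_G(A) given by the regular covariant representation, and taking one such
   compression for each of the d + 1 towers and n + 1 summands, one recovers the
   identity of B, since the Rokhlin elements add up to 1. *)

(** * Real-valued norm *)

(** Decomposition rank and nuclear dimension ask for maps that are exactly of order zero, while
    Rokhlin towers are only approximately orthogonal, equivariant and central. For a compression,
    order zero follows from one algebraic relation, Y x (Y^* Y) y Y^* = Y (Y^* Y) x y Y^*, so that a
    single positive matrix has to be corrected. The admissible error of that correction depends on
    the finite-dimensional algebra F, which is only known once the approximation on A has been made.
    This fixes the order of the choices: a constant in front of the tolerance that does not see F,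
    then the tolerance, F, the rows Z_j, the size of the perturbation, and last the towers.
    Contractivity comes from comparison with the Rokhlin elements: the compressions of 1 are
    dominated by the sum of the f_g, and the small excess over 1 is removed by a scalar factor.
    Roots, positive parts and inverses come from norm-convergent iterations; each is accompanied by
    the statement that it commutes with whatever commutes with its argument, which does the work of
    functional calculus. *)

Section Norm.
Variables (R : realType) (A : cstarType R).
Implicit Types (x y z : A) (c : R[i]).

Definition nm x : R := complex.Re `|x|.

Lemma nmE x : `|x| = (nm x)%:C.
Proof.
rewrite /nm; case: `|x| (normr_ge0 x) => a b; rewrite lecE /= => /andP[/eqP -> _].
by [].
Qed.

Lemma nm_ge0 x : 0 <= nm x.
Proof. by rewrite -ler0c -nmE. Qed.

Lemma nm_ltc x (e : R) : (`|x| < e%:C) = (nm x < e).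
Proof. by rewrite nmE ltcR. Qed.

Lemma nmD x y : nm (x + y) <= nm x + nm y.
Proof. by rewrite -lecR -nmE rmorphD /= -!nmE ler_normD. Qed.

Lemma nmN x : nm (- x) = nm x.
Proof. by rewrite /nm normrN. Qed.

Lemma nm0 : nm (0 : A) = 0.
Proof. by rewrite /nm normr0. Qed.

Lemma nmB x y : nm (x - y) <= nm x + nm y.
Proof. by rewrite -(nmN y) nmD. Qed.

Lemma nmC x y : nm (x - y) = nm (y - x).
Proof. by rewrite -nmN opprB. Qed.

Lemma nm_eq0 x : nm x = 0 -> x = 0.
Proof. by move=> h; apply/eqP; rewrite -normr_eq0 nmE h. Qed.

Lemma nm_le0 x : nm x <= 0 -> x = 0.
Proof. by move=> h; apply: nm_eq0; apply/eqP; rewrite eq_le h nm_ge0. Qed.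

Lemma nmM x y : nm (x * y) <= nm x * nm y.
Proof. by rewrite -lecR -nmE rmorphM /= -!nmE; exact: cstar_normM. Qed.

Lemma nmZ c x : nm (c *: x) = complex.Re `|c| * nm x.
Proof.
have -> : nm (c *: x) = complex.Re (`|c| * `|x|) by rewrite -normrZ.
by rewrite nmE normc_def /= mulr0 subr0.
Qed.

Lemma nmZr (r : R) x : nm (r%:C *: x) = `|r| * nm x.
Proof. by rewrite nmZ normc_def /= expr0n /= addr0 sqrtr_sqr. Qed.

Lemma nm_sq x : nm (star x * x) = nm x ^+ 2.
Proof.
have h : `|star x * x| = `|x| ^+ 2 by exact: cstar_norm.
by apply: complexI; rewrite -nmE h nmE rmorphXn.
Qed.

Lemma starK x : star (star x) = x. Proof. exact: cstar_starK. Qed.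
Lemma starD x y : star (x + y) = star x + star y. Proof. exact: cstar_starD. Qed.
Lemma starZ c x : star (c *: x) = Num.conj c *: star x.
Proof. exact: cstar_starZ. Qed.
Lemma starM x y : star (x * y) = star y * star x. Proof. exact: cstar_starM. Qed.

Lemma star0 : star (0 : A) = 0.
Proof. by have := starZ 0 0; rewrite rmorph0 !scale0r. Qed.

Lemma starN x : star (- x) = - star x.
Proof. by rewrite -scaleN1r starZ rmorphN rmorph1 scaleN1r. Qed.

Lemma starB x y : star (x - y) = star x - star y.
Proof. by rewrite starD starN. Qed.

Lemma star1 : star (1 : A) = 1.
Proof.
have h y : y * star (1 : A) = y by rewrite -[y]starK -starM mul1r.
by rewrite -[LHS]mul1r h.
Qed.

Lemma conjCr (r : R) : Num.conj r%:C = r%:C.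
Proof. by apply: conj_Creal; rewrite complex_real. Qed.

Lemma starZr (r : R) x : star (r%:C *: x) = r%:C *: star x.
Proof. by rewrite starZ conjCr. Qed.

Lemma star_sum (I : Type) (r : seq I) (P : pred I) (F : I -> A) :
  star (\sum_(i <- r | P i) F i) = \sum_(i <- r | P i) star (F i).
Proof. exact: (big_morph _ starD star0). Qed.

Lemma nm_star x : nm (star x) = nm x.
Proof.
have h y : nm y <= nm (star y).
  have [->|y0] := eqVneq (nm y) 0; first exact: nm_ge0.
  have yp : 0 < nm y by rewrite lt_def y0 nm_ge0.
  by rewrite -(ler_pM2r yp) -expr2 -nm_sq nmM.
by apply/eqP; rewrite eq_le h -{2}[x]starK h.
Qed.

Lemma nm_sqr x : nm (x * star x) = nm x ^+ 2.
Proof. by rewrite -{1}[x]starK nm_sq nm_star. Qed.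

Lemma cscaleAl c x y : c *: (x * y) = (c *: x) * y.
Proof. exact: cstar_scaleAl. Qed.

Lemma cscaleAr c x y : c *: (x * y) = x * (c *: y).
Proof. exact: cstar_scaleAr. Qed.

Lemma nm_le1 : nm (1 : A) <= 1.
Proof.
have h := nm_sq 1; rewrite star1 mulr1 in h.
have [->|n0] := eqVneq (nm (1 : A)) 0; first exact: ler01.
have p : 0 < nm (1 : A) by rewrite lt_def n0 nm_ge0.
by rewrite -(ler_pM2l p) mulr1 -expr2 -h.
Qed.

Lemma nm_sum (I : Type) (r : seq I) (P : pred I) (F : I -> A) :
  nm (\sum_(i <- r | P i) F i) <= \sum_(i <- r | P i) nm (F i).
Proof.
elim/big_rec2: _ => [|i y x _ h]; first by rewrite nm0.
by apply: le_trans (nmD _ _) _; rewrite lerD2l.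
Qed.

(** Completeness with an explicit rate: the bound at stage n survives in the limit, so that later
    limits are handled by inequalities at finite stages. *)
Lemma cauchy_rate (u : nat -> A) (e : nat -> R) :
  (forall n m, (n <= m)%N -> nm (u n - u m) <= e n) ->
  (forall eps : R, 0 < eps -> exists n, e n <= eps) ->
  exists l, forall n, nm (u n - l) <= e n.
Proof.
move=> hu he.
have hc : cvg (u @ \oo).
  apply: (@cauchy_cvg (cstar_space A)).
  apply: cauchy_exP => eps eps0.
  have [r0 r0E] : exists r : R, eps = r%:C.
    exists (complex.Re eps); move: eps0; rewrite ltcE; case: eps => a b /= /andP[/eqP -> _].
    by [].
  rewrite r0E ltcR in eps0.
  have [n hn] := he (r0 / 2) ltac:(lra).
  exists (u n); exists n => // m /= nm'.
  rewrite -ball_normE /ball_ /= r0E.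
  have h : `|u n - u m| < r0%:C.
    rewrite nm_ltc; apply: le_lt_trans (hu _ _ nm') _; lra.
  exact: h.
exists (lim (u @ \oo)) => n.
apply/ler_addgt0Pr => eps eps0.
have /cvgrPdist_lt hl : u @ \oo --> lim (u @ \oo) by exact: hc.
have /hl [N _ hN] : 0 < eps%:C by rewrite ltcR.
have hm := hN (maxn n N) (leq_maxr _ _).
have h1 := hu n (maxn n N) (leq_maxl _ _).
have h2 : nm (lim (u @ \oo) - u (maxn n N)) < eps.
  rewrite -nm_ltc; exact: hm.
have -> : u n - lim (u @ \oo) =
   (u n - u (maxn n N)) - (lim (u @ \oo) - u (maxn n N)).
  by rewrite opprB addrA subrK.
apply: le_trans (nmB _ _) _; lra.
Qed.

End Norm.

(** * Identities between noncommutative polynomials, by reflection *)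

Section NoncommutativeNormalization.
Variables (R : realType) (A : cstarType R).

(** Adjoints count as atoms, so [starM] and its kin are applied before [ncring]. Words have their
    own fixpoints below, so that [cbv] restricted to these names computes the words and leaves the
    coefficients in [R[i]] to [ring] or [field]. *)
Inductive ncexp := NCvar of nat | NC0 | NC1 | NCadd of ncexp & ncexp
  | NCopp of ncexp | NCmul of ncexp & ncexp | NCscale of R[i] & ncexp.

Fixpoint nc_eval (env : seq A) (e : ncexp) : A :=
  match e with
  | NCvar n => nth 0 env n
  | NC0 => 0
  | NC1 => 1
  | NCadd a b => nc_eval env a + nc_eval env b
  | NCopp a => - nc_eval env a
  | NCmul a b => nc_eval env a * nc_eval env b
  | NCscale c a => c *: nc_eval env a
  end.

Definition nc_word (env : seq A) (w : seq nat) : A :=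
  foldr (fun n x => nth 0 env n * x) 1 w.

Fixpoint nc_poly (env : seq A) (l : seq (R[i] * seq nat)) : A :=
  if l is (c, w) :: l' then c *: nc_word env w + nc_poly env l' else 0.

Fixpoint nc_weq (v w : seq nat) : bool :=
  match v, w with
  | [::], [::] => true
  | m :: v', n :: w' => if eqn m n then nc_weq v' w' else false
  | _, _ => false
  end.

Fixpoint nc_insert (c : R[i]) (w : seq nat) (l : seq (R[i] * seq nat)) :=
  if l is (c', w') :: l' then
    if nc_weq w w' then (c + c', w') :: l' else (c', w') :: nc_insert c w l'
  else [:: (c, w)].

Fixpoint nc_add (l l' : seq (R[i] * seq nat)) :=
  if l is (c, w) :: l1 then nc_insert c w (nc_add l1 l') else l'.

Fixpoint nc_app (v w : seq nat) :=
  if v is n :: v' then n :: nc_app v' w else w.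

Fixpoint nc_mul1 (c : R[i]) (w : seq nat) (l : seq (R[i] * seq nat)) :=
  if l is (c', w') :: l' then nc_insert (c * c') (nc_app w w') (nc_mul1 c w l')
  else [::].

Fixpoint nc_mul (l l' : seq (R[i] * seq nat)) :=
  if l is (c, w) :: l1 then nc_add (nc_mul1 c w l') (nc_mul l1 l') else [::].

Fixpoint nc_norm (e : ncexp) : seq (R[i] * seq nat) :=
  match e with
  | NCvar n => [:: (1, [:: n])]
  | NC0 => [::]
  | NC1 => [:: (1, [::])]
  | NCadd a b => nc_add (nc_norm a) (nc_norm b)
  | NCopp a => nc_mul1 (-1) [::] (nc_norm a)
  | NCmul a b => nc_mul (nc_norm a) (nc_norm b)
  | NCscale c a => nc_mul1 c [::] (nc_norm a)
  end.

Fixpoint nc_zero (l : seq (R[i] * seq nat)) : Prop :=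
  if l is (c, _) :: l' then c = 0 /\ nc_zero l' else True.

Lemma nc_weqP v w : nc_weq v w -> v = w.
Proof.
elim: v w => [|m v ih] [|n w] //=; case: eqnP => // -> /ih -> //.
Qed.

Lemma nc_insertE env c w l :
  nc_poly env (nc_insert c w l) = c *: nc_word env w + nc_poly env l.
Proof.
elim: l => [|[c' w'] l ih] //=; case: ifP => [/nc_weqP ->|_] /=.
  by rewrite scalerDl addrA.
by rewrite ih addrCA.
Qed.

Lemma nc_addE env l l' : nc_poly env (nc_add l l') = nc_poly env l + nc_poly env l'.
Proof.
elim: l => [|[c w] l ih] /=; first by rewrite add0r.
by rewrite nc_insertE ih addrA.
Qed.

Lemma nc_appE env v w : nc_word env (nc_app v w) = nc_word env v * nc_word env w.
Proof. by elim: v => [|n v ih] /=; rewrite ?mul1r // ih mulrA. Qed.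

Lemma nc_mul1E env c w l :
  nc_poly env (nc_mul1 c w l) = (c *: nc_word env w) * nc_poly env l.
Proof.
elim: l => [|[c' w'] l ih] /=; first by rewrite mulr0.
rewrite nc_insertE ih nc_appE mulrDr; congr (_ + _).
by rewrite -cscaleAl -cscaleAr scalerA.
Qed.

Lemma nc_mulE env l l' :
  nc_poly env (nc_mul l l') = nc_poly env l * nc_poly env l'.
Proof.
elim: l => [|[c w] l ih] /=; first by rewrite mul0r.
by rewrite nc_addE nc_mul1E ih mulrDl.
Qed.

Lemma nc_normE env e : nc_poly env (nc_norm e) = nc_eval env e.
Proof.
elim: e => [n|||a iha b ihb|a iha|a iha b ihb|c a iha] //=.
- by rewrite scale1r mulr1 addr0.
- by rewrite scale1r addr0.
- by rewrite nc_addE iha ihb.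
- by rewrite nc_mul1E iha /= scaleN1r mulNr mul1r.
- by rewrite nc_mulE iha ihb.
- by rewrite nc_mul1E iha /= -cscaleAl mul1r.
Qed.

Lemma nc_zeroE env l : nc_zero l -> nc_poly env l = 0.
Proof.
by elim: l => [|[c w] l ih] //= [-> /ih ->]; rewrite scale0r addr0.
Qed.

Lemma nc_correct env e1 e2 :
  nc_zero (nc_norm (NCadd e1 (NCopp e2))) -> nc_eval env e1 = nc_eval env e2.
Proof.
by move=> /(nc_zeroE env); rewrite nc_normE /= => /eqP; rewrite subr_eq0 => /eqP.
Qed.

End NoncommutativeNormalization.

Ltac nc_mem a l :=
  lazymatch l with
  | nil => constr:(false)
  | cons a _ => constr:(true)
  | cons _ ?l' => nc_mem a l'
  end.

Ltac nc_index a l :=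
  lazymatch l with
  | cons a _ => constr:(O)
  | cons _ ?l' => let n := nc_index a l' in constr:(S n)
  end.

Ltac nc_atoms t l :=
  lazymatch t with
  | 0%R => l
  | 1%R => l
  | (?a + ?b)%R => let l1 := nc_atoms a l in nc_atoms b l1
  | (- ?a)%R => nc_atoms a l
  | (?a * ?b)%R => let l1 := nc_atoms a l in nc_atoms b l1
  | (_ *: ?a)%R => nc_atoms a l
  | _ => lazymatch nc_mem t l with true => l | false => constr:(cons t l) end
  end.

Ltac nc_reify R t l :=
  lazymatch t with
  | 0%R => constr:(@NC0 R)
  | 1%R => constr:(@NC1 R)
  | (?a + ?b)%R => let a' := nc_reify R a l in let b' := nc_reify R b l in
      constr:(@NCadd R a' b')
  | (- ?a)%R => let a' := nc_reify R a l in constr:(@NCopp R a')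
  | (?a * ?b)%R => let a' := nc_reify R a l in let b' := nc_reify R b l in
      constr:(@NCmul R a' b')
  | (?c *: ?a)%R => let a' := nc_reify R a l in constr:(@NCscale R c a')
  | _ => let n := nc_index t l in constr:(@NCvar R n)
  end.

Ltac ncring_core R A a b :=
  let l0 := constr:(@nil (cstar_sort A)) in
  let l1 := nc_atoms a l0 in
  let l := nc_atoms b l1 in
  let ea := nc_reify R a l in
  let eb := nc_reify R b l in
  refine (@nc_correct R A l ea eb _);
  cbv [nc_norm nc_add nc_mul nc_mul1 nc_insert nc_app nc_weq nc_zero eqn Nat.eqb];
  repeat (split; [first [ring|by field]|]); exact I.

Ltac ncring :=
  lazymatch goal with
  | |- @eq (@cstar_sort ?R ?A) ?a ?b => ncring_core R A a b
  | |- @eq ?T ?a ?b =>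
    let T' := eval hnf in T in
    let T1 := eval cbn in T in
    lazymatch T1 with context [@cstar_sort ?R ?A] => ncring_core R A a b end
  end.

(** * Square roots *)

Section Sqrt.
Variables (R : realType) (A : cstarType R).
Implicit Types (a b c x y z : A).

(** A fixed point s satisfies (1 - s)^2 = 1 - c: the iterates approximate 1 - (1 - c)^(1/2). *)
Fixpoint sqi c n : A :=
  if n is m.+1 then (2^-1)%:C *: (c + sqi c m * sqi c m) else 0.

(** The iteration for the scalar c = 1, a majorant of [sqi c] for every c of norm at most 1. Its
    distance to 1 is at most 2 / (n + 2), whatever c is. *)
Fixpoint sqt n : R := if n is m.+1 then 2^-1 * (1 + sqt m ^+ 2) else 0.

Lemma sqt_ge0 n : 0 <= sqt n.
Proof. by case: n => [|n] //=; have := sqr_ge0 (sqt n); lra. Qed.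

Lemma sqt_le1 n : sqt n <= 1.
Proof.
elim: n => [|n ih] /=; first lra.
have := sqt_ge0 n; nra.
Qed.

Lemma sqt_rate n : (1 - sqt n) * (n%:R + 2) <= 2.
Proof.
elim: n => [|n ih] /=; first lra.
have h0 := sqt_ge0 n; have h1 := sqt_le1 n.
have hn : 0 <= n%:R :> R by rewrite ler0n.
rewrite -natr1; set N := n%:R in ih hn *; set t := sqt n in ih h0 h1 *.
have h2 : 0 <= (2 - (1 - t) * (N + 2)) * ((1 + t) / 2) by apply: mulr_ge0; lra.
rewrite [leLHS](_ : _ = 2 - (1 - t) ^+ 2 / 2 -
  (2 - (1 - t) * (N + 2)) * ((1 + t) / 2)); last by field.
have := sqr_ge0 (1 - t); lra.
Qed.

Lemma sqt_small (eps : R) : 0 < eps -> exists n, 1 - sqt n <= eps.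
Proof.
move=> e0; have [n hn] : exists n : nat, 2 / eps <= n%:R.
  by exists (Num.bound (2 / eps)); apply/ltW/archi_boundP; apply: divr_ge0; lra.
exists n; have := sqt_rate n; have h0 := sqt_le1 n.
have hn' : 2 <= n%:R * eps by rewrite -ler_pdivrMr.
move=> h; rewrite leNgt; apply/negP => hlt.
have : eps * (n%:R + 2) < (1 - sqt n) * (n%:R + 2).
  by rewrite ltr_pM2r // ltr_wpDl ?ler0n.
nra.
Qed.

Lemma sqt_limit0 x (k : R) : 0 <= k -> (forall n, nm x <= k * (1 - sqt n)) -> x = 0.
Proof.
move=> k0 h; apply: nm_le0; apply/ler_addgt0Pr => e e0; rewrite add0r.
have [n hn] := @sqt_small (e / (k + 1)) ltac:(by apply: divr_gt0; lra).
apply: le_trans (h n) _; apply: le_trans (ler_wpM2l k0 hn) _.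
rewrite mulrCA ger_pMr // ler_pdivrMr; lra.
Qed.

Lemma nm_scale1 (r : R) : 0 <= r -> nm (r%:C *: (1 : A)) <= r.
Proof.
by move=> r0; rewrite nmZr ger0_norm //; rewrite ler_piMr // nm_le1.
Qed.

Section Iterate.
Variable c : A.
Hypothesis c1 : nm c <= 1.

Lemma sqi_le n : nm (sqi c n) <= sqt n.
Proof.
elim: n => [|n ih] /=; first by rewrite nm0.
rewrite nmZr ger0_norm ?invr_ge0 //; apply: ler_wpM2l; first by rewrite invr_ge0.
apply: le_trans (nmD _ _) _; apply: lerD => //.
by apply: le_trans (nmM _ _) _; rewrite expr2; apply: ler_pM; rewrite ?nm_ge0.
Qed.

(** Since s^2 - t^2 = s (s - t) + (s - t) t, the triangle inequality reproduces the recursion of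
    [sqt]. *)
Lemma sqi_step n : nm (sqi c n.+1 - sqi c n) <= sqt n.+1 - sqt n.
Proof.
elim: n => [|n ih].
  rewrite /= mulr0 addr0 subr0 nmZr ger0_norm ?invr_ge0 //.
  by rewrite expr0n /= addr0 subr0; apply: ler_wpM2l; rewrite ?invr_ge0.
have -> : sqi c n.+2 - sqi c n.+1 = (2^-1)%:C *: (sqi c n.+1 * (sqi c n.+1 - sqi c n) +
   (sqi c n.+1 - sqi c n) * sqi c n).
  rewrite -[sqi c n.+2]/((2^-1)%:C *: (c + sqi c n.+1 * sqi c n.+1)).
  by rewrite [X in _ - X]/(sqi c n.+1) -/sqi -scalerBr; congr (_ *: _); ncring.
have -> : sqt n.+2 - sqt n.+1 = 2^-1 * (sqt n.+1 * (sqt n.+1 - sqt n) +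
   (sqt n.+1 - sqt n) * sqt n).
  by rewrite -[sqt n.+2]/(2^-1 * (1 + sqt n.+1 ^+ 2)) {2}/sqt -/sqt; field.
rewrite nmZr ger0_norm ?invr_ge0 //; apply: ler_wpM2l; first by rewrite invr_ge0.
apply: le_trans (nmD _ _) _; apply: lerD; apply: le_trans (nmM _ _) _;
  by apply: ler_pM; rewrite ?nm_ge0 ?sqi_le.
Qed.

Lemma sqi_dist n m : (n <= m)%N -> nm (sqi c n - sqi c m) <= sqt m - sqt n.
Proof.
move=> /subnK <-; elim: (m - n)%N => [|k ih]; first by rewrite add0n !subrr nm0.
rewrite addSn nmC.
have -> : sqi c (k + n).+1 - sqi c n =
   (sqi c (k + n).+1 - sqi c (k + n)) + (sqi c (k + n) - sqi c n).
  by rewrite addrA subrK.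
apply: le_trans (nmD _ _) _; have := sqi_step (k + n); rewrite nmC in ih; lra.
Qed.

End Iterate.

(** Meant for [nm (1 - a) <= 1], with a self-adjoint or not. The limit is singled out by its rate of
    convergence; if there is none, the value is 1. *)
Definition csqrt a : A :=
  1 - xget 0 [set l | forall n, nm (sqi (1 - a) n - l) <= 1 - sqt n].

Section CSqrt.
Variable a : A.
Hypothesis a1 : nm (1 - a) <= 1.

Lemma csqrtP n : nm (sqi (1 - a) n - (1 - csqrt a)) <= 1 - sqt n.
Proof.
rewrite /csqrt subKr.
case: xgetP => [l _ hl|]; first exact: hl.
have [||l hl] := @cauchy_rate R A (sqi (1 - a)) (fun n => 1 - sqt n).
- by move=> i j /(sqi_dist a1) /le_trans -> //; rewrite lerB // sqt_le1.
- exact: sqt_small.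
- by move=> /(_ l).
Qed.

Lemma csqrt_le1 : nm (1 - csqrt a) <= 1.
Proof. by have := csqrtP 0; rewrite /= sub0r nmN subr0. Qed.

Lemma csqrtK : csqrt a * csqrt a = a.
Proof.
set l := 1 - csqrt a.
have hl : (2^-1)%:C *: ((1 - a) + l * l) - l = 0.
  apply: (@sqt_limit0 _ 3); first lra.
  move=> n.
  have -> : (2^-1)%:C *: ((1 - a) + l * l) - l =
     (sqi (1 - a) n.+1 - l) - (2^-1)%:C *: (sqi (1 - a) n * (sqi (1 - a) n - l) +
        (sqi (1 - a) n - l) * l).
    rewrite /= ; set s := sqi _ n; ncring.
  have h1 := csqrtP n; have h2 := csqrtP n.+1; have l1 := csqrt_le1.
  have s1 := le_trans (sqi_le a1 n) (sqt_le1 n).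
  rewrite -/l in h1 h2 l1.
  apply: le_trans (nmB _ _) _.
  rewrite nmZr ger0_norm ?invr_ge0 //.
  have h3 : nm (sqi (1 - a) n * (sqi (1 - a) n - l) + (sqi (1 - a) n - l) * l) <= 
     1 * (1 - sqt n) + (1 - sqt n) * 1.
    apply: le_trans (nmD _ _) _; apply: lerD; apply: le_trans (nmM _ _) _;
    by apply: ler_pM; rewrite ?nm_ge0.
  have i2 : 0 <= 2^-1 :> R by rewrite invr_ge0.
  apply: le_trans (lerD h2 (ler_wpM2l i2 h3)) _.
  have h4 : sqt n <= sqt n.+1 by rewrite /=; have := sqr_ge0 (1 - sqt n); lra.
  have := sqt_le1 n; lra.
have -> : csqrt a = 1 - l by rewrite /l subKr.
have -> : (1 - l) * (1 - l) = a + 2%:C *: ((2^-1)%:C *: ((1 - a) + l * l) - l).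
  ncring.
by rewrite hl scaler0 addr0.
Qed.

End CSqrt.

(** The n-th iterate multiplies the defect of a x = x b by at most n, and passing from the roots to
    the iterates costs the other term. Distinct a and b let one estimate cover commutation (a = b),
    continuity of the root (x = 1) and equivariance (x a unitary). *)
Lemma csqrt_intertwine_le a b x n : nm (1 - a) <= 1 -> nm (1 - b) <= 1 ->
  nm (csqrt a * x - x * csqrt b) <= 2 * (1 - sqt n) * nm x + n%:R * nm (a * x - x * b).
Proof.
move=> a1 b1.
have hs m : nm (sqi (1 - a) m * x - x * sqi (1 - b) m) <= m%:R * nm (a * x - x * b).
  elim: m => [|m ih] /=; first by rewrite mul0r mulr0 subrr nm0 mul0r.
  set s := sqi (1 - a) m in ih *; set t := sqi (1 - b) m in ih *.
  have -> : (2^-1)%:C *: (1 - a + s * s) * x - x * ((2^-1)%:C *: (1 - b + t * t)) =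
    (2^-1)%:C *: (s * (s * x - x * t) + (s * x - x * t) * t - (a * x - x * b)).
    ncring.
  have s1 : nm s <= 1 := le_trans (sqi_le a1 m) (sqt_le1 m).
  have t1 : nm t <= 1 := le_trans (sqi_le b1 m) (sqt_le1 m).
  have h1 : nm (s * (s * x - x * t)) <= 1 * nm (s * x - x * t).
    by apply: le_trans (nmM _ _) _; apply: ler_wpM2r; rewrite ?nm_ge0.
  have h2 : nm ((s * x - x * t) * t) <= nm (s * x - x * t) * 1.
    by apply: le_trans (nmM _ _) _; apply: ler_wpM2l; rewrite ?nm_ge0.
  rewrite nmZr ger0_norm ?invr_ge0 // -[m.+1%:R]natr1.
  have := nmB (s * (s * x - x * t) + (s * x - x * t) * t) (a * x - x * b).
  have := nmD (s * (s * x - x * t)) ((s * x - x * t) * t).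
  have := nm_ge0 (a * x - x * b); lra.
have ha := csqrtP a1 n; have hb := csqrtP b1 n.
set la := sqi _ n in ha; set lb := sqi _ n in hb.
have -> : csqrt a * x - x * csqrt b = (la - (1 - csqrt a)) * x - x * (lb - (1 - csqrt b))
   - (la * x - x * lb) by ncring.
apply: le_trans (nmB _ _) _; apply: lerD; last exact: hs.
apply: le_trans (nmB _ _) _.
have -> : 2 * (1 - sqt n) * nm x = (1 - sqt n) * nm x + nm x * (1 - sqt n) by ring.
by apply: lerD; apply: le_trans (nmM _ _) _; 
  [apply: ler_wpM2r | apply: ler_wpM2l]; rewrite ?nm_ge0.
Qed.

Lemma csqrt_intertwine a b x : nm (1 - a) <= 1 -> nm (1 - b) <= 1 ->
  a * x = x * b -> csqrt a * x = x * csqrt b.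
Proof.
move=> a1 b1 h; apply/eqP; rewrite -subr_eq0; apply/eqP.
apply: (@sqt_limit0 _ (2 * nm x)); first by have := nm_ge0 x; lra.
move=> n; have := csqrt_intertwine_le x n a1 b1.
by rewrite h subrr nm0 mulr0 addr0 mulrAC.
Qed.

Lemma csqrt_star a : nm (1 - a) <= 1 -> star a = a -> star (csqrt a) = csqrt a.
Proof.
move=> a1 ha.
have hs n : star (sqi (1 - a) n) = sqi (1 - a) n.
  elim: n => [|n ih] /=; first exact: star0.
  by rewrite starZr starD starM ih starB star1 ha.
apply/eqP; rewrite -subr_eq0; apply/eqP; apply: (@sqt_limit0 _ 2) => // n.
have h := csqrtP a1 n.
have -> : star (csqrt a) - csqrt a =
  star (sqi (1 - a) n - (1 - csqrt a)) - (sqi (1 - a) n - (1 - csqrt a)).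
  by rewrite !starB star1 hs; ncring.
apply: le_trans (nmB _ _) _; rewrite nm_star; lra.
Qed.

Lemma csqrt_modulus (eta : R) : 0 < eta -> exists2 delta : R, 0 < delta &
  forall a b x, nm (1 - a) <= 1 -> nm (1 - b) <= 1 -> nm x <= 1 ->
    nm (a * x - x * b) <= delta -> nm (csqrt a * x - x * csqrt b) <= eta.
Proof.
move=> e0; have [n hn] := @sqt_small (eta / 4) ltac:(lra).
exists (eta / (2 * (n%:R + 1))).
  by apply: divr_gt0 => //; rewrite mulr_gt0 // ltr_wpDl ?ler0n.
move=> a b x a1 b1 x1 h; apply: le_trans (csqrt_intertwine_le x n a1 b1) _.
have h1 : n%:R * nm (a * x - x * b) <= eta / 2.
  have hn0 : 0 <= n%:R :> R by rewrite ler0n.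
  apply: le_trans (ler_wpM2l hn0 h) _.
  have -> : n%:R * (eta / (2 * (n%:R + 1))) = eta / 2 * (n%:R / (n%:R + 1)) :> R.
    by field; rewrite -(natrD _ n 1) pnatr_eq0 addn1.
  by rewrite ler_piMr // ?ler_pdivrMr; lra.
have := sqt_le1 n; have := nm_ge0 x; nra.
Qed.

End Sqrt.

(** * Positivity *)

Section Positive.
Variables (R : realType) (A : cstarType R).
Implicit Types (a b c d f g p q r s t x y z : A).

(* The form of positivity for which the positive elements visibly form a
   convex cone; [posP] below identifies it with [cstar_pos]. *)
Definition pos x := star x = x /\ exists2 t : R, 0 <= t & nm (t%:C *: (1 : A) - x) <= t.

Lemma pos_sa x : pos x -> star x = x. Proof. by case. Qed.

Lemma scaleVK (r : R) x : r != 0 -> (r^-1)%:C *: (r%:C *: x) = x.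
Proof. by move=> r0; rewrite scalerA -rmorphM /= mulVf // scale1r. Qed.

Lemma scaleKV (r : R) x : r != 0 -> r%:C *: ((r^-1)%:C *: x) = x.
Proof. by move=> r0; rewrite scalerA -rmorphM /= mulfV // scale1r. Qed.

Lemma pos_scale1 (r : R) : 0 <= r -> pos (r%:C *: (1 : A)).
Proof. by move=> r0; split; [rewrite starZr star1 | exists r; rewrite // subrr nm0]. Qed.

Lemma pos0 : pos 0.
Proof. by rewrite -(scale0r (1 : A)); apply: (@pos_scale1 0). Qed.

Lemma posD x y : pos x -> pos y -> pos (x + y).
Proof.
move=> [sx [t t0 ht]] [sy [s s0 hs]]; split; first by rewrite starD sx sy.
exists (t + s); first exact: addr_ge0.
have -> : (t + s)%:C *: (1 : A) - (x + y) = (t%:C *: (1 : A) - x) + (s%:C *: (1 : A) - y) by ncring.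
by apply: le_trans (nmD _ _) _; rewrite lerD.
Qed.

Lemma posZ (r : R) x : 0 <= r -> pos x -> pos (r%:C *: x).
Proof.
move=> r0 [sx [t t0 ht]]; split; first by rewrite starZr sx.
exists (r * t); first exact: mulr_ge0.
have -> : (r * t)%:C *: (1 : A) - r%:C *: x = r%:C *: (t%:C *: (1 : A) - x) by ncring.
by rewrite nmZr ger0_norm // ler_wpM2l.
Qed.

Lemma pos_sum (I : Type) (l : seq I) (P : pred I) (F : I -> A) :
  (forall i, P i -> pos (F i)) -> pos (\sum_(i <- l | P i) F i).
Proof. by move=> h; elim/big_rec: _ => [|i y /h hi hy]; [exact: pos0 | exact: posD]. Qed.

Lemma pos_nm_sub (t : R) x : star x = x -> nm x <= t -> pos (t%:C *: (1 : A) - x).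
Proof.
move=> sx h; split; first by rewrite starB starZr star1 sx.
exists t; first by apply: le_trans h; exact: nm_ge0.
by have -> : t%:C *: (1 : A) - (t%:C *: (1 : A) - x) = x by ncring.
Qed.

(** The last clause stands in for functional calculus: the root is a limit of polynomials in a.
    Positive parts inherit the same property. *)
Lemma pos_sqrt a : pos a -> exists s, [/\ pos s, s * s = a &
  forall x, a * x = x * a -> s * x = x * s].
Proof.
move=> [sa [t t0 ht]].
have [t00|tn0] := eqVneq t 0.
  have -> : a = 0.
    apply: nm_le0; rewrite t00 in ht.
    have -> : a = - (0%:C *: (1 : A) - a) by ncring.
    by rewrite nmN.
  exists 0; split; [exact: pos0 | by rewrite mulr0|].
  by move=> x _; rewrite mul0r mulr0.
have tp : 0 < t by rewrite lt_def tn0.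
pose b := (t^-1)%:C *: a.
have b1 : nm (1 - b) <= 1.
  have -> : 1 - b = (t^-1)%:C *: (t%:C *: (1 : A) - a) by rewrite scalerBr scaleVK.
  by rewrite nmZr ger0_norm ?invr_ge0 // mulrC ler_pdivrMr // mul1r.
have sb : star b = b by rewrite /b starZr sa.
have ab : a = t%:C *: b.
  by rewrite scaleKV.
have pr : 0 <= Num.sqrt t by exact: sqrtr_ge0.
exists ((Num.sqrt t)%:C *: csqrt b); split.
- apply: posZ => //; split; first exact: csqrt_star.
  by exists 1 => //; rewrite scale1r; exact: csqrt_le1.
- rewrite -cscaleAl -cscaleAr csqrtK // scalerA -rmorphM /= -expr2 sqr_sqrtr //.
- move=> x ax; rewrite -cscaleAl -cscaleAr; congr (_ *: _).
  by apply: csqrt_intertwine => //; rewrite /b -cscaleAl -cscaleAr ax.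
Qed.

Lemma nm_sa_sq x : star x = x -> nm (x * x) = nm x ^+ 2.
Proof. by move=> sx; rewrite -nm_sq sx. Qed.

Lemma sa_sq_eq0 x : star x = x -> x * x = 0 -> x = 0.
Proof.
move=> sx h; apply: nm_eq0; apply/eqP; rewrite -sqrf_eq0 -nm_sa_sq // h nm0.
exact: eqxx.
Qed.

(* [b] is the real part of the unitary [b + i (1 - b^2)^(1/2)]. *)
Lemma sa_sq_le b : star b = b -> nm b <= 1 -> nm (1 - b * b) <= 1.
Proof.
move=> sb b1.
have h1 : nm (1 - (1 - b * b)) <= 1.
  by rewrite subKr nm_sa_sq // expr_le1 // nm_ge0.
have sa1 : star (1 - b * b) = 1 - b * b by rewrite starB star1 starM sb.
set c := csqrt (1 - b * b).
have sc : star c = c by exact: csqrt_star.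
have cc : c * c = 1 - b * b by exact: csqrtK.
have bc : c * b = b * c by apply: csqrt_intertwine => //; ncring.
pose u := b + 'i%C *: c.
have conji : Num.conj 'i%C = - 'i%C :> R[i] by apply/eqP; rewrite eq_complex /= oppr0 !eqxx.
have i2 : 'i%C * 'i%C = -1 :> R[i] by rewrite -expr2 sqr_i.
have su : star u = b - 'i%C *: c by rewrite /u starD starZ sb sc conji scaleNr.
have uu : star u * u = 1.
  rewrite su /u; transitivity (b * b - ('i%C * 'i%C) *: (c * c) + 'i%C *: (b * c - c * b)).
    ncring.
  by rewrite bc subrr scaler0 addr0 cc i2; ncring.
have hu : nm u <= 1.
  have := nm_sq u; rewrite uu => h.
  rewrite leNgt; apply/negP => h2; have := nm_le1 A; nra.
(* As 2 b = u + u^* with u unitary, 4 b^2 = u^2 + (u^2)^* + 2. *)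
have -> : 1 - b * b = (4^-1)%:C *: (2%:C *: (1 : A) - (u * u + star u * star u)).
  have -> : u * u + star u * star u = 2%:C *: (b * b) + (2%:C * ('i%C * 'i%C)) *: (c * c).
    rewrite su /u; ncring.
  rewrite i2 cc; ncring.
rewrite nmZr ger0_norm ?invr_ge0 //.
have := nmB (2%:C *: (1 : A)) (u * u + star u * star u).
have := nmD (u * u) (star u * star u).
have : nm (u * u) <= 1.
  by apply: le_trans (nmM _ _) _; rewrite mulr_ile1 ?nm_ge0.
have : nm (star u * star u) <= 1.
  by apply: le_trans (nmM _ _) _; rewrite mulr_ile1 ?nm_ge0 // nm_star.
have := @nm_scale1 R A 2 ltac:(lra).
lra.
Qed.

Lemma pos_sa_sq b : star b = b -> pos (b * b).
Proof.
move=> sb; have rp : 0 < nm b + 1 by have := nm_ge0 b; lra.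
set r := nm b + 1 in rp.
pose c := (r^-1)%:C *: b.
have -> : b * b = (r ^+ 2)%:C *: (c * c).
  have rn : r != 0 by rewrite gt_eqF.
  have <- : r%:C *: c = b by rewrite scaleKV.
  ncring.
apply: posZ; first exact: sqr_ge0.
have sc : star c = c by rewrite /c starZr sb.
split; first by rewrite starM sc.
exists 1 => //; rewrite scale1r; apply: sa_sq_le => //.
rewrite /c nmZr ger0_norm; last by rewrite invr_ge0 ltW.
by rewrite mulrC ler_pdivrMr // mul1r /r lerDl.
Qed.

Lemma posM_comm a b : pos a -> pos b -> a * b = b * a -> pos (a * b).
Proof.
move=> pa pb ab.
have [s [ps ss hs]] := pos_sqrt pa; have [r [pr rr hr]] := pos_sqrt pb.
have sb : s * b = b * s by exact: hs.
have rs : r * s = s * r by apply: hr; rewrite sb.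
have -> : a * b = (s * r) * (s * r).
  rewrite -ss -rr; transitivity (s * (s * r) * r); first by ncring.
  rewrite -{1}rs; ncring.
by apply: pos_sa_sq; rewrite starM (pos_sa ps) (pos_sa pr).
Qed.

(** With commuting roots r of b and s of t - b, the element z = r + i s satisfies z^* z = t, and r
    is its real part. *)
Lemma pos_le_nm (t : R) b : 0 <= t -> pos b -> pos (t%:C *: (1 : A) - b) -> nm b <= t.
Proof.
move=> t0 pb pc.
have [r [pr rr hr]] := pos_sqrt pb; have [s [ps ss hs]] := pos_sqrt pc.
have rb : b * r = r * b by rewrite -rr mulrA.
have sr : s * r = r * s by apply: hs; rewrite mulrBl mulrBr rb -cscaleAl -cscaleAr mul1r mulr1.
pose z := r + 'i%C *: s.
have conji : Num.conj 'i%C = - 'i%C :> R[i] by apply/eqP; rewrite eq_complex /= oppr0 !eqxx.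
have i2 : 'i%C * 'i%C = -1 :> R[i] by rewrite -expr2 sqr_i.
have sz : star z = r - 'i%C *: s.
  by rewrite /z starD starZ (pos_sa pr) (pos_sa ps) conji scaleNr.
have zz : star z * z = t%:C *: (1 : A).
  rewrite sz /z; transitivity (r * r - ('i%C * 'i%C) *: (s * s) + 'i%C *: (r * s - s * r)).
    ncring.
  by rewrite sr subrr scaler0 addr0 rr ss i2; ncring.
have hz : nm z ^+ 2 <= t by rewrite -nm_sq zz nm_scale1.
have hr2 : nm r <= nm z.
  have -> : r = (2^-1)%:C *: (z + star z) by rewrite sz /z; ncring.
  rewrite nmZr ger0_norm ?invr_ge0 //.
  have := nmD z (star z); rewrite nm_star; lra.
rewrite -rr nm_sa_sq ?(pos_sa pr) //; apply: le_trans hz.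
by rewrite lerXn2r // nnegrE nm_ge0.
Qed.

Lemma pos_mono a b : pos a -> pos (b - a) -> nm a <= nm b.
Proof.
move=> pa pba; apply: pos_le_nm => //; first exact: nm_ge0.
have -> : (nm b)%:C *: (1 : A) - a = ((nm b)%:C *: (1 : A) - b) + (b - a) by ncring.
apply: posD => //; apply: pos_nm_sub => //.
by have := pos_sa (posD pba pa); rewrite subrK.
Qed.

Lemma pos_anti a : pos a -> pos (- a) -> a = 0.
Proof. by move=> pa pn; apply: nm_le0; rewrite -(nm0 A); apply: pos_mono; rewrite ?sub0r. Qed.

Lemma pos_nm_shrink (t : R) a : pos a -> nm a <= t -> nm (t%:C *: (1 : A) - a) <= t.
Proof.
move=> pa h; apply: pos_le_nm; first by apply: le_trans h; exact: nm_ge0.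
  exact: pos_nm_sub (pos_sa pa) h.
by have -> : t%:C *: (1 : A) - (t%:C *: (1 : A) - a) = a by ncring.
Qed.

(** Let k = |f| and g = k - f. From f g = - k g one gets f^3 g^2 = - k^3 g^2; both f^3 g^2 and k^3
    g^2 are positive, hence 0. As g^3 = 4 (k^3 - f^3), this gives g^5 = 0. *)
Lemma pos_cube f : star f = f -> pos (f * f * f) -> pos f.
Proof.
move=> sf pw.
have [k [pk kk hk]] := pos_sqrt (pos_sa_sq sf).
have fk : k * f = f * k by apply: hk; rewrite mulrA.
suff -> : f = k by [].
pose g := k - f.
have sg : star g = g by rewrite /g starB sf (pos_sa pk).
have fg : f * g = - (k * g) by rewrite /g !mulrBr kk fk; ncring.
have gk : g * k = k * g by rewrite /g mulrBl mulrBr fk.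
have gf : g * f = f * g by rewrite /g mulrBl mulrBr fk.
have pgg := pos_sa_sq sg.
have cube x : g * x = x * g -> x * x * x * (g * g) = g * g * (x * x * x).
  move=> gx; have h : GRing.comm (x * x * x) g.
    by apply: commr_sym; apply: commrM => //; apply: commrM.
  exact: commrM.
have c1 := cube f gf; have c2 := cube k gk.
have p1 := posM_comm pw pgg c1.
have pk3 : pos (k * k * k).
  by apply: posM_comm => //; [apply: posM_comm | rewrite mulrA].
have p2 := posM_comm pk3 pgg c2.
have e1 : f * f * f * (g * g) = - (k * k * k * (g * g)).
  have -> : f * f * f * (g * g) = f * f * (f * g) * g by ncring.
  rewrite fg -kk; ncring.
have z1 : k * k * k * (g * g) = 0 by apply: pos_anti; rewrite // -e1.
have z2 : f * f * f * (g * g) = 0 by rewrite e1 z1 oppr0.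
have g5 : g * g * g * (g * g) = 0.
  have -> : g * g * g = 4%:C *: (k * k * k - f * f * f).
    transitivity (k * k * k - k * k * f - k * f * k - f * k * k +
       k * f * f + f * k * f + f * f * k - f * f * f); first by rewrite /g; ncring.
    have -> : k * k * f = f * f * f by rewrite kk.
    have -> : k * f * k = f * f * f by rewrite fk -mulrA kk mulrA.
    have -> : f * k * k = f * f * f by rewrite -mulrA kk mulrA.
    have -> : k * f * f = k * k * k by rewrite -mulrA -kk mulrA.
    have -> : f * k * f = k * k * k by rewrite -fk -mulrA -kk mulrA.
    have -> : f * f * k = k * k * k by rewrite -kk.
    ncring.
  by rewrite -cscaleAl mulrBl z1 z2 subrr scaler0.
have g4 : g * g * (g * g) = 0.
  have s3 : star (g * g * g) = g * g * g by rewrite !starM sg mulrA.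
  have g3 : g * g * g = 0.
    apply: sa_sq_eq0 => //; have -> : g * g * g * (g * g * g) = g * g * g * (g * g) * g by ncring.
    by rewrite g5 mul0r.
  by rewrite mulrA g3 mul0r.
have g2 : g * g = 0 by apply: sa_sq_eq0 => //; rewrite starM sg.
by have /eqP := sa_sq_eq0 sg g2; rewrite subr_eq0 => /eqP ->.
Qed.

(** The parts are (|a| + a) / 2 and (|a| - a) / 2. For s = |a| and b = a or - a, (s + b)^3 = 2 s (s
    + b)^2 is a product of commuting positive elements, so [pos_cube] applies to s + b. *)
Lemma pos_decomp a : star a = a -> exists p q,
  [/\ pos p, pos q, a = p - q, p * q = 0 & q * p = 0] /\
  forall x, a * x = x * a -> p * x = x * p /\ q * x = x * q.
Proof.
move=> sa; have [s [ps ss hs]] := pos_sqrt (pos_sa_sq sa).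
have sas : s * a = a * s by apply: hs; rewrite mulrA.
have H b : star b = b -> b * b = a * a -> s * b = b * s -> pos (s + b).
  move=> sb bb sbs; apply: pos_cube; first by rewrite starD sb (pos_sa ps).
  have -> : (s + b) * (s + b) * (s + b) = 2%:C *: (s * ((s + b) * (s + b))).
    have e : (s + b) * (s + b) = 2%:C *: (s * (s + b)).
      transitivity (s * s + (s * b + b * s) + b * b); first by ncring.
      rewrite -sbs bb -ss; ncring.
    rewrite {1}e; ncring.
  apply: posZ => //; apply: posM_comm => //.
    by apply: pos_sa_sq; rewrite starD sb (pos_sa ps).
  have h : s * (s + b) = (s + b) * s by rewrite mulrDr mulrDl sbs.
  by rewrite mulrA h -mulrA h mulrA.
exists ((2^-1)%:C *: (s + a)), ((2^-1)%:C *: (s - a)); split; first split.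
- by apply: posZ; rewrite ?invr_ge0 //; exact: H.
- by apply: posZ; rewrite ?invr_ge0 //; apply: H; rewrite ?starN ?sa ?mulrNN ?mulrN ?mulNr ?sas.
- ncring.
- transitivity ((4^-1)%:C *: (s * s - a * a + (a * s - s * a))); first by ncring.
  by rewrite ss sas !subrr addr0 scaler0.
- transitivity ((4^-1)%:C *: (s * s - a * a - (a * s - s * a))); first by ncring.
  by rewrite ss sas !subrr scaler0.
- move=> x ax; have sx : s * x = x * s by apply: hs; rewrite -mulrA ax mulrA ax mulrA.
  by split; rewrite -cscaleAl -cscaleAr; congr (_ *: _);
    rewrite !(mulrDl, mulrDr, mulNr, mulrN) sx ax.
Qed.

(* With [x^* x = p - q] and [y = x q], both [- y^* y = q^3] and [y y^*] are
   positive of norm [N], and [(N - y y^* ) y = y (N + q^3)] bounds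
   [2 N q^6] by [N^3], which forces [N = 0]. *)
Lemma pos_gram x : pos (star x * x).
Proof.
have sa : star (star x * x) = star x * x by rewrite starM starK.
have [p [q [[pp pq e pq0 qp0] _]]] := pos_decomp sa.
suff -> : star x * x = p by [].
pose y := x * q.
have sq := pos_sa pq.
have yy : star y * y = - (q * q * q).
  rewrite /y starM sq.
  have -> : q * star x * (x * q) = q * (star x * x) * q by ncring.
  by rewrite e mulrBr qp0 sub0r mulNr.
have pqq : pos (q * q * q).
  apply: posM_comm => //; last by rewrite mulrA.
  by apply: pos_sa_sq.
set c := q * q * q in yy pqq.
pose d := y * star y.
have pd : pos d.
  (* Half the sum of the two squares is y y^* + y^* y, and adding c = - y^* y leaves y y^*. *)
  have -> : d = (2^-1)%:C *: ((y + star y) * (y + star y) +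
     ('i%C *: (y - star y)) * ('i%C *: (y - star y))) + c.
    rewrite (_ : c = - (star y * y)); last by rewrite yy opprK.
    have i2 : 'i%C * 'i%C = -1 :> R[i] by rewrite -expr2 sqr_i.
    have -> : ('i%C *: (y - star y)) * ('i%C *: (y - star y)) =
        ('i%C * 'i%C) *: ((y - star y) * (y - star y)) by ncring.
    rewrite i2 /d; ncring.
  apply: posD => //; apply: posZ; rewrite ?invr_ge0 //.
  apply: posD; apply: pos_sa_sq; first by rewrite starD starK addrC.
  have conji : Num.conj 'i%C = - 'i%C :> R[i] by apply/eqP; rewrite eq_complex /= oppr0 !eqxx.
  by rewrite starZ starB starK conji scaleNr -scalerN opprB.
set N := nm y ^+ 2.
have N0 : 0 <= N by exact: sqr_ge0.
have nd : nm d = N by rewrite /d nm_sqr.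
have nc : nm c = N by rewrite -nmN -yy nm_sq.
have h1 : nm (y * (N%:C *: (1 : A) + c)) <= N * nm y.
  have -> : y * (N%:C *: (1 : A) + c) = (N%:C *: (1 : A) - d) * y.
    have -> : c = - (star y * y) by rewrite yy opprK.
    rewrite /d; ncring.
  apply: le_trans (nmM _ _) _; apply: ler_wpM2r; first exact: nm_ge0.
  by apply: pos_nm_shrink => //; rewrite nd.
have sc := pos_sa pqq.
have h2 : 2 * N * N ^+ 2 <= N ^+ 2 * N.
  have -> : 2 * N * N ^+ 2 = nm ((2 * N)%:C *: (c * c)).
    have N2 : 0 <= 2 * N by rewrite mulr_ge0.
    by rewrite nmZr (ger0_norm N2) nm_sa_sq // nc.
  have h3 : nm ((N%:C *: (1 : A) + c) * c * (N%:C *: (1 : A) + c)) <= N ^+ 2 * N.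
    have -> : (N%:C *: (1 : A) + c) * c * (N%:C *: (1 : A) + c) =
       - (star (y * (N%:C *: (1 : A) + c)) * (y * (N%:C *: (1 : A) + c))).
      rewrite starM starD starZr star1 sc.
      transitivity (- ((N%:C *: (1 : A) + c) * (star y * y) * (N%:C *: (1 : A) + c)));
        last by ncring.
      rewrite yy; ncring.
    rewrite nmN nm_sq -exprMn; apply: lerXn2r; rewrite ?nnegrE ?nm_ge0 ?mulr_ge0 ?nm_ge0 //.
  apply: le_trans _ h3; apply: pos_mono.
    by apply: posZ; [rewrite mulr_ge0 | exact: pos_sa_sq].
  have -> : (N%:C *: (1 : A) + c) * c * (N%:C *: (1 : A) + c) - (2 * N)%:C *: (c * c) =
     (N ^+ 2)%:C *: c + c * (c * c) by ncring.
  apply: posD; first by apply: posZ; rewrite ?sqr_ge0.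
  by apply: posM_comm => //; [exact: pos_sa_sq | rewrite mulrA].
have N00 : N = 0.
  apply/eqP; rewrite eq_le N0 andbT leNgt; apply/negP => Np.
  have : 0 < N ^+ 2 * N by rewrite mulr_gt0 // exprn_gt0.
  lra.
have c0 : c = 0 by apply: nm_eq0; rewrite nc.
have q2 : q * q = 0.
  apply: sa_sq_eq0; first by rewrite starM sq.
  by rewrite mulrA -/c c0 mul0r.
by rewrite e (sa_sq_eq0 sq q2) subr0.
Qed.

Lemma posP x : cstar_pos x <-> pos x.
Proof.
split=> [[y ->]|px]; first exact: pos_gram.
have [s [ps ss _]] := pos_sqrt px; exists s; by rewrite (pos_sa ps) ss.
Qed.

Lemma pos_conj a x : pos a -> pos (star x * a * x).
Proof.
move=> /posP [y ->]; have -> : star x * (star y * y) * x = star (y * x) * (y * x).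
  by rewrite starM; ncring.
exact: pos_gram.
Qed.

Lemma nm_le_gram (t : R) x : 0 <= t -> pos ((t ^+ 2)%:C *: (1 : A) - star x * x) -> nm x <= t.
Proof.
move=> t0 h; have := pos_le_nm (sqr_ge0 t) (pos_gram x) h.
by rewrite nm_sq ler_sqr ?nnegrE ?nm_ge0.
Qed.

Lemma gram_le_nm (t : R) x : nm x <= t -> pos ((t ^+ 2)%:C *: (1 : A) - star x * x).
Proof.
move=> h; apply: pos_nm_sub; first by rewrite starM starK.
by rewrite nm_sq lerXn2r ?nnegrE ?nm_ge0 //; apply: le_trans h; exact: nm_ge0.
Qed.

End Positive.

(** * Factorization and perturbation of Gram elements *)

Section StarHom.
Variables (R : realType) (A B : cstarType R) (f : A -> B).
Hypothesis hf : star_hom f.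

Lemma shomD x y : f (x + y) = f x + f y.
Proof. by case: hf => h _ _ _; rewrite -[x in LHS]scale1r h scale1r. Qed.

Lemma shom0 : f 0 = 0.
Proof. by apply: (@addrI _ (f 0)); rewrite -shomD !addr0. Qed.

Lemma shomZ (c : R[i]) x : f (c *: x) = c *: f x.
Proof. by case: hf => h _ _ _; rewrite -[c *: x]addr0 h shom0 addr0. Qed.

Lemma shomN x : f (- x) = - f x.
Proof. by rewrite -scaleN1r shomZ scaleN1r. Qed.

Lemma shomB x y : f (x - y) = f x - f y.
Proof. by rewrite shomD shomN. Qed.

Lemma shomM x y : f (x * y) = f x * f y. Proof. by case: hf. Qed.
Lemma shom1 : f 1 = 1. Proof. by case: hf. Qed.
Lemma shom_star x : f (star x) = star (f x). Proof. by case: hf. Qed.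

Lemma shom_sum (I : Type) (r : seq I) (P : pred I) (F : I -> A) :
  f (\sum_(i <- r | P i) F i) = \sum_(i <- r | P i) f (F i).
Proof. exact: (big_morph f shomD shom0). Qed.

Lemma shom_pos x : pos x -> pos (f x).
Proof. by move=> /posP [y ->]; rewrite shomM shom_star; exact: pos_gram. Qed.

(** The inequality x^* x <= t^2 characterizes [nm x <= t] for t >= 0, and unital *-homomorphisms
    preserve it. *)
Lemma shom_nm x : nm (f x) <= nm x.
Proof.
apply: nm_le_gram; first exact: nm_ge0.
rewrite -shom_star -shomM -shom1 -shomZ -shomB; apply: shom_pos.
exact: gram_le_nm.
Qed.

End StarHom.

Section RealLimits.
Variable R : realType.

Lemma inv_small (eps : R) : 0 < eps -> exists n : nat, n.+1%:R^-1 <= eps.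
Proof.
move=> e0; exists (Num.bound eps^-1).
have h : eps^-1 < (Num.bound eps^-1)%:R by apply: archi_boundP; rewrite invr_ge0 ltW.
rewrite -[leRHS]invrK lef_pV2 ?posrE ?invr_gt0 ?ltr0Sn //.
by apply: ltW; apply: lt_le_trans h _; rewrite ler_nat.
Qed.

Lemma le_inv_lim (a b K : R) : (forall n : nat, a <= b + K * n.+1%:R^-1) -> a <= b.
Proof.
move=> h; apply/ler_addgt0Pr => e e0.
have d0 : 0 < e / (`|K| + 1) by apply: divr_gt0 => //; have := normr_ge0 K; lra.
have [n hn] := inv_small d0.
apply: le_trans (h n) _; rewrite lerD2l.
have i0 : 0 <= n.+1%:R^-1 :> R by rewrite invr_ge0.
apply: le_trans (ler_wpM2r i0 (ler_norm K)) _.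
apply: le_trans (ler_wpM2l (normr_ge0 K) hn) _.
rewrite mulrCA ger_pMr // ler_pdivrMr; have := normr_ge0 K; lra.
Qed.

Lemma geom_le (r : R) n : 0 <= r -> r <= 1 -> r ^+ n * (1 + n%:R * (1 - r)) <= 1.
Proof.
move=> r0 r1; elim: n => [|n ih]; first by rewrite expr0; lra.
apply: le_trans ih; rewrite exprSr -mulrA; apply: ler_wpM2l; first exact: exprn_ge0.
have n0 : 0 <= n%:R :> R by rewrite ler0n.
rewrite -[n.+1%:R]natr1.
have : 0 <= n%:R * (1 - r) * (1 - r) by rewrite !mulr_ge0 // subr_ge0.
nra.
Qed.

Lemma geom_small (r eps : R) : 0 <= r -> r < 1 -> 0 < eps -> exists n, r ^+ n / (1 - r) <= eps.
Proof.
move=> r0 r1 e0.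
have d0 : 0 < 1 - r by lra.
have [n hn] := @inv_small (eps * (1 - r) * (1 - r)) ltac:(by rewrite !mulr_gt0).
exists n.+1; rewrite ler_pdivrMr //.
have h := geom_le n.+1 r0 (ltW r1).
have n0 : 0 < n.+1%:R :> R by rewrite ltr0n.
have h1 : r ^+ n.+1 * (n.+1%:R * (1 - r)) <= 1.
  apply: le_trans h; rewrite ler_wpM2l ?exprn_ge0 //; lra.
have h2 : 1 <= eps * (1 - r) * (n.+1%:R * (1 - r)).
  have -> : eps * (1 - r) * (n.+1%:R * (1 - r)) = eps * (1 - r) * (1 - r) * n.+1%:R by ring.
  by rewrite -ler_pdivrMr // mul1r.
have np : 0 < n.+1%:R * (1 - r) by rewrite mulr_gt0.
by rewrite -(ler_pM2r np); apply: le_trans h1 h2.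
Qed.

End RealLimits.

Section Inverse.
Variables (R : realType) (A : cstarType R).
Implicit Types (c s w x y z : A).

Lemma inv_lim0 x (K : R) : (forall n : nat, nm x <= K * n.+1%:R^-1) -> x = 0.
Proof. by move=> h; apply: nm_le0; apply: (@le_inv_lim R _ _ K) => n; rewrite add0r. Qed.

Lemma neumann c (r : R) : 0 <= r -> r < 1 -> nm c <= r -> exists w,
  [/\ (1 - c) * w = 1, w * (1 - c) = 1 & forall x, c * x = x * c -> w * x = x * w].
Proof.
move=> r0 r1 hc.
pose S := fix S n : A := if n is m.+1 then 1 + c * S m else 0.
have d0 : 0 < 1 - r by lra.
have i0 : 0 <= (1 - r)^-1 by rewrite invr_ge0 ltW.
have step n : nm (S n.+1 - S n) <= r ^+ n.
  elim: n => [|n ih]; first by rewrite /= mulr0 addr0 subr0 expr0 nm_le1.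
  have -> : S n.+2 - S n.+1 = c * (S n.+1 - S n).
    rewrite -[S n.+2]/(1 + c * S n.+1) -[X in _ - X]/(1 + c * S n); ncring.
  by apply: le_trans (nmM _ _) _; rewrite exprS ler_pM ?nm_ge0.
have dist n m : (n <= m)%N -> nm (S n - S m) <= (r ^+ n - r ^+ m) / (1 - r).
  move=> /subnK <-; elim: (m - n)%N => [|k ih]; first by rewrite add0n !subrr nm0 mul0r.
  rewrite addSn.
  have -> : S n - S (k + n).+1 = (S n - S (k + n)) - (S (k + n).+1 - S (k + n)).
    by rewrite opprB addrA subrK.
  apply: le_trans (nmB _ _) _; apply: le_trans (lerD ih (step _)) _.
  rewrite le_eqVlt; apply/orP; left; apply/eqP.
  by rewrite exprS; field; lra.
have [||w hw] := @cauchy_rate R A S (fun n => r ^+ n / (1 - r)).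
- move=> n m /dist /le_trans; apply; rewrite ler_wpM2r //.
  by rewrite gerBl exprn_ge0.
- by move=> eps; exact: geom_small.
have lim0 x (K : R) : 0 <= K -> (forall n, nm x <= K * (r ^+ n / (1 - r))) -> x = 0.
  move=> K0 h; apply: (@inv_lim0 _ K) => m.
  have [n hn] := @geom_small R r m.+1%:R^-1 r0 r1 ltac:(by rewrite invr_gt0 ltr0n).
  by apply: le_trans (h n) _; rewrite ler_wpM2l.
have comm x : c * x = x * c -> w * x = x * w.
  move=> cx.
  have Sx n : S n * x = x * S n.
    elim: n => [|n ih] /=; first by rewrite mul0r mulr0.
    by rewrite mulrDl mulrDr mul1r mulr1 -mulrA ih !mulrA cx.
  apply/eqP; rewrite -subr_eq0; apply/eqP; apply: (lim0 _ (nm x + nm x)).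
    by rewrite addr_ge0 // nm_ge0.
  move=> n; have -> : w * x - x * w = x * (S n - w) - (S n - w) * x.
    rewrite mulrBr mulrBl Sx; ncring.
  apply: le_trans (nmB _ _) _; rewrite [leRHS]mulrDl; apply: lerD; apply: le_trans (nmM _ _) _.
    by rewrite ler_wpM2l ?nm_ge0.
  by rewrite mulrC ler_wpM2l ?nm_ge0.
have fix_w : w = 1 + c * w.
  apply/eqP; rewrite -subr_eq0; apply/eqP; apply: (lim0 _ (1 + 1)) => // n.
  have -> : w - (1 + c * w) = c * (S n - w) - (S n.+1 - w).
    rewrite -[S n.+1]/(1 + c * S n); ncring.
  apply: le_trans (nmB _ _) _; rewrite [leRHS]mulrDl; apply: lerD.
    apply: le_trans (nmM _ _) _; apply: ler_pM; rewrite ?nm_ge0 //; lra.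
  apply: le_trans (hw n.+1) _; rewrite mul1r ler_wpM2r //.
  by rewrite exprS ler_piMl ?exprn_ge0 // ltW.
have h1 : (1 - c) * w = 1 by rewrite mulrBl mul1r {1}fix_w addrK.
exists w; split=> //.
by rewrite mulrBr mulr1 comm // -{1}[w]mul1r -mulrBl.
Qed.

(** The bound on t - s makes s + e a multiple of 1 - c with c of norm at most t / (t + e), so the
    Neumann series converges. The product s w is a soft cut-off of s at height e, with 1 - s w = e
    w; its bound comes from 1 - (s w)^2 = w (2 e s + e^2) w. *)
Lemma pos_inv s (e : R) : pos s -> 0 < e -> exists w,
  [/\ (s + e%:C *: (1 : A)) * w = 1, w * (s + e%:C *: (1 : A)) = 1, star w = w,
      forall x, s * x = x * s -> w * x = x * w & nm (s * w) <= 1].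
Proof.
move=> ps e0; have [ss [t t0 ht]] := ps.
have T0 : 0 < t + e by lra.
have Tn : t + e != 0 by rewrite gt_eqF.
pose c := ((t + e)^-1)%:C *: (t%:C *: (1 : A) - s).
have hc : nm c <= t / (t + e).
  rewrite /c nmZr ger0_norm; last by rewrite invr_ge0 ltW.
  by rewrite mulrC ler_wpM2r // invr_ge0 ltW.
have [|||w [w1 w2 w3]] := @neumann c (t / (t + e)); first by rewrite divr_ge0 // ltW.
- by rewrite ltr_pdivrMr //; lra.
- exact: hc.
have sE : s + e%:C *: (1 : A) = (t + e)%:C *: (1 - c).
  rewrite scalerBr /c scaleKV //; ncring.
pose v := ((t + e)^-1)%:C *: w.
have v1 : (s + e%:C *: (1 : A)) * v = 1.
  by rewrite sE /v -cscaleAl -cscaleAr w1 scaleKV.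
have v2 : v * (s + e%:C *: (1 : A)) = 1.
  by rewrite sE /v -cscaleAl -cscaleAr w2 scaleVK.
have cv x : s * x = x * s -> v * x = x * v.
  move=> sx; rewrite /v -cscaleAl -cscaleAr; congr (_ *: _); apply: w3.
  rewrite /c -cscaleAl -cscaleAr; congr (_ *: _).
  by rewrite mulrBl mulrBr sx -cscaleAl -cscaleAr mul1r mulr1.
have sv : star v = v.
  have h : star v * (s + e%:C *: (1 : A)) = 1.
    rewrite -[LHS]starK starM starD starZr star1 ss starK.
    by rewrite v1 star1.
  by rewrite -[LHS]mulr1 -v1 mulrA h mul1r.
have svc : v * s = s * v by apply: cv.
exists v; split => //.
apply: nm_le_gram => //; rewrite expr1n scale1r.
have -> : 1 - star (s * v) * (s * v) = 
  star v * ((2 * e)%:C *: s + (e ^+ 2)%:C *: (1 : A)) * v.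
  rewrite starM ss sv.
  have {1}-> : (1 : A) = v * (s + e%:C *: (1 : A)) * ((s + e%:C *: (1 : A)) * v).
    by rewrite v1 v2 mulr1.
  ncring.
apply: pos_conj; apply: posD; apply: posZ; rewrite ?mulr_ge0 ?sqr_ge0 ?ltW //.
by rewrite -[1]scale1r; exact: (pos_scale1 _ ler01).
Qed.

End Inverse.

Section BoundedSqrt.
Variables (R : realType) (A : cstarType R).
Implicit Types (a b x : A).

(** Rescaling by a fixed M, and not by a bound depending on a, makes the modulus of continuity
    uniform on the positive elements of norm at most M. *)
Definition bsqrt (M : R) a : A := (Num.sqrt M)%:C *: csqrt ((M^-1)%:C *: a).

Section WithBound.
Variable M : R.
Hypothesis M0 : 0 < M.

Lemma bsqrt_scale a : pos a -> nm a <= M -> nm (1 - (M^-1)%:C *: a) <= 1.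
Proof.
move=> pa ha.
have -> : 1 - (M^-1)%:C *: a = (M^-1)%:C *: (M%:C *: (1 : A) - a).
  by rewrite scalerBr scaleVK ?gt_eqF.
rewrite nmZr ger0_norm; last by rewrite invr_ge0 ltW.
by rewrite mulrC ler_pdivrMr // mul1r; exact: pos_nm_shrink.
Qed.

Lemma bsqrt_pos a : pos a -> nm a <= M -> pos (bsqrt M a).
Proof.
move=> pa ha; apply: posZ; first exact: sqrtr_ge0.
have h := bsqrt_scale pa ha.
split; first by apply: csqrt_star => //; rewrite starZr (pos_sa pa).
by exists 1 => //; rewrite scale1r; exact: csqrt_le1.
Qed.

Lemma bsqrtK a : pos a -> nm a <= M -> bsqrt M a * bsqrt M a = a.
Proof.
move=> pa ha; rewrite /bsqrt -cscaleAl -cscaleAr csqrtK; last exact: bsqrt_scale.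
by rewrite scalerA -rmorphM /= -expr2 sqr_sqrtr ?ltW // scaleKV // gt_eqF.
Qed.

Lemma bsqrt_modulus (eta : R) : 0 < eta -> exists2 delta : R, 0 < delta &
  forall a b, pos a -> pos b -> nm a <= M -> nm b <= M ->
    nm (a - b) <= delta -> nm (bsqrt M a - bsqrt M b) <= eta.
Proof.
move=> e0; have sM : 0 < Num.sqrt M by rewrite sqrtr_gt0.
have [d d0 hd] := @csqrt_modulus R A (eta / Num.sqrt M) ltac:(by rewrite divr_gt0).
exists (M * d); first by rewrite mulr_gt0.
move=> a b pa pb ha hb hab; rewrite /bsqrt -scalerBr nmZr (ger0_norm (ltW sM)).
rewrite mulrC -ler_pdivlMr //.
have := hd ((M^-1)%:C *: a) ((M^-1)%:C *: b) 1 (bsqrt_scale pa ha) (bsqrt_scale pb hb) (nm_le1 A).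
rewrite !mulr1 !mul1r; apply.
rewrite -scalerBr nmZr ger0_norm; last by rewrite invr_ge0 ltW.
by rewrite mulrC ler_pdivrMr // mulrC.
Qed.

End WithBound.
End BoundedSqrt.

Section Exactify.
Variables (R : realType) (A : cstarType R).
Implicit Types (a b k p r s w x y z : A).

Lemma nm_mul_le r s z : star r = r -> star s = s -> pos (s * s - r * r) ->
  nm (z * r) <= nm (z * s).
Proof.
move=> sr ss h; rewrite -ler_sqr ?nnegrE ?nm_ge0 // -!nm_sqr; apply: pos_mono.
  by rewrite -{1}[z * r]starK; exact: pos_gram.
have -> : z * s * star (z * s) - z * r * star (z * r) = star (star z) * (s * s - r * r) * star z.
  rewrite starK !starM sr ss; ncring.
exact: pos_conj.
Qed.

(** Lets y be traded for its absolute value s in norms of products, in place of a polar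
    decomposition. *)
Lemma nm_gram_eq y s z : star y * y = star s * s -> nm (y * z) = nm (s * z).
Proof.
move=> h; apply/eqP; rewrite -(@eqrXn2 _ 2) ?nm_ge0 // -!nm_sq !starM.
have e u : star z * star u * (u * z) = star z * (star u * u) * z by ncring.
by rewrite !e h.
Qed.

(* [y' = lim y (s + e)^-1 r] as [e] tends to 0. *)
Lemma gram_factor y r s : pos s -> star r = r -> s * s = star y * y ->
  pos (s * s - r * r) -> exists y',
  [/\ star y' * y' = r * r, nm (y' - y) <= nm (r - s) &
      forall p, p * y = y -> p * y' = y'].
Proof.
move=> ps sr sy hk; have ss := pos_sa ps.
have gs : star y * y = star s * s by rewrite ss sy.
pose e (n : nat) : R := n.+1%:R^-1.
have e0 n : 0 < e n by rewrite invr_gt0 ltr0n.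
have [w hw] := @choice _ _ _ (fun n => pos_inv ps (e0 n)).
have swc n : w n * s = s * w n by have [_ _ _ h _] := hw n; exact: h.
have w1 n : 1 - s * w n = (e n)%:C *: w n.
  have [h _ _ _ _] := hw n; rewrite -{1}h; ncring.
have nsw n : nm (s * w n) <= 1 by case: (hw n).
have sww n : star (w n) = w n by case: (hw n).
pose u n := y * w n * r.
have e_anti n m : (n <= m)%N -> e m <= e n.
  by move=> nm'; rewrite lef_pV2 ?posrE ?ltr0n // ler_nat ltnS.
have [||y' hy] := @cauchy_rate R A u e.
- move=> n m lnm.
  (* In the norm, y becomes s on the left and r is dominated by s on the right; the resolvent
     identity then leaves (e_m - e_n) (s w_n) (s w_m). *)
  have -> : u n - u m = y * ((w n - w m) * r) by rewrite /u; ncring.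
  rewrite (nm_gram_eq _ gs) mulrA; apply: le_trans (nm_mul_le _ sr ss hk) _.
  have -> : s * (w n - w m) * s = (e m - e n)%:C *: ((s * w n) * (s * w m)).
    have [_ h2 _ _ _] := hw n; have [h1' _ _ _ _] := hw m.
    have -> : w n - w m = (e m - e n)%:C *: (w n * w m).
      transitivity (w n * ((s + (e m)%:C *: (1 : A)) * w m) -
          (w n * (s + (e n)%:C *: (1 : A))) * w m).
        by rewrite h1' h2 mulr1 mul1r.
      ncring.
    rewrite -cscaleAr -cscaleAl; congr (_ *: _).
    by rewrite -!mulrA swc.
  rewrite nmZr distrC ger0_norm ?subr_ge0 ?e_anti //.
  apply: le_trans (_ : (e n - e m) * 1 <= _).
    apply: ler_wpM2l; first by rewrite subr_ge0 e_anti.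
    by apply: le_trans (nmM _ _) _; rewrite mulr_ile1 ?nm_ge0.
  by rewrite mulr1 gerBl ltW.
- by move=> eps /inv_small.
have nyw n : nm (y * w n) <= 1 by rewrite (nm_gram_eq _ gs).
have nu n : nm (u n) <= nm r.
  by apply: le_trans (nmM _ _) _; rewrite ler_piMl ?nm_ge0.
exists y'; split.
- apply/eqP; rewrite -subr_eq0; apply/eqP; apply: (@inv_lim0 _ _ _ (nm y' + nm r + 2 * nm r)).
  move=> n.
  have h1 : nm (r * r - star (u n) * u n) <= 2 * nm r * e n.
    have -> : r * r - star (u n) * u n = (r * (1 - s * w n)) * ((1 + s * w n) * r).
      rewrite /u !starM sr sww.
      have -> : r * (w n * star y) * (y * w n * r) = r * (w n * (star y * y) * w n) * r by ncring.
      rewrite gs ss (_ : w n * (s * s) = s * w n * s); last by rewrite mulrA swc.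
      ncring.
    apply: le_trans (nmM _ _) _; rewrite mulrC; apply: ler_pM; rewrite ?nm_ge0 //.
      apply: le_trans (nmM _ _) _; rewrite ler_wpM2r ?nm_ge0 //.
      by apply: le_trans (nmD _ _) _; have := nsw n; have := nm_le1 A; lra.
    have -> : nm (r * (1 - s * w n)) = nm ((1 - s * w n) * r).
      by rewrite -nm_star starM sr starB star1 starM sww ss swc.
    apply: le_trans (nm_mul_le _ sr ss hk) _.
    rewrite w1 -cscaleAl nmZr (ger0_norm (ltW (e0 n))) ler_piMr //; first exact: ltW.
    by rewrite swc.
  have -> : star y' * y' - r * r = - (star y' * (u n - y')) - star (u n - y') * u n
     - (r * r - star (u n) * u n) by rewrite starB; ncring.
  apply: le_trans (nmB _ _) _; rewrite [leRHS]mulrDl; apply: lerD; last exact: h1.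
  apply: le_trans (nmB _ _) _; rewrite [leRHS]mulrDl nmN; apply: lerD; apply: le_trans (nmM _ _) _.
    by rewrite nm_star ler_wpM2l ?nm_ge0.
  by rewrite nm_star mulrC; apply: ler_pM; rewrite ?nm_ge0.
- apply: (@le_inv_lim R _ _ 2) => n.
  have -> : y' - y = - (u n - y') + (y * w n * (r - s) - (e n)%:C *: (y * w n)).
    have {1}-> : y = y * (s * w n) + (e n)%:C *: (y * w n).
      have -> : (e n)%:C *: (y * w n) = y * ((e n)%:C *: w n) by ncring.
      by rewrite -w1; ncring.
    by rewrite /u -swc; ncring.
  apply: le_trans (nmD _ _) _; rewrite nmN.
  have := nmB (y * w n * (r - s)) ((e n)%:C *: (y * w n)).
  rewrite nmZr (ger0_norm (ltW (e0 n))).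
  have h1 : nm (y * w n * (r - s)) <= nm (r - s).
    by apply: le_trans (nmM _ _) _; rewrite ler_piMl ?nm_ge0.
  have h2 : e n * nm (y * w n) <= e n by rewrite ler_piMr // ltW.
  have := hy n; rewrite -/(e n); lra.
(* y' is a limit of elements of y A, so a left unit of y is one of y'. This will keep a perturbed
   row inside its row. *)
- move=> p py; apply/eqP; rewrite -subr_eq0; apply/eqP.
  apply: (@inv_lim0 _ _ _ (nm p + 1)) => n.
  have pu : p * u n = u n by rewrite /u !mulrA py.
  have -> : p * y' - y' = (u n - y') - p * (u n - y') by rewrite mulrBr pu; ncring.
  apply: le_trans (nmB _ _) _; rewrite [leRHS]mulrDl [leRHS]addrC mul1r; apply: lerD => //.
  by apply: le_trans (nmM _ _) _; rewrite ler_wpM2l ?nm_ge0.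
Qed.

(** [gram_factor] wants the new Gram element below the old one, which closeness of k to y^* y does
    not give. Lowering k by the error D does: with k - D = p - q and the cut-off e = p (p + D)^-1,
    which kills q, one has e p e = e (k - D) e <= e y^* y e. The new Gram element e p e still
    commutes with whatever commutes with k. *)
Lemma gram_perturb (M eta : R) : 0 < M -> 0 < eta -> exists2 delta : R, 0 < delta &
  forall y k, pos k -> nm (star y * y) <= M -> nm (star y * y - k) <= delta ->
  exists y', [/\ nm (y' - y) <= eta,
    forall x, k * x = x * k -> star y' * y' * x = x * (star y' * y') &
    forall p, p * y = y -> p * y' = y'].
Proof.
move=> M0 eta0.
have [d1 d10 hd1] := @bsqrt_modulus R A M M0 (eta / 2) ltac:(lra).
(* Below, D = d / 3. The first bound puts 2 D under the modulus of continuity of the root; the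
   second puts 10 D, which bounds the square of [nm (y * (1 - e))], under (eta / 2)^2. *)
pose d := Num.min (d1 / 2) ((eta / 4) ^+ 2).
have d0 : 0 < d.
  have h1 : 0 < d1 / 2 by lra.
  have h2 : 0 < eta / 4 by lra.
  by rewrite lt_min h1 exprn_gt0.
have dd1 : 2 * d <= d1.
  have : d <= d1 / 2 by rewrite ge_min lexx.
  lra.
have dd2 : d <= (eta / 4) ^+ 2 by rewrite ge_min lexx orbT.
exists (d / 3); first lra.
set D := d / 3; have D0 : 0 < D by rewrite /D; lra.
move=> y k pk hM hyk.
have sk : star (k - D%:C *: (1 : A)) = k - D%:C *: (1 : A).
  by rewrite starB starZr star1 (pos_sa pk).
have [p [q [[pp pq hpq pq0 qp0] hc]]] := pos_decomp sk.
have [w [w1 w2 sw cw nw]] := pos_inv pp D0.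
have wp : w * p = p * w by exact: cw.
pose e := p * w.
have se : star e = e by rewrite /e starM sw (pos_sa pp) wp.
have qe : q * e = 0 by rewrite /e mulrA qp0 mul0r.
have e1 : 1 - e = D%:C *: w by rewrite /e -{1}w1; ncring.
have ne : nm e <= 1 by [].
pose y1 := y * e.
have kE : e * (k - D%:C *: (1 : A)) * e = e * p * e.
  by rewrite hpq mulrBr mulrBl -(mulrA _ q) qe mulr0 subr0.
have pk1 : pos (e * p * e) by rewrite -{1}se; exact: pos_conj.
have diff : star y1 * y1 - e * p * e = star e * (D%:C *: (1 : A) - (k - star y * y)) * e.
  rewrite -kE /y1 starM se; ncring.
have nm_e x : nm (star e * x * e) <= nm x.
  apply: le_trans (nmM _ _) _; rewrite -[leRHS]mulr1; apply: ler_pM; rewrite ?nm_ge0 //.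
  by apply: le_trans (nmM _ _) _; rewrite nm_star ler_piMl ?nm_ge0.
have pdiff : pos (star y1 * y1 - e * p * e).
  rewrite diff; apply: pos_conj; apply: pos_nm_sub; last by rewrite nmC.
  by rewrite starB starM starK (pos_sa pk).
have ndiff : nm (star y1 * y1 - e * p * e) <= 2 * D.
  rewrite diff; apply: le_trans (nm_e _) _; apply: le_trans (nmB _ _) _.
  have := @nm_scale1 R A D (ltW D0); rewrite nmC in hyk; lra.
have ny1 : nm (star y1 * y1) <= M.
  apply: le_trans hM; rewrite /y1 starM.
  have -> : star e * star y * (y * e) = star e * (star y * y) * e by ncring.
  exact: nm_e.
have nk1 : nm (e * p * e) <= M by apply: le_trans ny1; exact: pos_mono.
have pg := pos_gram y1.
have [y' [g1 g2 g3]] := @gram_factor y1 (bsqrt M (e * p * e)) (bsqrt M (star y1 * y1))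
  (bsqrt_pos M0 pg ny1) (pos_sa (bsqrt_pos M0 pk1 nk1)) (bsqrtK M0 pg ny1)
  ltac:(by rewrite !bsqrtK).
exists y'; split.
- have h1 : nm (y' - y1) <= eta / 2.
    apply: le_trans g2 _; rewrite nmC; apply: hd1 => //.
    by apply: le_trans ndiff _; rewrite /D; lra.
  have h2 : nm (y1 - y) <= eta / 2.
    have n1e : nm (1 - e) <= 2.
      by apply: le_trans (nmB _ _) _; have := nm_le1 A; lra.
    have s1e : star (1 - e) = 1 - e by rewrite starB star1 se.
    have nn x : nm ((1 - e) * x * (1 - e)) <= 4 * nm x.
      apply: le_trans (nmM _ _) _; apply: le_trans (_ : 2 * nm x * 2 <= _); last lra.
      apply: ler_pM; rewrite ?nm_ge0 //.
      by apply: le_trans (nmM _ _) _; rewrite ler_wpM2r ?nm_ge0.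
    rewrite -ler_sqr ?nnegrE ?nm_ge0 //; last lra.
    have -> : nm (y1 - y) = nm (y * (1 - e)).
      by rewrite nmC /y1 mulrBr mulr1.
    rewrite -nm_sq starM s1e.
    have -> : (1 - e) * star y * (y * (1 - e)) = (1 - e) * (star y * y - k) * (1 - e)
       + (1 - e) * k * (1 - e) by ncring.
    apply: le_trans (nmD _ _) _.
    have h3 := le_trans (nn (star y * y - k)) (ler_wpM2l (ler0n _ 4) hyk).
    (* k is at most D + p, and 1 - e = D w makes (1 - e) p small. *)
    have h4 : nm ((1 - e) * k * (1 - e)) <= nm ((1 - e) * (D%:C *: (1 : A) + p) * (1 - e)).
      apply: pos_mono; first by rewrite -{1}s1e; exact: pos_conj.
      have -> : (1 - e) * (D%:C *: (1 : A) + p) * (1 - e) - (1 - e) * k * (1 - e)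
         = (1 - e) * q * (1 - e).
        rewrite -mulrBl -mulrBr; congr (_ * _ * _).
        have -> : k = p - q + D%:C *: (1 : A) by rewrite -hpq subrK.
        ncring.
      by rewrite -{1}s1e; exact: pos_conj.
    have h5 : nm ((1 - e) * (D%:C *: (1 : A) + p) * (1 - e)) <= 4 * D + 2 * D.
      have -> : (1 - e) * (D%:C *: (1 : A) + p) * (1 - e) =
        (1 - e) * (D%:C *: (1 : A)) * (1 - e) + (1 - e) * p * (1 - e) by ncring.
      apply: le_trans (nmD _ _) _; apply: lerD.
        apply: le_trans (nn _) _; apply: ler_wpM2l => //.
        by apply: nm_scale1; exact: ltW.
      apply: le_trans (nmM _ _) _; rewrite mulrC; apply: ler_pM; rewrite ?nm_ge0 //.
      by rewrite e1 -cscaleAl wp nmZr (ger0_norm (ltW D0)) ler_piMr // ltW.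
    have -> : (eta / 2) ^+ 2 = 4 * (eta / 4) ^+ 2 by field.
    rewrite /D in h3 h5 *; lra.
  have -> : y' - y = (y' - y1) + (y1 - y) by rewrite addrA subrK.
  by apply: le_trans (nmD _ _) _; lra.
- move=> x kx; rewrite g1 bsqrtK //.
  have [px _] : p * x = x * p /\ q * x = x * q.
    by apply: hc; rewrite mulrBl mulrBr kx -cscaleAl -cscaleAr mul1r mulr1.
  have wx : w * x = x * w by exact: cw.
  have ex : e * x = x * e by rewrite /e -mulrA wx mulrA px mulrA.
  by rewrite -mulrA ex mulrA -(mulrA e) px mulrA ex !mulrA.
- by move=> z zy; apply: g3; rewrite /y1 mulrA zy.
Qed.

End Exactify.

(** * Matrices over a C*-algebra *)

Lemma sum_pairE (V : nmodType) (K G : finType) (F : K * G -> V) :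
  \sum_p F p = \sum_k \sum_g F (k, g).
Proof. by rewrite pair_big /=; apply: eq_bigr => -[]. Qed.

Section HilbertModule.
Variables (R : realType) (A : cstarType R) (I : finType).
Implicit Types (v w : I -> A).

Definition ip v w : A := \sum_i star (v i) * w i.
Definition hn v : R := Num.sqrt (nm (ip v v)).

Lemma ip_pos v : pos (ip v v).
Proof. by apply: pos_sum => i _; exact: pos_gram. Qed.

Lemma hn_ge0 v : 0 <= hn v. Proof. exact: sqrtr_ge0. Qed.

Lemma hn_sq v : hn v ^+ 2 = nm (ip v v).
Proof. by rewrite sqr_sqrtr // nm_ge0. Qed.

Lemma ip_star v w : star (ip v w) = ip w v.
Proof. by rewrite star_sum; apply: eq_bigr => i _; rewrite starM starK. Qed.

Lemma ipDl v v' w : ip (fun i => v i + v' i) w = ip v w + ip v' w.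
Proof. by rewrite -big_split; apply: eq_bigr => i _; rewrite starD mulrDl. Qed.

Lemma ipDr v w w' : ip v (fun i => w i + w' i) = ip v w + ip v w'.
Proof. by rewrite -big_split; apply: eq_bigr => i _; rewrite mulrDr. Qed.

Lemma ipMr v w a : ip v (fun i => w i * a) = ip v w * a.
Proof. by rewrite mulr_suml; apply: eq_bigr => i _; rewrite mulrA. Qed.

Lemma ipMl v w a : ip (fun i => v i * a) w = star a * ip v w.
Proof. by rewrite mulr_sumr; apply: eq_bigr => i _; rewrite starM mulrA. Qed.

(** With a = <v, w> and s slightly larger than the norm of <v, v>, positivity of <v a - s w, v a - s
    w> gives s a^* a <= s^2 <w, w>. The excess 1 / (n + 1) keeps s invertible. *)
Lemma cauchy_schwarz v w : nm (ip v w) <= hn v * hn w.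
Proof.
rewrite -ler_sqr ?nnegrE ?mulr_ge0 ?nm_ge0 ?hn_ge0 // exprMn !hn_sq.
set a := ip v w; set t := nm (ip v v); have t0 : 0 <= t := nm_ge0 _.
apply: (@le_inv_lim R _ _ (nm (ip w w))) => n.
have i0 : 0 < n.+1%:R^-1 :> R by rewrite invr_gt0 ltr0n.
set s := t + n.+1%:R^-1; have s0 : 0 < s by apply: ltr_wpDl.
have p1 := ip_pos (fun i => v i * a + w i * (- (s%:C *: (1 : A)))).
rewrite ipDl !ipDr !ipMl !ipMr -/a -[ip w v]ip_star -/a in p1.
have p2 : pos (star a * (s%:C *: (1 : A) - ip v v) * a).
  apply: pos_conj; apply: pos_nm_sub; first exact: pos_sa (ip_pos v).
  by rewrite /s lerDl ltW.
have p3 : pos ((s ^+ 2)%:C *: ip w w - s%:C *: (star a * a)).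
  have := posD p1 p2; congr pos.
  rewrite starN starZr star1; ncring.
have := pos_mono (posZ (ltW s0) (pos_gram a)) p3.
rewrite !nmZr !ger0_norm ?sqr_ge0 ?(ltW s0) // nm_sq expr2 -mulrA ler_pM2l //.
by rewrite /s mulrDl (mulrC _^-1).
Qed.

Lemma hnD v w : hn (fun i => v i + w i) <= hn v + hn w.
Proof.
rewrite -ler_sqr ?nnegrE ?addr_ge0 ?hn_ge0 // hn_sq ipDl !ipDr sqrrD !hn_sq.
have h1 := cauchy_schwarz v w; have h2 := cauchy_schwarz w v.
have := nmD (ip v v + ip v w) (ip w v + ip w w).
have := nmD (ip v v) (ip v w); have := nmD (ip w v) (ip w w).
rewrite (mulrC (hn w)) in h2; lra.
Qed.

Lemma hnZ (c : R[i]) v : hn (fun i => c *: v i) = complex.Re `|c| * hn v.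
Proof.
have c0 : 0 <= complex.Re `|c| by rewrite normc_def /= sqrtr_ge0.
have cE : `|c| = (complex.Re `|c|)%:C by rewrite normc_def.
have e : ip (fun i => c *: v i) (fun i => c *: v i) = (Num.conj c * c) *: ip v v.
  rewrite scaler_sumr; apply: eq_bigr => i _.
  by rewrite starZ -cscaleAl -cscaleAr scalerA.
apply/eqP; rewrite -(@eqrXn2 _ 2) ?mulr_ge0 ?hn_ge0 // exprMn !hn_sq e nmZ.
by rewrite normrM norm_conjC {1 2}cE -rmorphM /= expr2.
Qed.

Lemma hn_coord v i : nm (v i) <= hn v.
Proof.
rewrite -ler_sqr ?nnegrE ?nm_ge0 ?hn_ge0 // hn_sq -nm_sq; apply: pos_mono; first exact: pos_gram.
rewrite /ip (bigD1 i) //= addrAC subrr add0r; apply: pos_sum => j _; exact: pos_gram.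
Qed.

Lemma hn_le_sum v : hn v <= \sum_i nm (v i).
Proof.
have S0 : 0 <= \sum_i nm (v i) by apply: sumr_ge0 => i _; exact: nm_ge0.
rewrite -ler_sqr ?nnegrE ?hn_ge0 // hn_sq; apply: le_trans (nm_sum _ _ _) _.
rewrite expr2 mulr_suml; apply: ler_sum => i _.
rewrite nm_sq expr2 ler_wpM2l ?nm_ge0 // (bigD1 i) //= lerDl.
by apply: sumr_ge0 => j _; exact: nm_ge0.
Qed.

Lemma hn_eq0 v : hn v = 0 -> forall i, v i = 0.
Proof. by move=> h i; apply: nm_le0; rewrite -h hn_coord. Qed.

End HilbertModule.

(* Families, indexed by [K], of [G x G] matrices over [A]: the direct sum of
   [#|K|] copies of the matrix algebra, acting on the Hilbert module over
   [K * G]. *)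
Definition blk (R : realType) (K G : finType) (A : cstarType R) : Type :=
  {ffun K * G * G -> A}.

HB.instance Definition _ (R : realType) (K G : finType) (A : cstarType R) :=
  GRing.Lmodule.copy (blk K G A) {ffun K * G * G -> A}.

Section BlockAlgebra.
Variables (R : realType) (K G : finType) (A : cstarType R).
Implicit Types (x y z : blk K G A) (v w : K * G -> A).

Definition blk_fun x : K * G * G -> A := (x : {ffun K * G * G -> A}).

Definition blk_of (f : K -> G -> G -> A) : blk K G A :=
  [ffun p => f p.1.1 p.1.2 p.2].

Lemma blk_ofE f k g h : blk_fun (blk_of f) (k, g, h) = f k g h.
Proof. by rewrite /blk_fun /blk_of ffunE. Qed.

Lemma blk_ext x y : (forall k g h, blk_fun x (k, g, h) = blk_fun y (k, g, h)) -> x = y.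
Proof. by move=> e; apply/ffunP => -[[k g] h]; exact: e. Qed.

Lemma blk_funD x y p : blk_fun (x + y) p = blk_fun x p + blk_fun y p.
Proof. by rewrite /blk_fun ffunE. Qed.

Lemma blk_funN x p : blk_fun (- x) p = - blk_fun x p.
Proof. by rewrite /blk_fun ffunE. Qed.

Lemma blk_funZ (c : R[i]) x p : blk_fun (c *: x) p = c *: blk_fun x p.
Proof. by rewrite /blk_fun ffunE. Qed.

Definition blk_mul x y := blk_of (fun k g h =>
  \sum_m blk_fun x (k, g, m) * blk_fun y (k, m, h)).
Definition blk_one := blk_of (fun k g h => if g == h then 1 else 0).
Definition blk_star x := blk_of (fun k g h => star (blk_fun x (k, h, g))).

Lemma blk_mulA : associative blk_mul.
Proof.
move=> x y z; apply: blk_ext => k g h; rewrite !blk_ofE.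
under eq_bigr do rewrite blk_ofE mulr_sumr.
rewrite exchange_big /=; apply: eq_bigr => m _; rewrite blk_ofE mulr_suml.
by apply: eq_bigr => l _; rewrite mulrA.
Qed.

Lemma blk_mul1l : left_id blk_one blk_mul.
Proof.
move=> x; apply: blk_ext => k g h; rewrite blk_ofE (bigD1 g) //= blk_ofE eqxx mul1r.
rewrite big1 ?addr0 // => m mg; by rewrite blk_ofE eq_sym (negbTE mg) mul0r.
Qed.

Lemma blk_mul1r : right_id blk_one blk_mul.
Proof.
move=> x; apply: blk_ext => k g h; rewrite blk_ofE (bigD1 h) //= blk_ofE eqxx mulr1.
by rewrite big1 ?addr0 // => m mg; rewrite blk_ofE (negbTE mg) mulr0.
Qed.

Lemma blk_mulDl : left_distributive blk_mul +%R.
Proof.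
move=> x y z; apply: blk_ext => k g h; rewrite blk_funD !blk_ofE -big_split.
by apply: eq_bigr => m _; rewrite blk_funD mulrDl.
Qed.

Lemma blk_mulDr : right_distributive blk_mul +%R.
Proof.
move=> x y z; apply: blk_ext => k g h; rewrite blk_funD !blk_ofE -big_split.
by apply: eq_bigr => m _; rewrite blk_funD mulrDr.
Qed.

Lemma blk_scaleAl (c : R[i]) x y : c *: blk_mul x y = blk_mul (c *: x) y.
Proof.
apply: blk_ext => k g h; rewrite blk_funZ !blk_ofE scaler_sumr.
by apply: eq_bigr => m _; rewrite blk_funZ cscaleAl.
Qed.

Lemma blk_scaleAr (c : R[i]) x y : c *: blk_mul x y = blk_mul x (c *: y).
Proof.
apply: blk_ext => k g h; rewrite blk_funZ !blk_ofE scaler_sumr.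
by apply: eq_bigr => m _; rewrite blk_funZ cscaleAr.
Qed.

Lemma blk_starK : involutive blk_star.
Proof. by move=> x; apply: blk_ext => k g h; rewrite !blk_ofE starK. Qed.

Lemma blk_starD : {morph blk_star : x y / x + y}.
Proof. by move=> x y; apply: blk_ext => k g h; rewrite blk_funD !blk_ofE blk_funD starD. Qed.

Lemma blk_starZ (c : R[i]) x : blk_star (c *: x) = Num.conj c *: blk_star x.
Proof. by apply: blk_ext => k g h; rewrite blk_funZ !blk_ofE blk_funZ starZ. Qed.

Lemma blk_starM x y : blk_star (blk_mul x y) = blk_mul (blk_star y) (blk_star x).
Proof.
apply: blk_ext => k g h; rewrite !blk_ofE star_sum; apply: eq_bigr => m _.
by rewrite !blk_ofE starM.
Qed.

Definition blk_act x v : K * G -> A :=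
  fun p => \sum_h blk_fun x (p, h) * v (p.1, h).

Lemma blk_act_mul x y v : blk_act (blk_mul x y) v = blk_act x (blk_act y v).
Proof.
apply/funext => -[k g]; rewrite /blk_act /=.
under eq_bigr do rewrite blk_ofE mulr_suml.
rewrite exchange_big /=; apply: eq_bigr => m _; rewrite mulr_sumr.
by apply: eq_bigr => h _; rewrite mulrA.
Qed.

Lemma blk_act_adjoint x v w : ip (blk_act x v) w = ip v (blk_act (blk_star x) w).
Proof.
rewrite /ip !sum_pairE; apply: eq_bigr => k _; rewrite /blk_act /=.
under eq_bigr do rewrite star_sum mulr_suml.
rewrite exchange_big /=; apply: eq_bigr => h _; rewrite mulr_sumr.
by apply: eq_bigr => g _; rewrite blk_ofE starM mulrA.
Qed.

(** The bounds defining the operator norm on the Hilbert module. It is equivalent to the sum of the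
    norms of the entries, but that sum would not satisfy the C*-identity. *)
Definition blk_bounds x : set R :=
  [set t | 0 <= t /\ forall v, hn (blk_act x v) <= t * hn v].
Definition bnm x : R := inf (blk_bounds x).

Lemma blk_sum_bound x : blk_bounds x (\sum_p nm (blk_fun x p)).
Proof.
split; first by apply: sumr_ge0 => p _; exact: nm_ge0.
move=> v; apply: le_trans (hn_le_sum _) _; rewrite mulr_suml.
rewrite [leRHS]sum_pairE.
apply: ler_sum => p _; apply: le_trans (nm_sum _ _ _) _; apply: ler_sum => h _.
by apply: le_trans (nmM _ _) _; rewrite ler_wpM2l ?nm_ge0 ?hn_coord.
Qed.

Lemma bnm_has_inf x : has_inf (blk_bounds x).
Proof.
split; first by exists (\sum_p nm (blk_fun x p)); exact: blk_sum_bound.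
by exists 0 => t [].
Qed.

Lemma bnm_ge0 x : 0 <= bnm x.
Proof.
apply: lb_le_inf; first by case: (bnm_has_inf x).
by move=> t [].
Qed.

Lemma bnm_le x t : 0 <= t -> (forall v, hn (blk_act x v) <= t * hn v) -> bnm x <= t.
Proof. by move=> t0 h; apply: ge_inf; [case: (bnm_has_inf x) | split]. Qed.

Lemma bnm_act x v : hn (blk_act x v) <= bnm x * hn v.
Proof.
have [h|h] := eqVneq (hn v) 0.
  by rewrite h mulr0; have [_ /(_ v)] := blk_sum_bound x; rewrite h mulr0.
have hp : 0 < hn v by rewrite lt_def h hn_ge0.
rewrite -ler_pdivrMr //; apply: lb_le_inf; first by case: (bnm_has_inf x).
by move=> t [_ /(_ v)]; rewrite -ler_pdivrMr.
Qed.

Lemma bnm_le_sum x : bnm x <= \sum_p nm (blk_fun x p).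
Proof. by have [h1 h2] := blk_sum_bound x; exact: bnm_le. Qed.

Lemma bnm_entry x p : nm (blk_fun x p) <= bnm x.
Proof.
case: p => -[k g] h.
pose v (q : K * G) : A := if q == (k, h) then 1 else 0.
have hv : hn v <= 1.
  have ipv : ip v v = 1.
    rewrite /ip (bigD1 (k, h)) //= /v eqxx star1 mulr1 big1 ?addr0 // => q /negbTE ->.
    by rewrite mulr0.
  by rewrite -(expr_le1 (n := 2)) ?hn_ge0 // hn_sq ipv nm_le1.
have -> : blk_fun x (k, g, h) = blk_act x v (k, g).
  rewrite /blk_act (bigD1 h) //= /v eqxx mulr1 big1 ?addr0 // => m mh.
  by rewrite xpair_eqE eqxx (negbTE mh) mulr0.
apply: le_trans (hn_coord _ _) _; apply: le_trans (bnm_act _ _) _.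
by rewrite ler_piMr // bnm_ge0.
Qed.

Lemma bnm_eq0 x : bnm x = 0 -> x = 0.
Proof.
move=> h; apply: blk_ext => k g h'.
rewrite /blk_fun [RHS]ffunE; apply: nm_le0; rewrite -h; exact: bnm_entry.
Qed.

Lemma bnmD x y : bnm (x + y) <= bnm x + bnm y.
Proof.
apply: bnm_le; first by rewrite addr_ge0 ?bnm_ge0.
move=> v; rewrite mulrDl; apply: le_trans (lerD (bnm_act x v) (bnm_act y v)).
apply: le_trans (hnD _ _).
rewrite (_ : blk_act (x + y) v = fun i => blk_act x v i + blk_act y v i) //.
apply/funext => p; rewrite /blk_act -big_split; apply: eq_bigr => h _.
by rewrite blk_funD mulrDl.
Qed.

Lemma blk_actZ (c : R[i]) x v : blk_act (c *: x) v = fun i => c *: blk_act x v i.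
Proof.
apply/funext => p; rewrite /blk_act scaler_sumr; apply: eq_bigr => h _.
by rewrite blk_funZ -cscaleAl.
Qed.

Lemma bnmZ_le (c : R[i]) x : bnm (c *: x) <= complex.Re `|c| * bnm x.
Proof.
have c0 : 0 <= complex.Re `|c| by rewrite normc_def /= sqrtr_ge0.
apply: bnm_le; first by rewrite mulr_ge0 ?bnm_ge0.
by move=> v; rewrite blk_actZ hnZ -mulrA ler_wpM2l // bnm_act.
Qed.

Lemma bnmZ (c : R[i]) x : bnm (c *: x) = complex.Re `|c| * bnm x.
Proof.
have [->|c0] := eqVneq c 0.
  rewrite scale0r normr0 /= mul0r; apply/eqP; rewrite eq_le bnm_ge0 andbT.
  by apply: bnm_le => // v; rewrite mul0r -(scale0r (0 : blk K G A)) blk_actZ hnZ normr0 mul0r.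
have cp : 0 < complex.Re `|c|.
  have : 0 < `|c| by rewrite normr_gt0.
  by rewrite normc_def ltcR.
apply/eqP; rewrite eq_le bnmZ_le /= mulrC -ler_pdivlMr //.
have {1}-> : x = c^-1 *: (c *: x) by rewrite scalerA mulVf // scale1r.
apply: le_trans (bnmZ_le _ _) _; rewrite mulrC ler_wpM2l ?bnm_ge0 //.
have cE : `|c| = (complex.Re `|c|)%:C by rewrite normc_def.
by rewrite normfV {1}cE -fmorphV.
Qed.

Lemma bnmM x y : bnm (blk_mul x y) <= bnm x * bnm y.
Proof.
apply: bnm_le; first by rewrite mulr_ge0 ?bnm_ge0.
move=> v; rewrite blk_act_mul -mulrA; apply: le_trans (bnm_act _ _) _.
by rewrite ler_wpM2l ?bnm_ge0 ?bnm_act.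
Qed.

(** As <x v, x v> = <v, x^* x v>, Cauchy-Schwarz bounds the square of the norm of x v by that of x^*
    x times the square of the norm of v. *)
Lemma bnm_cstar x : bnm (blk_mul (blk_star x) x) = bnm x ^+ 2.
Proof.
have h y : bnm y ^+ 2 <= bnm (blk_mul (blk_star y) y).
  set t := bnm (blk_mul _ _); have t0 : 0 <= t by exact: bnm_ge0.
  have -> : t = Num.sqrt t ^+ 2 by rewrite sqr_sqrtr.
  rewrite ler_sqr ?nnegrE ?bnm_ge0 ?sqrtr_ge0 //.
  apply: bnm_le; first exact: sqrtr_ge0.
  move=> v; rewrite -ler_sqr ?nnegrE ?mulr_ge0 ?hn_ge0 ?sqrtr_ge0 //.
  rewrite exprMn [X in X <= _]hn_sq sqr_sqrtr // blk_act_adjoint -blk_act_mul.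
  apply: le_trans (cauchy_schwarz _ _) _; rewrite mulrC expr2 mulrA ler_wpM2r ?hn_ge0 //.
  exact: bnm_act.
have hs y : bnm y <= bnm (blk_star y).
  have [->|y0] := eqVneq (bnm y) 0; first exact: bnm_ge0.
  have yp : 0 < bnm y by rewrite lt_def y0 bnm_ge0.
  by rewrite -(ler_pM2r yp) -expr2; apply: le_trans (h y) (bnmM _ _).
apply/eqP; rewrite eq_le h andbT; apply: le_trans (bnmM _ _) _.
rewrite expr2 ler_wpM2r ?bnm_ge0 //.
by apply: le_trans (hs _) _; rewrite blk_starK.
Qed.

End BlockAlgebra.

Section BlockNormed.
Variables (R : realType) (K G : finType) (A : cstarType R).

Lemma bnm_normD (x y : blk K G A) : (bnm (x + y))%:C <= (bnm x)%:C + (bnm y)%:C.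
Proof. by rewrite -rmorphD lecR bnmD. Qed.

Lemma bnm_normZ (c : R[i]) (x : blk K G A) : (bnm (c *: x))%:C = `|c| * (bnm x)%:C.
Proof. by rewrite bnmZ rmorphM /=; congr (_ * _); rewrite normc_def. Qed.

Lemma bnm_norm0 (x : blk K G A) : (bnm x)%:C = 0 -> x = 0.
Proof. by move=> /complexI /bnm_eq0. Qed.

HB.instance Definition _ := Lmodule_isNormed.Build R[i] (blk K G A)
  bnm_normD bnm_normZ bnm_norm0.

Lemma blk_normE (x : blk K G A) : `|x| = (bnm x)%:C.
Proof. by []. Qed.

(** By [bnm_entry] and [bnm_le_sum], convergence in [bnm] is convergence of the finitely many
    entries. *)
Lemma blk_complete (F : set_system (blk K G A)) : ProperFilter F -> cauchy F -> cvg F.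
Proof.
move=> FF hF.
have hp p : cvg ((fun x : blk K G A => (blk_fun x p : cstar_space A)) @ F).
  apply: cauchy_cvg; apply: cauchy_exP => e e0.
  have [x hx] := (cauchyP F).1 hF e e0.
  exists (blk_fun x p); apply: (@filterS _ F _ (ball x e)) hx => y.
  rewrite -!ball_normE /ball_ /= => h; apply: le_lt_trans h.
  have -> : blk_fun x p - blk_fun y p = blk_fun (x - y) p by rewrite blk_funD blk_funN.
  by rewrite -[X in X <= _]/(`|_ : A|) nmE lecR bnm_entry.
pose l : blk K G A := [ffun p => lim ((fun x : blk K G A => (blk_fun x p : cstar_space A)) @ F)].
apply/cvg_ex; exists l; apply/cvgrPdist_lt => e e0.
have [r rE] : exists r : R, e = r%:C.
  exists (complex.Re e); move: e0; rewrite ltcE; case: e => a b /= /andP[/eqP -> _].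
  by [].
rewrite rE ltcR in e0; pose n : R := #|{: K * G * G}|%:R.
have n0 : 0 <= n by rewrite ler0n.
have d0 : 0 < r / (n + 1) by rewrite divr_gt0 //; lra.
have hx : \forall x \near F, forall p, nm (blk_fun (l - x) p) < r / (n + 1).
  apply: filter_forall => p; have /cvgrPdist_lt := hp p.
  move=> /(_ (r / (n + 1))%:C); rewrite ltcR => /(_ d0).
  apply: filterS => x; rewrite -nm_ltc blk_funD blk_funN /blk_fun ffunE; exact.
apply: filterS hx => x h.
rewrite blk_normE rE ltcR; apply: le_lt_trans (bnm_le_sum _) _.
apply: le_lt_trans (_ : \sum_(p : K * G * G) r / (n + 1) < _).
  by apply: ler_sum => p _; exact: ltW.
rewrite sumr_const -mulr_natl -/n mulrCA gtr_pMr // ltr_pdivrMr; lra.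
Qed.

HB.instance Definition _ := Uniform_isComplete.Build (blk K G A) blk_complete.

Lemma blk_normM (x y : blk K G A) : `|blk_mul x y| <= `|x| * `|y|.
Proof. by rewrite !blk_normE -rmorphM lecR bnmM. Qed.

Lemma blk_norm_cstar (x : blk K G A) : `|blk_mul (blk_star x) x| = `|x| ^+ 2.
Proof. by rewrite !blk_normE -rmorphXn bnm_cstar. Qed.

Definition BM : cstarType R := @CstarType R (blk K G A : completeNormedModType R[i])
  (@blk_mul R K G A) (@blk_one R K G A) (@blk_star R K G A)
  (@blk_mulA R K G A) (@blk_mul1l R K G A) (@blk_mul1r R K G A)
  (@blk_mulDl R K G A) (@blk_mulDr R K G A) (@blk_scaleAl R K G A)
  (@blk_scaleAr R K G A) blk_normM (@blk_starK R K G A) (@blk_starD R K G A)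
  (@blk_starZ R K G A) (@blk_starM R K G A) blk_norm_cstar.

Definition ent (x : BM) k g h : A := blk_fun x (k, g, h).
Definition bm (f : K -> G -> G -> A) : BM := blk_of f.

Lemma entE f k g h : ent (bm f) k g h = f k g h. Proof. exact: blk_ofE. Qed.

Lemma bm_ext (x y : BM) : (forall k g h, ent x k g h = ent y k g h) -> x = y.
Proof. exact: blk_ext. Qed.

Lemma entD (x y : BM) k g h : ent (x + y) k g h = ent x k g h + ent y k g h.
Proof. exact: blk_funD. Qed.

Lemma entN (x : BM) k g h : ent (- x) k g h = - ent x k g h.
Proof. exact: blk_funN. Qed.

Lemma entZ (c : R[i]) (x : BM) k g h : ent (c *: x) k g h = c *: ent x k g h.
Proof. exact: blk_funZ. Qed.

Lemma entM (x y : BM) k g h : ent (x * y) k g h = \sum_m ent x k g m * ent y k m h.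
Proof. exact: blk_ofE. Qed.

Lemma ent1 k g h : ent 1 k g h = if g == h then 1 else 0.
Proof. exact: blk_ofE. Qed.

Lemma ent0 k g h : ent 0 k g h = 0.
Proof. by rewrite /ent /blk_fun ffunE. Qed.

Lemma ent_star (x : BM) k g h : ent (star x) k g h = star (ent x k h g).
Proof. exact: blk_ofE. Qed.

Lemma ent_sum (I : Type) (r : seq I) (P : pred I) (F : I -> BM) k g h :
  ent (\sum_(i <- r | P i) F i) k g h = \sum_(i <- r | P i) ent (F i) k g h.
Proof. by elim/big_rec2: _ => [|i y x _ <-]; rewrite ?ent0 ?entD. Qed.

Lemma nm_ent (x : BM) k g h : nm (ent x k g h) <= nm x.
Proof. exact: bnm_entry. Qed.

Lemma nm_BM_le (x : BM) : nm x <= \sum_(p : K * G * G) nm (ent x p.1.1 p.1.2 p.2).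
Proof.
apply: le_trans (@bnm_le_sum R K G A x) _.
by rewrite le_eqVlt; apply/orP; left; apply/eqP; apply: eq_bigr => -[[k g] h] _.
Qed.

End BlockNormed.

Arguments BM {R} K G A.

(** * Completely positive maps *)

Section GramMatrices.
Variables (R : realType) (A : cstarType R).

(** The condition of [mx_positive] over any finite index type, so that pairs can serve as indices.
    In [gposP] the single block [unit] turns [BM] into M_I(A). *)
Definition gpos (I : finType) (x : I -> I -> A) : Prop :=
  exists y : I -> I -> A, forall i j, x i j = \sum_k star (y k i) * y k j.

Lemma gposP (I : finType) (x : I -> I -> A) :
  gpos x <-> pos (bm (fun _ : unit => x)).
Proof.
rewrite -posP; split=> [[y hy]|[y hy]].
  exists (bm (fun _ => y)); apply: bm_ext => k g h; rewrite entM entE hy.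
  by apply: eq_bigr => m _; rewrite ent_star !entE.
exists (ent y tt) => i j; rewrite -(entE (fun _ : unit => x) tt) hy entM.
by apply: eq_bigr => m _; rewrite ent_star.
Qed.

(** The array v may be rectangular, whereas [gpos] asks for a square factor. The sum of the rank one
    matrices v_c^* v_c is positive in M_I(A), hence has one. *)
Lemma gram_gpos (I J : finType) (v : J -> I -> A) :
  gpos (fun i j => \sum_c star (v c i) * v c j).
Proof.
apply/gposP; have -> : bm (fun (_ : unit) i j => \sum_c star (v c i) * v c j) =
    \sum_c bm (fun (_ : unit) i j => star (v c i) * v c j).
  apply: bm_ext => k g h; rewrite ent_sum entE.
  by apply: eq_bigr => c _; rewrite entE.
apply: pos_sum => c _; apply/gposP.
(* A single vector is stored in row [i0]; an empty index set offers no row. *)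
case: (pickP (xpredT : pred I)) => [i0 _|I0].
  exists (fun k i => if k == i0 then v c i else 0) => i j.
  rewrite (bigD1 i0) //= eqxx big1 ?addr0 // => k /negbTE ->.
  by rewrite mulr0.
by exists (fun _ _ => 0) => i; have := I0 i.
Qed.

Lemma mx_positiveP n (x : 'M[A]_n) : mx_positive x <-> gpos (fun i j => x i j).
Proof.
split=> [[y ->]|[y hy]].
  exists (fun i j => y i j) => i j; rewrite !mxE.
  by apply: eq_bigr => k _; rewrite !mxE.
exists (\matrix_(i, j) y i j); apply/matrixP => i j; rewrite hy !mxE.
by apply: eq_bigr => k _; rewrite !mxE.
Qed.

End GramMatrices.

Section CompletelyPositive.
Variables (R : realType) (A B : cstarType R) (phi : {linear A -> B}).

Lemma cp_of_gpos :
  (forall n (x : 'I_n -> 'I_n -> A), gpos x -> gpos (fun i j => phi (x i j))) ->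
  completely_positive phi.
Proof.
move=> h n x /mx_positiveP /h [y hy]; apply/mx_positiveP; exists y => i j.
by rewrite mxE hy.
Qed.

Hypothesis cp : completely_positive phi.

Lemma cp_gpos (I : finType) (x : I -> I -> A) :
  gpos x -> gpos (fun i j => phi (x i j)).
Proof.
move=> [y hy]; pose n := #|I|.
have re (V : nmodType) (F : I -> V) : \sum_(k : I) F k = \sum_(k < n) F (enum_val k).
  rewrite (reindex (@enum_val I xpredT)) //.
  by exists enum_rank => i _; rewrite ?enum_valK ?enum_rankK.
have : mx_positive (\matrix_(i < n, j < n) x (enum_val i) (enum_val j)).
  apply/mx_positiveP; exists (fun k j => y (enum_val k) (enum_val j)) => i j.
  by rewrite mxE hy re.
move/cp/mx_positiveP => [w hw].
exists (fun k i => w (enum_rank k) (enum_rank i)) => i j.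
have := hw (enum_rank i) (enum_rank j); rewrite !mxE !enum_rankK => ->.
by rewrite re; apply: eq_bigr => k _; rewrite enum_valK.
Qed.

Lemma cp_pos x : pos x -> pos (phi x).
Proof.
move=> /posP [y ->].
have [|w hw] := @cp_gpos unit (fun _ _ => star y * y).
  by exists (fun _ _ => y) => _ _; rewrite (bigD1 tt) //= big1 ?addr0 // => -[].
by rewrite (hw tt tt); apply: pos_sum => k _; exact: pos_gram.
Qed.

(* The matrix [[1, x], [x^*, t^2]] is positive for [t = nm x]. *)
Lemma cp_offdiag x : exists (w : bool -> bool -> B),
  [/\ phi 1 = ip (w^~ true) (w^~ true),
      phi x = ip (w^~ true) (w^~ false),
      phi (star x) = ip (w^~ false) (w^~ true) &
      phi ((nm x ^+ 2)%:C *: (1 : A)) = ip (w^~ false) (w^~ false)].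
Proof.
have /posP [z hz] := gram_le_nm (lexx (nm x)).
pose y (k i : bool) : A := if k then (if i then 1 else x) else (if i then 0 else z).
have [|w hw] := @cp_gpos _ (fun i j => \sum_k star (y k i) * y k j); first by exists y.
have e i j : phi (\sum_k star (y k i) * y k j) = ip (w^~ i) (w^~ j) by exact: hw.
exists w; split; rewrite -e big_bool /=.
- by rewrite star1 star0 mulr0 addr0 mulr1.
- by rewrite star1 star0 mul0r addr0 mul1r.
- by rewrite mulr0 addr0 mulr1.
- by rewrite -hz addrC subrK.
Qed.

(** Cauchy-Schwarz for the Gram vectors of [cp_offdiag]. From here on, contractivity of a completely
    positive map is checked at 1. *)
Lemma cp_nm x : nm (phi x) <= nm (phi 1) * nm x.
Proof.
have [w [h1 h2 _ h4]] := cp_offdiag x.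
rewrite h2; apply: le_trans (cauchy_schwarz _ _) _.
rewrite -ler_sqr ?nnegrE ?mulr_ge0 ?hn_ge0 ?nm_ge0 // exprMn !hn_sq -h1 -h4.
rewrite linearZ /= nmZr ger0_norm ?sqr_ge0 //.
by rewrite le_eqVlt; apply/orP; left; apply/eqP; ring.
Qed.

Lemma cp_star x : phi (star x) = star (phi x).
Proof. by have [w [_ -> -> _]] := cp_offdiag x; rewrite ip_star. Qed.

(** For the pair a = y^*, x the values phi (a_i^* a_j) are inner products of Gram vectors. If phi
    (x^* x) k = 0, the vector of x is killed by k, and so is its product with that of y^*. *)
Lemma cp_kernel x y k : phi (star x * x) * k = 0 -> phi (y * x) * k = 0.
Proof.
move=> h.
pose a (i : bool) : A := if i then star y else x.
have [|w hw] := @cp_gpos _ (fun i j => star (a i) * a j).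
  have [v hv] := @gram_gpos R A bool unit (fun _ => a).
  by exists v => i j; rewrite -hv (bigD1 tt) //= big1 ?addr0 // => -[].
have h0 : ip (fun c => w c false * k) (fun c => w c false * k) = 0.
  rewrite ipMl ipMr /ip -(hw false false) /= /a -/a.
  by rewrite h mulr0.
have wk c : w c false * k = 0.
  apply: (@hn_eq0 _ _ _ (fun c => w c false * k)).
  by rewrite /hn h0 nm0 sqrtr0.
have := hw true false; rewrite /a starK => ->; rewrite mulr_suml big1 // => c _.
by rewrite -mulrA wk mulr0.
Qed.

End CompletelyPositive.

(** * Finite-dimensional C*-algebras *)

Section FiniteDimensional.
Variables (R : realType) (F : cstarType R).
Implicit Types (a x y : F).

(** For self-adjoint a the norm of a^(2^j) is the norm of a to the power 2^j. *)
Lemma sa_nilpotent a k : star a = a -> a ^+ k = 0 -> a = 0.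
Proof.
move=> sa ak.
have sX n : star (a ^+ n) = a ^+ n.
  by elim: n => [|n ih]; rewrite ?star1 // exprS starM ih sa -exprSr -exprS.
have h j : nm (a ^+ (2 ^ j)) = nm a ^+ (2 ^ j).
  elim: j => [|j ih]; first by rewrite !expr1.
  by rewrite expnSr !exprM -ih -[LHS]/(nm (_ * _)) nm_sa_sq.
apply: nm_eq0; apply/eqP.
have -> : (nm a == 0) = (nm a ^+ (2 ^ k) == 0) by rewrite expf_eq0 expn_gt0.
have kl : (k <= 2 ^ k)%N by apply: ltnW; apply: ltn_expl.
by rewrite -h -(subnKC kl) exprD ak mul0r nm0.
Qed.

Lemma pos_scale_real (z : R[i]) (b : F) : b <> 0 -> star b = b -> star (z *: b) = z *: b ->
  Num.conj z = z.
Proof.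
move=> b0 sb; rewrite starZ sb => h; apply/eqP; rewrite -subr_eq0; apply/eqP.
apply: contrapT => /eqP z0; apply: b0.
have : (Num.conj z - z) *: b = 0 by rewrite scalerBl h subrr.
by move/(congr1 (fun u => (Num.conj z - z)^-1 *: u)); rewrite scalerA mulVf // scale1r scaler0.
Qed.

Lemma conj_realP (z : R[i]) : Num.conj z = z -> z = (complex.Re z)%:C.
Proof.
case: z => u v /eqP; rewrite eq_complex /= => /andP[_ /eqP h].
have -> : v = 0 by lra.
by [].
Qed.

Lemma pos_scale_ge0 (z : R[i]) (b : F) : b <> 0 -> pos b -> pos (z *: b) -> 0 <= z.
Proof.
move=> b0 pb pz; have zr := pos_scale_real b0 (pos_sa pb) (pos_sa pz).
rewrite (conj_realP zr) in pz *; set r := complex.Re z in pz *.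
rewrite ler0c leNgt; apply/negP => r0.
have h : r%:C *: b = 0.
  apply: pos_anti => //; rewrite -scaleNr -rmorphN; apply: posZ => //; lra.
have rn : r != 0 by rewrite lt_eqF.
by apply: b0; rewrite -(scaleVK b rn) h scaler0.
Qed.

Section Frame.
Variables (m' : nat).
Local Notation m := m'.+1.
Variables (v : {linear F -> 'rV[R[i]]_m}) (vi : 'rV[R[i]]_m -> F).
Hypotheses (vK : cancel v vi) (viK : cancel vi v).

Lemma vi_linear (c : R[i]) u w : vi (c *: u + w) = c *: vi u + vi w.
Proof. by rewrite -[u in LHS]viK -[w in LHS]viK -linearP vK. Qed.

Lemma vi0 : vi 0 = 0.
Proof. by rewrite -(linear0 v) vK. Qed.

Lemma vi_sum (I : Type) (r : seq I) (P : pred I) (c : I -> R[i]) (u : I -> 'rV_m) :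
  vi (\sum_(i <- r | P i) c i *: u i) = \sum_(i <- r | P i) c i *: vi (u i).
Proof.
by elim/big_rec2: _ => [|i x y _ <-]; [exact: vi0 | rewrite vi_linear].
Qed.

(** Left multiplication by x in the coordinates v. Acting on row vectors, it reverses products. *)
Definition lmx x : 'M[R[i]]_m := \matrix_(i, j) v (x * vi (delta_mx 0 i)) 0 j.

Lemma lmxE x y : v (x * y) = v y *m lmx x.
Proof.
rewrite -{1}[y]vK {1}[v y]row_sum_delta vi_sum mulr_sumr linear_sum /=.
apply/rowP => j; rewrite summxE !mxE; apply: eq_bigr => i _.
by rewrite -cscaleAr linearZ /= !mxE.
Qed.

Lemma lmx_eq x (M : 'M[R[i]]_m) : (forall y, v (x * y) = v y *m M) -> lmx x = M.
Proof.
move=> h; apply/row_matrixP => i; rewrite !rowE -[delta_mx 0 i]viK -lmxE h.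
by [].
Qed.

Lemma lmxM x y : lmx (x * y) = lmx y *m lmx x.
Proof. by apply: lmx_eq => z; rewrite -mulrA !lmxE mulmxA. Qed.

Lemma lmxP (c : R[i]) x y : lmx (c *: x + y) = c *: lmx x + lmx y.
Proof.
apply: lmx_eq => z; rewrite mulrDl -cscaleAl linearP /= !lmxE mulmxDr.
by rewrite -scalemxAr.
Qed.

Lemma lmx_inj x y : lmx x = lmx y -> x = y.
Proof.
by move=> h; rewrite -[x]vK -[y]vK -[x]mulr1 -[y]mulr1 !lmxE h.
Qed.

Lemma lmx0 : lmx 0 = 0.
Proof. by apply: lmx_eq => y; rewrite mul0r linear0 mulmx0. Qed.

Lemma lmx1 : lmx 1 = 1%:M.
Proof. by apply: lmx_eq => y; rewrite mul1r mulmx1. Qed.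

Lemma lmxD x y : lmx (x + y) = lmx x + lmx y.
Proof. by rewrite -[x in LHS]scale1r lmxP scale1r. Qed.

Lemma lmxZ (c : R[i]) x : lmx (c *: x) = c *: lmx x.
Proof. by rewrite -[_ *: x]addr0 lmxP lmx0 addr0. Qed.

(** A trace on F that is positive by [tau_ge0] and faithful by [tau_eq0], obtained without writing F
    as a sum of matrix algebras. *)
Definition tau x : R[i] := \tr (lmx x).

Lemma tauP (c : R[i]) x y : tau (c *: x + y) = c * tau x + tau y.
Proof. by rewrite /tau lmxP mxtraceD mxtraceZ. Qed.

Lemma tau0 : tau 0 = 0. Proof. by rewrite /tau lmx0 mxtrace0. Qed.

Lemma tauD x y : tau (x + y) = tau x + tau y.
Proof. by rewrite -[x in LHS]scale1r tauP mul1r. Qed.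

Lemma tauZ (c : R[i]) x : tau (c *: x) = c * tau x.
Proof. by rewrite -[_ *: _]addr0 tauP tau0 addr0. Qed.

Lemma tauB x y : tau (x - y) = tau x - tau y.
Proof. by rewrite tauD -scaleN1r tauZ mulN1r. Qed.

Lemma tau_sum (I : Type) (r : seq I) (P : pred I) (G : I -> F) :
  tau (\sum_(i <- r | P i) G i) = \sum_(i <- r | P i) tau (G i).
Proof. exact: (big_morph tau tauD tau0). Qed.

Lemma tauC x y : tau (x * y) = tau (y * x).
Proof. by rewrite /tau !lmxM mxtrace_mulC. Qed.

Lemma char_roots a : exists r : seq R[i],
  char_poly (lmx a) = \prod_(z <- r) ('X - z%:P) /\
  forall z, z \in r -> exists2 y, y <> 0 & a * y = z *: y.
Proof.
have [r hr] := closed_field_poly_normal (char_poly (lmx a)).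
have hm := char_poly_monic (lmx a); rewrite (monicP hm) scale1r in hr.
exists r; split=> // z zr.
have : root (char_poly (lmx a)) z by rewrite hr root_prod_XsubC.
rewrite -eigenvalue_root_char => /eigenvalueP [u hu u0].
exists (vi u); first by move=> h; move/eqP: u0; apply; rewrite -[u]viK h linear0.
by rewrite -[LHS]vK lmxE viK hu -[_ *: u]addr0 vi_linear vi0 addr0.
Qed.

Lemma tau_roots a (r : seq R[i]) : char_poly (lmx a) = \prod_(z <- r) ('X - z%:P) ->
  tau a = \sum_(z <- r) z.
Proof.
move=> hr.
have sr : size r = m.
  by have := size_char_poly (lmx a); rewrite hr size_prod_XsubC => -[].
apply: oppr_inj; rewrite -(char_poly_trace _ (ltn0Sn m')) hr -coefPn_prod_XsubC ?sr //.
Qed.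

Lemma pos_roots a (z : R[i]) y : pos a -> y <> 0 -> a * y = z *: y -> 0 <= z.
Proof.
move=> pa y0 h; apply: (@pos_scale_ge0 z (star y * y)).
- by move=> e; apply: y0; apply: nm_eq0; apply/eqP; rewrite -sqrf_eq0 -nm_sq e nm0.
- exact: pos_gram.
- by rewrite cscaleAr -h mulrA; exact: pos_conj.
Qed.

Lemma tau_ge0 a : pos a -> 0 <= tau a.
Proof.
move=> pa; have [r [hr he]] := char_roots a; rewrite (tau_roots hr).
by rewrite big_seq; apply: sumr_ge0 => z /he [y y0 hy]; exact: pos_roots hy.
Qed.

(** Polynomials in [lmx a] are left multiplications again, and the adjoint conjugates the
    coefficients; this carries spectral arguments on matrices back to F. *)
Lemma horner_lmx a : star a = a -> forall p : {poly R[i]}, exists x,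
  lmx x = horner_mx (lmx a) p /\
  lmx (star x) = horner_mx (lmx a) (map_poly Num.conj p).
Proof.
move=> sa; elim/poly_ind => [|p c [x [h1 h2]]].
  by exists 0; rewrite star0 lmx0 map_poly0 rmorph0.
exists (a * x + c *: (1 : F)); split.
  rewrite lmxD lmxM lmxZ lmx1 h1 rmorphD rmorphM /= horner_mx_X horner_mx_C.
  by rewrite scalemx1.
rewrite starD starM starZ star1 sa lmxD lmxM lmxZ lmx1 h2 scalemx1.
rewrite !(rmorphD, rmorphM) /= map_polyX map_polyC /= horner_mx_X horner_mx_C.
congr (_ + _); transitivity (horner_mx (lmx a) ('X * map_poly Num.conj p)).
  by rewrite rmorphM /= horner_mx_X.
by rewrite mulrC rmorphM /= horner_mx_X.
Qed.

Lemma lmxX a k : lmx (a ^+ k) = lmx a ^+ k.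
Proof.
elim: k => [|k ih]; first exact: lmx1.
by rewrite exprSr lmxM ih exprS.
Qed.

(** The eigenvalues of left multiplication by x^* x are nonnegative with sum 0, so the
    characteristic polynomial is a power of X and x^* x is nilpotent by Cayley-Hamilton. *)
Lemma tau_eq0 x : tau (star x * x) = 0 -> x = 0.
Proof.
move=> t0; set a := star x * x in t0.
have pa : pos a := pos_gram x.
have [r [hr he]] := char_roots a.
have r0 z : z \in r -> z = 0.
  move: t0; rewrite (tau_roots hr) big_seq => /eqP.
  rewrite psumr_eq0; last by move=> i /he [y y0 hy]; exact: pos_roots hy.
  by move=> /allP h zr; have /implyP/(_ zr)/eqP := h _ zr.
have hX : char_poly (lmx a) = 'X ^+ size r.
  rewrite hr big_seq (eq_bigr (fun _ => 'X)); last by move=> z /r0 ->; rewrite subr0.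
  by rewrite -big_seq big_const_seq count_predT iter_mulr_1.
have : a = 0.
  apply: (@sa_nilpotent a (size r)); first exact: pos_sa.
  apply: lmx_inj; rewrite lmx0 lmxX -{1}[lmx a]horner_mx_X -rmorphXn -hX.
  exact: Cayley_Hamilton.
by move=> a0; apply: nm_eq0; apply/eqP; rewrite -sqrf_eq0 -nm_sq -/a a0 nm0.
Qed.

Lemma tau_star x : tau (star x) = Num.conj (tau x).
Proof.
have hsa y : star y = y -> Num.conj (tau y) = tau y.
  move=> sy; have [p [q [[pp pq -> _ _] _]]] := pos_decomp sy.
  by rewrite tauB rmorphB /= !conj_Creal // ger0_real // tau_ge0.
pose h1 := x + star x; pose h2 := 'i%C *: (x - star x).
have i2 : 'i%C * 'i%C = -1 :> R[i] by rewrite -expr2 sqr_i.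
have conji : Num.conj 'i%C = - 'i%C :> R[i] by apply/eqP; rewrite eq_complex /= oppr0 !eqxx.
have s1 : star h1 = h1 by rewrite /h1 starD starK addrC.
have s2 : star h2 = h2 by rewrite /h2 starZ starB starK conji scaleNr -scalerN opprB.
have e1 : x = (2^-1)%:C *: (h1 - 'i%C *: h2).
  rewrite /h1 /h2; transitivity ((2^-1)%:C *: ((x + star x) - ('i%C * 'i%C) *: (x - star x))).
    rewrite i2; ncring.
  ncring.
clearbody h1 h2; rewrite e1 starZr starB starZ s1 s2 conji !(tauZ, tauB) rmorphM rmorphB rmorphM /=.
by rewrite !hsa // conjCr conji.
Qed.

(** F is spanned by its projections. For self-adjoint a, the product p of the linear factors at the
    distinct eigenvalues annihilates a, so a polynomial in a is determined by its values there, and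
    the Lagrange polynomials [l z] yield the spectral projections. *)
Lemma proj_ind (P : F -> Prop) :
  (forall (c : R[i]) x y, P x -> P y -> P (c *: x + y)) ->
  (forall p, star p = p -> p * p = p -> P p) -> forall x, P x.
Proof.
move=> Plin Pproj.
have P0 : P 0 by apply: Pproj; rewrite ?star0 ?mulr0.
have Psum (I : Type) (l : seq I) (Q : pred I) (c : I -> R[i]) (G : I -> F) :
    (forall i, Q i -> P (G i)) -> P (\sum_(i <- l | Q i) c i *: G i).
  by move=> h; elim/big_rec: _ => [|i y /h hi hy]; [exact: P0 | exact: Plin].
have Psa a : star a = a -> P a.
  move=> sa; have [r [hr he]] := char_roots a.
  pose s := undup r.
  have sE z : z \in s -> Num.conj z = z.
    rewrite mem_undup => /he [y y0 hy]; apply: (@pos_scale_real z (star y * y)).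
    - by move=> e; apply: y0; apply: nm_eq0; apply/eqP; rewrite -sqrf_eq0 -nm_sq e nm0.
    - by rewrite starM starK.
    - by rewrite cscaleAr -hy !starM starK sa mulrA.
  pose p := \prod_(z <- s) ('X - z%:P).
  (* The value of p at a is self-adjoint, since the eigenvalues are real, and nilpotent, since the
     characteristic polynomial divides a power of p. *)
  have hp : horner_mx (lmx a) p = 0.
    have [x [x1 x2]] := horner_lmx sa p.
    have px : map_poly Num.conj p = p.
      rewrite /p rmorph_prod /= big_seq [RHS]big_seq; apply: eq_bigr => z /sE zr.
      by rewrite rmorphB /= map_polyX map_polyC /= zr.
    have sx : star x = x by apply: lmx_inj; rewrite x2 px x1.
    have x0 : x ^+ size r = 0.
      apply: lmx_inj; rewrite lmxX x1 lmx0 -rmorphXn.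
      have /dvdpP [q ->] : char_poly (lmx a) %| p ^+ size r.
        have dv t : {subset t <= r} -> \prod_(z <- t) ('X - z%:P) %| p ^+ size t.
          elim: t => [|z t ih] ht; first by rewrite big_nil expr0 dvdpp.
          rewrite big_cons exprS; apply: dvdp_mul.
            by rewrite dvdp_XsubCl root_prod_XsubC mem_undup ht // mem_head.
          by apply: ih => w wt; apply: ht; rewrite inE wt orbT.
        by rewrite hr; exact: dv.
      by rewrite rmorphM /= Cayley_Hamilton mulr0.
    by rewrite -x1 (sa_nilpotent sx x0) lmx0.
  have heq (f g : {poly R[i]}) : (forall z, z \in s -> f.[z] = g.[z]) ->
      horner_mx (lmx a) f = horner_mx (lmx a) g.
    move=> h; apply/eqP; rewrite -subr_eq0 -rmorphB /=.
    have /dvdpP [q ->] : p %| f - g.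
      apply: uniq_roots_dvdp; last by rewrite uniq_rootsE undup_uniq.
      by apply/allP => z /h hz; rewrite rootE !hornerE hz subrr.
    by rewrite rmorphM /= hp mulr0.
  pose pz z := \prod_(w <- rem z s) ('X - w%:P).
  pose l z := ((pz z).[z])^-1 *: pz z.
  have lE0 z w : w \in s -> z != w -> (l z).[w] = 0.
    move=> ws zw; have : root (pz z) w.
      by rewrite root_prod_XsubC mem_rem_uniq ?undup_uniq // inE eq_sym zw.
    by rewrite /l hornerZ rootE => /eqP ->; rewrite mulr0.
  have lE1 z : (l z).[z] = 1.
    rewrite /l hornerZ mulVf // -rootE root_prod_XsubC mem_rem_uniqF //.
    exact: undup_uniq.
  have lE z w : w \in s -> (l z).[w] = (z == w)%:R.
    by move=> ws; case: eqVneq => [->|/lE0 -> //]; exact: lE1.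
  have [e he1] := @choice _ _ _ (fun z => horner_lmx sa (l z)).
  have hconj (f : {poly R[i]}) z : Num.conj z = z ->
      (map_poly Num.conj f).[z] = Num.conj f.[z].
    by move=> zr; rewrite -{1}zr horner_map.
  have -> : a = \sum_(z <- s) z *: e z.
    apply: lmx_inj.
    have -> : lmx (\sum_(z <- s) z *: e z) =
        horner_mx (lmx a) (\sum_(z <- s) z *: l z).
      rewrite rmorph_sum /=; elim/big_rec2: _ => [|z x1 x2 _ h]; first exact: lmx0.
      by rewrite lmxP h linearZ /= (he1 z).1.
    rewrite -{1}[lmx a]horner_mx_X; apply: heq => w ws.
    rewrite hornerX horner_sum (bigD1_seq w) ?undup_uniq //=.
    rewrite hornerZ lE1 mulr1 big1 ?addr0 // => z zw.
    by rewrite hornerZ lE0 // mulr0.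
  rewrite big_seq; apply: Psum => z zs; apply: Pproj; apply: lmx_inj.
    rewrite (he1 z).1 (he1 z).2; apply: heq => w ws.
    rewrite hconj; last exact: sE.
    by rewrite lE //; case: eqP => _; rewrite ?rmorph1 ?rmorph0.
  rewrite lmxM !(he1 z).1 -[_ *m _]/(_ * _) -rmorphM /=; apply: heq => w ws.
  by rewrite hornerM lE //; case: eqP => _; rewrite ?mulr1 ?mulr0.
move=> x; have i2 : 'i%C * 'i%C = -1 :> R[i] by rewrite -expr2 sqr_i.
have conji : Num.conj 'i%C = - 'i%C :> R[i] by apply/eqP; rewrite eq_complex /= oppr0 !eqxx.
have -> : x = (2^-1)%:C *: (x + star x) + ((- (2^-1)%:C * 'i%C) *: ('i%C *: (x - star x)) + 0).
  transitivity ((2^-1)%:C *: (x + star x) - ((2^-1)%:C * ('i%C * 'i%C)) *: (x - star x)).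
    rewrite i2; ncring.
  ncring.
apply: (Plin); first by apply: Psa; rewrite starD starK addrC.
apply: (Plin) => //; apply: Psa.
by rewrite starZ starB starK conji scaleNr -scalerN opprB.
Qed.

Definition orthonormal (b : nat -> F) k := forall i j, (i < k)%N -> (j < k)%N ->
  tau (star (b i) * b j) = (i == j)%:R.

Lemma orthonormal_le b k : orthonormal b k -> (k <= m)%N.
Proof.
move=> hb.
pose P := \matrix_(i < k, l < m) v (b i) 0 l.
pose Q := \matrix_(l < m, j < k) tau (star (b j) * vi (delta_mx 0 l)).
have PQ : P *m Q = 1%:M.
  apply/matrixP => i j; rewrite !mxE -val_eqE eq_sym -(hb j i) //=.
  rewrite -[in RHS](vK (b i)) [in RHS](row_sum_delta (v (b i))) vi_sum mulr_sumr tau_sum.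
  by apply: eq_bigr => l _; rewrite !mxE -cscaleAr tauZ.
have := mxrankM_maxl P Q; rewrite PQ mxrank1 => h.
exact: leq_trans h (rank_leq_col P).
Qed.

(** Gram-Schmidt by contradiction: if no orthonormal system expanded every element, each could be
    extended, beyond the dimension. Families on [nat], with arbitrary values past k, are extended
    without a change of type. *)
Lemma onb_exists : exists n (b : nat -> F), orthonormal b n /\
  forall x, x = \sum_(i < n) tau (star (b i) * x) *: b i.
Proof.
apply: contrapT => no.
have grow k : exists b, orthonormal b k.
  elim: k => [|k [b hb]]; first by exists (fun _ => 0) => i.
  have [x hx] : exists x, x <> \sum_(i < k) tau (star (b i) * x) *: b i.
    apply: contrapT => h; apply: no; exists k, b; split=> // x.
    by apply: contrapT => hx; apply: h; exists x.
  pose y := x - \sum_(i < k) tau (star (b i) * x) *: b i.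
  have y0 : y <> 0 by move=> /eqP; rewrite subr_eq0 => /eqP.
  have by0 i : (i < k)%N -> tau (star (b i) * y) = 0.
    move=> ik; rewrite /y mulrBr tauB mulr_sumr tau_sum (bigD1 (Ordinal ik)) //=.
    rewrite -cscaleAr tauZ hb // eqxx mulr1 big1 ?addr0 ?subrr // => j ji.
    by rewrite -cscaleAr tauZ hb // eq_sym (_ : (j == i :> nat) = false) ?mulr0 //;
      apply/negbTE.
  have ty := tau_ge0 (pos_gram y).
  have tyr := conj_realP (conj_Creal (ger0_real ty)).
  set r := complex.Re _ in tyr.
  have r0 : 0 < r.
    rewrite lt_def -ler0c -tyr ty andbT; apply/eqP => r0.
    by apply: y0; apply: tau_eq0; rewrite tyr r0.
  pose s := (Num.sqrt r)^-1.
  have sr : s * s * r = 1.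
    rewrite /s -invfM -expr2 sqr_sqrtr ?ltW // mulVf // gt_eqF //.
  exists (fun i => if (i < k)%N then b i else s%:C *: y) => i j; rewrite !ltnS => ik jk.
  case: (ltnP i k) => ik'; case: (ltnP j k) => jk'.
  - exact: hb.
  - by rewrite -cscaleAr tauZ by0 // mulr0 ltn_eqF // (leq_trans ik' jk').
  - rewrite starZr -cscaleAl tauZ -[X in tau X]starK tau_star starM starK by0 // rmorph0.
    by rewrite mulr0 gtn_eqF // (leq_trans jk' ik').
  - have -> : i = j by apply/eqP; rewrite eqn_leq (leq_trans ik jk') (leq_trans jk ik').
    rewrite eqxx starZr -cscaleAl -cscaleAr !tauZ tyr -!rmorphM /=.
    by rewrite mulrA sr.
have [b hb] := grow m.+1.
by have := orthonormal_le hb; rewrite ltnn.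
Qed.

(** As [tau] is the trace of left multiplication, computing it in the basis b gives tau x = tau (x
    s) for s the sum of the b_i b_i^*. Faithfulness forces s = 1. *)
Lemma onb_trace n (b : nat -> F) :
  (forall x, x = \sum_(i < n) tau (star (b i) * x) *: b i) ->
  \sum_(i < n) b i * star (b i) = 1.
Proof.
move=> hb.
pose P := \matrix_(i < n, l < m) v (b i) 0 l.
pose Q := \matrix_(l < m, j < n) tau (star (b j) * vi (delta_mx 0 l)).
have hQ u j : (u *m Q) 0 j = tau (star (b j) * vi u).
  rewrite [in RHS](row_sum_delta u) vi_sum mulr_sumr tau_sum !mxE.
  by apply: eq_bigr => l _; rewrite !mxE -cscaleAr tauZ.
have QP : Q *m P = 1%:M.
  apply/row_matrixP => i; rewrite !rowE mulmxA mulmx1.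
  rewrite -[RHS]viK [in RHS](hb (vi _)) linear_sum /=.
  apply/rowP => l; rewrite summxE !mxE; apply: eq_bigr => j _.
  by rewrite hQ linearZ /= !mxE.
have tauE x : tau x = tau (x * \sum_(i < n) b i * star (b i)).
  rewrite /tau -[lmx x in LHS]mulmx1 -QP mulmxA mxtrace_mulC mulmxA mulr_sumr -/(tau _) tau_sum.
  apply: eq_bigr => j _.
  have -> : (P *m lmx x *m Q) j j = (row j (P *m lmx x) *m Q) 0 j.
    by rewrite -row_mul [RHS]mxE.
  rewrite hQ row_mul (_ : row j P = v (b j)); last by apply/rowP => l; rewrite !mxE.
  by rewrite -lmxE vK [in RHS]mulrA [in RHS]tauC.
apply/eqP; rewrite eq_sym -subr_eq0; apply/eqP; apply: tau_eq0.
by rewrite mulrBr mulr1 tauB -tauE subrr.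
Qed.

End Frame.

Lemma findim_cases : fin_dim F -> (forall x, x = 0) \/
  exists m' (v : {linear F -> 'rV[R[i]]_m'.+1}) vi, cancel v vi /\ cancel vi v.
Proof.
move=> [[|m'] [v [vi vK viK]]]; last by right; exists m', v, vi.
by left=> x; rewrite -[x]vK [v x]thinmx0 -[LHS]/(vi 0) -(linear0 v) vK.
Qed.

(* The model is [lam x i j = tau (star (b i) * x * b j)], where [tau] is the trace
   of the left regular representation and [b] is an orthonormal basis for it. *)
Record frame n (b : 'I_n -> F) (lam : F -> 'I_n -> 'I_n -> R[i]) : Prop := Frame {
  frameP : forall (c : R[i]) x y i j, lam (c *: x + y) i j = c * lam x i j + lam y i j;
  frameM : forall x y i j, lam (x * y) i j = \sum_k lam x i k * lam y k j;
  frame_star : forall x i j, lam (star x) i j = Num.conj (lam x j i);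
  frame_dec : forall x, x = \sum_i \sum_j lam x j i *: (b j * star (b i));
  frame_l : forall x i, \sum_k lam x i k *: star (b k) = star (b i) * x;
  frame_r : forall x j, \sum_k lam x k j *: b k = x * b j
}.

(** [frame_dec] is x multiplied by the sum of the b_i b_i^*, with each x b_i expanded in the
    basis. *)
Lemma frame_exists : fin_dim F -> exists n (b : 'I_n.+1 -> F) lam, frame b lam.
Proof.
case/findim_cases => [F0|[m' [v [vi [vK viK]]]]].
  exists 0, (fun _ => 0), (fun _ _ _ => 0); split=> *;
    rewrite ?mulr0 ?addr0 ?rmorph0 ?[RHS]F0 ?[LHS]F0 //.
  by rewrite big1 // => *; rewrite mulr0.
have [n [b0 [_ hb0]]] := onb_exists vK viK.
(* The additional zero vector makes the index set nonempty. *)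
pose b (i : 'I_n.+1) : F := if (i < n)%N then b0 i else 0.
pose t := tau v vi; pose lam x i j := t (star (b i) * (x * b j)).
have bE (i : 'I_n) : b (widen_ord (leqnSn n) i) = b0 i by rewrite /b /= ltn_ord.
have bm' : b ord_max = 0 by rewrite /b /= ltnn.
have hb x : x = \sum_i t (star (b i) * x) *: b i.
  rewrite big_ord_recr /= bm' scaler0 addr0 {1}[x]hb0.
  by apply: eq_bigr => i _; rewrite bE.
have hb1 : \sum_i b i * star (b i) = 1.
  rewrite big_ord_recr /= bm' mul0r addr0 -[RHS](onb_trace vK viK hb0).
  by apply: eq_bigr => i _; rewrite bE.
have fr x j : \sum_k lam x k j *: b k = x * b j by rewrite [RHS]hb.
have hs x y : t (star x * y) = Num.conj (t (star y * x)).
  by rewrite /t -tau_star // starM starK.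
have tZ (c : R[i]) x : t (c *: x) = c * t x by exact: tauZ.
have tS k (u : 'I_k -> F) : t (\sum_i u i) = \sum_i t (u i) by exact: tau_sum.
exists n, b, lam; split.
- move=> c x y i j; rewrite /lam mulrDl mulrDr -cscaleAl -cscaleAr.
  exact: tauP.
- move=> x y i j; rewrite /lam -[x * y * b j]mulrA [y * b j in LHS]hb !mulr_sumr tS.
  apply: eq_bigr => k _; by rewrite -!cscaleAr tZ mulrC.
- move=> x i j; rewrite /lam hs; congr (Num.conj (t _)).
  by rewrite starM starK mulrA.
- move=> x; rewrite exchange_big /= -[LHS]mulr1 -hb1 mulr_sumr exchange_big /=.
  apply: eq_bigr => i _; rewrite mulrA -fr mulr_suml.
  by apply: eq_bigr => j _; rewrite cscaleAl.
- move=> x i; rewrite -[RHS]starK starM starK -[X in star X]/(star x * b i) -fr star_sum.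
  apply: eq_bigr => k _; rewrite starZ; congr (_ *: _).
  by rewrite /lam hs starM -mulrA.
- exact: fr.
Qed.

Lemma findim_proj_ind (P : F -> Prop) : fin_dim F ->
  (forall (c : R[i]) x y, P x -> P y -> P (c *: x + y)) ->
  (forall p, star p = p -> p * p = p -> P p) -> forall x, P x.
Proof.
move=> fd Plin Pproj x; case: (findim_cases fd) => [F0|[m' [v [vi [vK viK]]]]].
  by rewrite [x]F0; apply: Pproj; rewrite ?star0 ?mulr0.
exact: proj_ind vK viK _ Plin Pproj x.
Qed.

End FiniteDimensional.

(** * Order zero maps *)

Lemma linear_exists (R : pzRingType) (U V : lmodType R) (f : U -> V) :
  linear f -> exists g : {linear U -> V}, g =1 f.
Proof.
move=> lf; pose m := GRing.isLinear.Build R U V *:%R f lf.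
pose g : {linear U -> V} := HB.pack f m.
by exists g.
Qed.

Section OrderZero.
Variables (R : realType) (F A : cstarType R) (phi : {linear F -> A}).
Hypotheses (fdF : fin_dim F) (cp : completely_positive phi).
Hypothesis oz : order_zero_on setT phi.

(** This identity is all the structure of order zero maps that is used. By linearity x is a
    projection p; with q = 1 - p, orthogonality of phi p and phi q spreads by [cp_kernel] to phi (z
    q) phi (p y) = 0 and its mirror image, so both sides equal phi (z p) phi (p y). *)
Lemma oz_mul x y z : phi (z * x) * phi y = phi z * phi (x * y).
Proof.
have orth p q : star p = p -> p * p = p -> star q = q -> q * q = q -> q * p = 0 ->
    forall y z, phi (z * q) * phi (p * y) = 0.
  move=> sp pp sq qq qp y' z'.
  have h0 : phi p * phi q = 0.
    apply: oz => //; [by exists p; rewrite sp pp | by exists q; rewrite sq qq|].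
    by rewrite -sp -sq -starM qp star0.
  have h1 : phi (star y' * p) * phi q = 0.
    by apply: (cp_kernel cp); rewrite sp pp.
  apply: (cp_kernel cp); rewrite sq qq.
  have -> : p * y' = star (star y' * p) by rewrite starM starK sp.
  by rewrite cp_star // -[phi q](congr1 phi sq) cp_star // -starM h1 star0.
move: x y z; apply: (findim_proj_ind fdF).
  move=> c x x' hx hx' y z.
  by rewrite mulrDr mulrDl -cscaleAr -cscaleAl !linearP /= mulrDl mulrDr -cscaleAl -cscaleAr hx hx'.
move=> p sp pp y z; pose q := 1 - p.
have sq : star q = q by rewrite /q starB star1 sp.
have qq : q * q = q by rewrite /q mulrBr mulr1 mulrBl mul1r pp subrr subr0.
have qp : q * p = 0 by rewrite /q mulrBl mul1r pp subrr.
have pq : p * q = 0 by rewrite /q mulrBr mulr1 pp subrr.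
have {1}-> : y = p * y + q * y by rewrite -mulrDl /q addrC subrK mul1r.
have {2}-> : z = z * p + z * q by rewrite -mulrDr /q addrC subrK mulr1.
rewrite !linearD /= mulrDr [RHS]mulrDl.
by rewrite (orth q p) // (orth p q) // !addr0.
Qed.

Lemma oz_comm x : phi 1 * phi x = phi x * phi 1.
Proof. by have := oz_mul x 1 1; rewrite mul1r mulr1. Qed.

Lemma oz_mul1 x y : phi x * phi y = phi 1 * phi (x * y).
Proof. by rewrite -oz_mul mul1r. Qed.

Variables (n : nat) (b : 'I_n -> F) (lam : F -> 'I_n -> 'I_n -> R[i]).
Hypothesis fr : frame b lam.

(* [Z j = (h^(1/2) + e)^-1 phi (b j)] with [h = phi 1] and [e] small. *)
Lemma oz_rows (eps : R) : 0 < eps -> exists Z : 'I_n -> A,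
  [/\ forall x, nm (\sum_i \sum_j lam x j i *: (Z j * star (Z i)) - phi x) <= eps * nm x,
      pos (phi 1 - \sum_i \sum_j lam 1 j i *: (Z j * star (Z i))) &
      forall x i j, \sum_k lam x i k *: (star (Z k) * Z j) =
                    \sum_k lam x k j *: (star (Z i) * Z k)].
Proof.
move=> e0; set h := phi 1.
have ph : pos h by apply: cp_pos => //; rewrite -[1]scale1r; exact: (pos_scale1 _ ler01).
have [t [pt tt ct]] := pos_sqrt ph.
(* The error is (1 + t w) (1 - t w) phi x with 1 - t w = d w, and w phi x has norm at most
   [nm t * nm x]; the total 2 d [nm t * nm x] is below eps [nm x]. *)
pose d := eps / (2 * (nm t + 1)).
have tp : 0 < nm t + 1 by have := nm_ge0 t; lra.
have d0 : 0 < d by rewrite divr_gt0 // mulr_gt0.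
have [w [w1 w2 sw cw nw]] := pos_inv pt d0.
have st := pos_sa pt.
have wt : w * t = t * w by exact: cw.
have tphi x : t * phi x = phi x * t by apply: ct; exact: oz_comm.
have wphi x : w * phi x = phi x * w by exact: cw.
pose q := (t * w) * (t * w).
(* Products of the rows collapse by order zero, so that the compression of x is exactly (t w)^2 phi
   x. *)
have ZZ x y : w * phi x * (phi y * w) = q * phi (x * y).
  transitivity (w * (phi x * phi y) * w); first by ncring.
  rewrite oz_mul1 -/h -tt /q.
  transitivity (w * t * t * (phi (x * y) * w)); first by ncring.
  rewrite -wphi wt; ncring.
have dec x : \sum_i \sum_j lam x j i *: (w * phi (b j) * star (w * phi (b i))) = q * phi x.
  rewrite [in RHS](frame_dec fr x) linear_sum mulr_sumr; apply: eq_bigr => i _.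
  rewrite linear_sum mulr_sumr; apply: eq_bigr => j _.
  by rewrite starM sw -cp_star // ZZ linearZ /= cscaleAr.
have dw : 1 - t * w = d%:C *: w by rewrite -{1}w1; ncring.
have nwphi x : nm (w * phi x) <= nm t * nm x.
  rewrite -ler_sqr ?nnegrE ?mulr_ge0 ?nm_ge0 // -nm_sqr starM sw -cp_star // ZZ.
  apply: le_trans (nmM _ _) _; rewrite exprMn.
  apply: le_trans (ler_wpM2l (nm_ge0 _) (cp_nm cp _)) _.
  rewrite -/h -tt nm_sa_sq // nm_sqr.
  rewrite ler_piMl ?mulr_ge0 ?sqr_ge0 ?nm_ge0 // /q.
  by apply: le_trans (nmM _ _) _; rewrite mulr_ile1 ?nm_ge0.
exists (fun j => w * phi (b j)); split.
- move=> x; rewrite dec.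
  have -> : q * phi x - phi x = - ((1 + t * w) * ((1 - t * w) * phi x)).
    rewrite /q; ncring.
  rewrite nmN dw -cscaleAl; apply: le_trans (nmM _ _) _.
  rewrite nmZr ger0_norm ?(ltW d0) //.
  have n1 : nm (1 + t * w) <= 2.
    by apply: le_trans (nmD _ _) _; have := nm_le1 A; lra.
  apply: le_trans (_ : 2 * (d * (nm t * nm x)) <= _).
    have d1 := ltW d0.
    apply: ler_pM; [exact: nm_ge0 | by rewrite mulr_ge0 ?nm_ge0 | by [] |].
    by rewrite ler_wpM2l.
  have -> : 2 * (d * (nm t * nm x)) = eps * nm x * (nm t / (nm t + 1)).
    by rewrite /d; field; rewrite gt_eqF.
  have e1 := ltW e0.
  rewrite ler_piMr ?mulr_ge0 ?nm_ge0 // ler_pdivrMr //; lra.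
- rewrite dec -/h.
  have -> : h - q * h = star t * (1 - star (t * w) * (t * w)) * t.
    have wtt x : w * (t * x) = t * (w * x) by rewrite mulrA wt mulrA.
    rewrite starM st sw -tt /q mulrBr mulrBl mulr1 -!mulrA; congr (_ - _).
    by rewrite !(wtt, wt).
  apply: pos_conj.
  have := gram_le_nm nw; by rewrite expr1n scale1r.
(* The entries Z_i^* Z_j are w^2 h phi (b_i^* b_j); both sides are w^2 h phi (b_i^* x b_j). *)
- move=> x i j; have qE y z : star (w * phi y) * (w * phi z) = w * w * (h * phi (star y * z)).
    rewrite starM sw -cp_star // -oz_mul1.
    transitivity ((phi (star y) * w) * (w * phi z)); first by [].
    rewrite -wphi; transitivity (w * (phi (star y) * w) * phi z); first by ncring.
    rewrite -wphi; ncring.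
  have lin (G : 'I_n -> F) (c : 'I_n -> R[i]) :
      \sum_k c k *: (w * w * (h * phi (G k))) = w * w * (h * phi (\sum_k c k *: G k)).
    rewrite linear_sum !mulr_sumr; apply: eq_bigr => k _.
    by rewrite linearZ /= !cscaleAr.
  transitivity (w * w * (h * phi (star (b i) * x * b j))).
    rewrite -(frame_l fr) mulr_suml.
    under eq_bigr do rewrite qE.
    by rewrite lin; congr (_ * (_ * phi _)); apply: eq_bigr => k _; rewrite cscaleAl.
  rewrite -[star (b i) * x * b j]mulrA -(frame_r fr) mulr_sumr.
  under [RHS]eq_bigr do rewrite qE.
  by rewrite lin; congr (_ * (_ * phi _)); apply: eq_bigr => k _; rewrite cscaleAr.
Qed.

End OrderZero.

Section DirectSum.
Variables (R : realType) (F : cstarType R) (n : nat) (I : 'I_n -> set F).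
Hypothesis hI : direct_sum I.

(** The components of 1. Uniqueness of the decomposition makes each of them the unit of its summand,
    hence a central projection. *)
Lemma direct_sum_units : exists e : 'I_n -> F,
  [/\ forall i, I i (e i), \sum_i e i = 1,
      forall i, star (e i) = e i, forall i, e i * e i = e i &
      forall i x, e i * x = x * e i].
Proof.
have [hid hdec] := hI.
have [s [[sI s1] _]] := hdec 1.
have uniq (v1 v2 : 'I_n -> F) : (forall i, I i (v1 i)) -> (forall i, I i (v2 i)) ->
    \sum_i v1 i = \sum_i v2 i -> v1 =1 v2.
  move=> h1 h2 h; have [s0 [_ hs0]] := hdec (\sum_i v1 i).
  have e1 := hs0 [ffun i => v1 i]; have e2 := hs0 [ffun i => v2 i].
  have {e1}e1 : s0 = [ffun i => v1 i].
    by apply: e1; split=> [i|]; [rewrite ffunE | apply: eq_bigr => i _; rewrite ffunE].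
  have {e2}e2 : s0 = [ffun i => v2 i].
    by apply: e2; split=> [i|]; [rewrite ffunE | rewrite h; apply: eq_bigr => i _; rewrite ffunE].
  move=> i; have e : [ffun i => v1 i] = [ffun i => v2 i] by rewrite -e1.
  by move/ffunP/(_ i): e; rewrite !ffunE.
have I0 i : I i 0 by case: (hid i).
have dlt i x : I i x -> \sum_j (if j == i then x else 0) = x.
  move=> _; rewrite (bigD1 i) //= eqxx big1 ?addr0 // => j /negbTE ->.
  by [].
have unitr i x : I i x -> x * s i = x.
  move=> Ix; have := uniq (fun j => x * s j) (fun j => if j == i then x else 0).
  move=> /(_ _ _ _ i) ->; rewrite ?eqxx //.
  - by move=> j; case: (hid j) => _ _ /(_ (s j) x (sI j)) [].
  - by move=> j; case: eqP => [->|_].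
  - by rewrite -mulr_sumr -s1 mulr1 dlt.
have unitl i x : I i x -> s i * x = x.
  move=> Ix; have := uniq (fun j => s j * x) (fun j => if j == i then x else 0).
  move=> /(_ _ _ _ i) ->; rewrite ?eqxx //.
  - by move=> j; case: (hid j) => _ _ /(_ (s j) x (sI j)) [].
  - by move=> j; case: eqP => [->|_].
  - by rewrite -mulr_suml -s1 mul1r dlt.
have ss i : star (s i) = s i.
  have Is : I i (star (s i)) by case: (hid i) => _ _ _; apply.
  by rewrite -{2}[s i]starK -(unitr _ _ Is) starM starK (unitr _ _ Is).
exists s; split => // [i|i x]; first exact: unitr.
have [_ _ /(_ (s i) x (sI i)) [h1 h2] _] := hid i.
by rewrite -[LHS](unitr _ _ h1) -[RHS](unitl _ _ h2) mulrA.
Qed.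

End DirectSum.

Section Summands.
Variables (R : realType) (F A : cstarType R) (phi : {linear F -> A}) (n : nat).
Variable I : 'I_n.+1 -> set F.
Hypotheses (cp : completely_positive phi) (dec : decomposes phi I).

(** The restriction to a summand becomes the map phi (e_i x) on all of F, so that the summand need
    not be made into an algebra. The last clause carries contractivity on [I i] over to the value at
    1. *)
Lemma oz_summands : exists phis : 'I_n.+1 -> {linear F -> A},
  [/\ forall i, completely_positive (phis i), forall i, order_zero_on setT (phis i),
      forall x, \sum_i phis i x = phi x &
      forall i, exists e, I i e /\ nm e <= 1 /\ phis i 1 = phi e].
Proof.
have [hI hoz] := dec; have [e [eI e1 se ee ce]] := direct_sum_units hI.
have lin i : linear (fun x => phi (e i * x)).
  by move=> c x y; rewrite mulrDr -cscaleAr linearP.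
have [phis hphis] := @choice _ _ (fun i (g : {linear F -> A}) => g =1 (fun x => phi (e i * x)))
  (fun i => linear_exists (lin i)).
exists phis; split.
- move=> i; apply: cp_of_gpos => m x [y hy].
  have [|w hw] := @cp_gpos _ _ _ _ cp _ (fun j k => e i * x j k).
    exists (fun j k => e i * y j k) => j k; rewrite hy mulr_sumr; apply: eq_bigr => l _.
    rewrite starM se; transitivity (star (y l j) * (e i * e i) * y l k).
      by rewrite ee -ce mulrA.
    by rewrite !mulrA.
  by exists w => j k; rewrite hphis hw.
- move=> i x y _ _ /posP px /posP py xy; rewrite !hphis.
  have [_ _ /= h _] := hI.1 i.
  have pe z : pos z -> cstar_pos (e i * z).
    move=> pz; apply/posP; have -> : e i * z = star (e i) * z * e i.
      by rewrite se -mulrA -ce mulrA ee.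
    exact: pos_conj.
  apply: hoz; try exact: pe.
  + exact: (h (e i) x (eI i)).1.
  + exact: (h (e i) y (eI i)).1.
  + by rewrite mulrA -(mulrA (e i)) -ce mulrA ee -mulrA xy mulr0.
- move=> x; under eq_bigr do rewrite hphis.
  by rewrite -linear_sum -mulr_suml e1 mul1r.
- move=> i; exists (e i); split=> //; split; last by rewrite hphis mulr1.
  have h := nm_sa_sq (se i); rewrite ee in h.
  have [->|n0] := eqVneq (nm (e i)) 0; first exact: ler01.
  have p : 0 < nm (e i) by rewrite lt_def n0 nm_ge0.
  by rewrite -(ler_pM2l p) mulr1 -expr2 -h.
Qed.

End Summands.

(** * Maps given by rows *)

Section RowMap.
Variables (R : realType) (F B : cstarType R) (K G : finType) (n : nat).
Variables (b : 'I_n -> F) (lam : F -> 'I_n -> 'I_n -> R[i]).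
Hypothesis fr : frame b lam.
Local Notation J := (G * 'I_n)%type.

(** The scalar matrix, indexed by G times the frame, of the block k: the amplification of [lam] to
    M_G(F). *)
Definition amp (x : BM K G F) (k : K) (p q : J) : R[i] :=
  lam (ent x k p.1 q.1) p.2 q.2.

Lemma lam0 i j : lam 0 i j = 0.
Proof.
have := frameP fr 1 0 0 i j; rewrite scaler0 addr0 mul1r => /(congr1 (+%R^~ (- lam 0 i j))).
by rewrite addrK subrr.
Qed.

Lemma lamD x y i j : lam (x + y) i j = lam x i j + lam y i j.
Proof. by have := frameP fr 1 x y i j; rewrite scale1r mul1r. Qed.

Lemma lam_sum (I : Type) (r : seq I) (P : pred I) (u : I -> F) i j :
  lam (\sum_(l <- r | P l) u l) i j = \sum_(l <- r | P l) lam (u l) i j.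
Proof. by elim/big_rec2: _ => [|l x y _ <-]; rewrite ?lam0 ?lamD. Qed.

Lemma ampP (c : R[i]) x y k p q : amp (c *: x + y) k p q = c * amp x k p q + amp y k p q.
Proof. by rewrite /amp entD entZ (frameP fr). Qed.

Lemma ampM x y k p q : amp (x * y) k p q = \sum_r amp x k p r * amp y k r q.
Proof.
rewrite /amp entM lam_sum sum_pairE; apply: eq_bigr => g _.
by rewrite (frameM fr).
Qed.

Lemma amp_star x k p q : amp (star x) k p q = Num.conj (amp x k q p).
Proof. by rewrite /amp ent_star (frame_star fr). Qed.

Definition row_map (Y : K -> J -> B) (x : BM K G F) : B :=
  \sum_k \sum_p \sum_q amp x k p q *: (Y k p * star (Y k q)).

Lemma row_map_linear Y : linear (row_map Y).
Proof.
move=> c x y; rewrite /row_map scaler_sumr -big_split; apply: eq_bigr => k _ /=.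
rewrite scaler_sumr -big_split; apply: eq_bigr => p _ /=.
rewrite scaler_sumr -big_split; apply: eq_bigr => q _ /=.
by rewrite ampP scalerDl scalerA.
Qed.

(** [amp] is multiplicative and respects adjoints, so the values at y_i^* y_j form a rectangular
    Gram matrix. *)
Lemma row_map_cp Y (phi : {linear BM K G F -> B}) : phi =1 row_map Y ->
  completely_positive phi.
Proof.
move=> e; apply: cp_of_gpos => m x [y hy].
have -> : (fun i j => phi (x i j)) = fun i j => \sum_(c : K * 'I_m * J)
    star (\sum_q amp (y c.1.2 i) c.1.1 c.2 q *: star (Y c.1.1 q)) *
    (\sum_q amp (y c.1.2 j) c.1.1 c.2 q *: star (Y c.1.1 q)).
  apply/funext => i; apply/funext => j; rewrite e hy.
  have -> : row_map Y (\sum_k star (y k i) * y k j) = \sum_k row_map Y (star (y k i) * y k j).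
    have h0 : row_map Y 0 = 0.
      have := row_map_linear Y 1 0 0; rewrite scaler0 addr0 scale1r.
      move=> /(congr1 (+%R^~ (- row_map Y 0))).
      by rewrite addrK subrr.
    elim/big_rec2: _ => [|k u v _ <-] //.
    by rewrite -[X in row_map Y (X + _)]scale1r row_map_linear scale1r.
  rewrite [RHS]sum_pairE [RHS]sum_pairE [RHS]exchange_big /=; apply: eq_bigr => l _.
  rewrite /row_map; apply: eq_bigr => k _.
  transitivity (\sum_r \sum_p \sum_q
    (Num.conj (amp (y l i) k r p) * amp (y l j) k r q) *: (Y k p * star (Y k q))).
    under eq_bigr do under eq_bigr do rewrite ampM scaler_suml.
    under eq_bigr do rewrite exchange_big.
    rewrite exchange_big; apply: eq_bigr => r _; apply: eq_bigr => p _; apply: eq_bigr => q _.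
    by rewrite amp_star.
  apply: eq_bigr => r _ /=; rewrite star_sum mulr_suml; apply: eq_bigr => p _.
  rewrite mulr_sumr; apply: eq_bigr => q _.
  by rewrite starZ starK -cscaleAl -cscaleAr scalerA.
exact: gram_gpos.
Qed.

Definition commutes_gram (c : J -> J -> R[i]) (k0 : J -> J -> B) :=
  forall p r, \sum_q c p q *: k0 q r = \sum_q c q r *: k0 p q.

Definition summand (k : K) : set (BM K G F) :=
  [set x | forall k' g h, k' != k -> ent x k' g h = 0].

(** Once x commutes with the Gram matrix Y^* Y, the product Y x (Y^* Y) y Y^* equals Y (Y^* Y) x y
    Y^*. *)
Lemma row_map_oz Y k :
  (forall x, commutes_gram (amp x k) (fun p q => star (Y k p) * Y k q)) ->
  order_zero_on (summand k) (row_map Y).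
Proof.
move=> hY x y Ix Iy _ _ xy.
have red z : summand k z ->
    row_map Y z = \sum_p \sum_q amp z k p q *: (Y k p * star (Y k q)).
  move=> Iz; rewrite /row_map (bigD1 k) //= [X in _ + X]big1 ?addr0 // => k' kk'.
  rewrite big1 // => p _; rewrite big1 // => q _.
  by rewrite /amp Iz // lam0 scale0r.
rewrite (red x) // (red y) // mulr_suml big1 // => p _.
rewrite mulr_suml.
transitivity (\sum_r (\sum_q amp x k p q *:
    (\sum_s amp y k r s *: (Y k p * (star (Y k q) * Y k r) * star (Y k s))))).
  rewrite [RHS]exchange_big; apply: eq_bigr => q _; rewrite mulr_sumr; apply: eq_bigr => r _.
  rewrite -cscaleAl mulr_sumr; congr (_ *: _); apply: eq_bigr => s _.
  by rewrite -cscaleAr; congr (_ *: _); rewrite !mulrA.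
transitivity (\sum_s \sum_r amp y k r s *:
    (Y k p * (\sum_q amp x k p q *: (star (Y k q) * Y k r)) * star (Y k s))).
  rewrite [RHS]exchange_big; apply: eq_bigr => r _.
  under [LHS]eq_bigr => q _ do rewrite scaler_sumr.
  rewrite [LHS]exchange_big; apply: eq_bigr => s _.
  rewrite mulr_sumr mulr_suml scaler_sumr; apply: eq_bigr => q _.
  by rewrite -cscaleAr -cscaleAl scalerA mulrC -scalerA.
rewrite big1 // => s _.
under eq_bigr do rewrite (hY x).
transitivity (\sum_q amp (x * y) k q s *: (Y k p * (star (Y k p) * Y k q) * star (Y k s))).
  under [RHS]eq_bigr do rewrite ampM scaler_suml.
  rewrite [RHS]exchange_big; apply: eq_bigr => r _.
  rewrite mulr_sumr mulr_suml scaler_sumr; apply: eq_bigr => q _.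
  by rewrite -cscaleAr -cscaleAl scalerA mulrC.
by rewrite xy big1 // => q _; rewrite /amp ent0 lam0 scale0r.
Qed.

End RowMap.

Section RowPerturb.
Variables (R : realType) (B : cstarType R) (J : finType) (p0 : J).

(** The row Y becomes a matrix y over J with Y in row [p0] and zeros elsewhere, so y^* y is its Gram
    matrix and [gram_perturb] applies in M_J(B). The matrix unit P at p0 is a left unit of y, hence
    of y', which is therefore again a single row. *)
Lemma row_perturb (M eta : R) : 0 < M -> 0 < eta -> exists2 delta : R, 0 < delta &
  forall (Y : J -> B) (k0 : J -> J -> B), gpos k0 -> (forall q, nm (Y q) <= M) ->
    (forall p q, nm (star (Y p) * Y q - k0 p q) <= delta) ->
  exists Y' : J -> B, (forall q, nm (Y' q - Y q) <= eta) /\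
    forall c : J -> J -> R[i],
      (forall p r, \sum_q c p q *: k0 q r = \sum_q c q r *: k0 p q) ->
      forall p r, \sum_q c p q *: (star (Y' q) * Y' r) = \sum_q c q r *: (star (Y' p) * Y' q).
Proof.
move=> M0 eta0; pose N : R := #|{: unit * J * J}|%:R.
have N0 : 0 <= N by rewrite ler0n.
have M1 : 0 < (N * M) ^+ 2 + 1 by have := sqr_ge0 (N * M); lra.
have [d d0 hd] := @gram_perturb R (BM unit J B) _ _ M1 eta0.
exists (d / (N + 1)); first by rewrite divr_gt0 //; lra.
move=> Y k0 pk hM hk.
have nmle (x : BM unit J B) (t : R) : (forall p q, nm (ent x tt p q) <= t) -> nm x <= N * t.
  move=> h; apply: le_trans (nm_BM_le x) _.
  rewrite /N mulr_natl -sumr_const; apply: ler_sum => -[[[] p] q] _; exact: h.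
pose y : BM unit J B := bm (fun _ p q => if p == p0 then Y q else 0).
have yy p q : ent (star y * y) tt p q = star (Y p) * Y q.
  rewrite entM (bigD1 p0) //= ent_star !entE eqxx big1 ?addr0 // => r /negbTE rp.
  by rewrite ent_star !entE rp mulr0.
have [||y' [h1 h2 h3]] := hd y (bm (fun _ => k0)) ((gposP _).1 pk).
- rewrite nm_sq; apply: le_trans (_ : (N * M) ^+ 2 <= _); last by rewrite lerDl.
  apply: lerXn2r; rewrite ?nnegrE ?nm_ge0 ?mulr_ge0 ?(ltW M0) //.
  apply: nmle => p q; rewrite entE; case: eqP => // _.
  by rewrite nm0 ltW.
- apply: le_trans (nmle _ (d / (N + 1)) _) _.
    by move=> p q; rewrite entD entN yy entE.
  by rewrite mulrCA ger_pMr // ler_pdivrMr; lra.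
pose P : BM unit J B := bm (fun _ p q => if (p == p0) && (q == p0) then 1 else 0).
have PE (x : BM unit J B) p q : ent (P * x) tt p q = if p == p0 then ent x tt p0 q else 0.
  rewrite entM (bigD1 p0) //= entE eqxx andbT big1 ?addr0; last first.
    by move=> r /negbTE rp; rewrite entE rp andbF mul0r.
  by case: eqP => _; rewrite ?mul1r ?mul0r.
have Py : P * y = y.
  by apply: bm_ext => -[] p q; rewrite PE !entE eqxx.
have Py' := h3 _ Py.
exists (ent y' tt p0); split.
  move=> q; apply: le_trans h1; apply: le_trans (nm_ent _ tt p0 q).
  by rewrite entD entN entE eqxx.
have y'y' p q : ent (star y' * y') tt p q = star (ent y' tt p0 p) * ent y' tt p0 q.
  rewrite -{2}Py' entM (bigD1 p0) //= ent_star PE eqxx big1 ?addr0 // => r /negbTE rp.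
  by rewrite PE rp mulr0.
move=> c hc p r.
pose X : BM unit J B := bm (fun _ p q => c p q *: (1 : B)).
have XE (z : BM unit J B) p' q : ent (X * z) tt p' q = \sum_l c p' l *: ent z tt l q.
  by rewrite entM; apply: eq_bigr => l _; rewrite entE -cscaleAl mul1r.
have EX (z : BM unit J B) p' q : ent (z * X) tt p' q = \sum_l c l q *: ent z tt p' l.
  by rewrite entM; apply: eq_bigr => l _; rewrite entE -cscaleAr mulr1.
have comm : bm (fun _ => k0) * X = X * bm (fun _ => k0).
  apply: bm_ext => -[] p' q; rewrite EX XE.
  under eq_bigr do rewrite entE; under [RHS]eq_bigr do rewrite entE.
  by rewrite hc.
have := h2 X comm => /(congr1 (fun z => ent z tt p r)).
rewrite XE EX; under eq_bigr do rewrite y'y'; under [RHS]eq_bigr do rewrite y'y'.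
by move=> ->.
Qed.

End RowPerturb.

(** * Block sums and the regular representation *)

Section BlockSums.
Variables (R : realType) (F : cstarType R) (K G : finType).

Lemma fin_dim_BM : fin_dim F -> fin_dim (BM K G F).
Proof.
move=> [m [v [vi vK viK]]]; pose T := (K * G * G)%type.
pose w (x : BM K G F) : 'rV[R[i]]_(#|{: T}| * m) :=
  mxvec (\matrix_(t < #|{: T}|, j < m) v (blk_fun x (enum_val t)) 0 j).
have lw : linear w.
  move=> c x y; rewrite /w -linearP; congr mxvec; apply/matrixP => t j.
  by rewrite !mxE blk_funD blk_funZ linearP !mxE.
have [g hg] := linear_exists lw.
exists _, g; pose gi (u : 'rV[R[i]]_(#|{: T}| * m)) : BM K G F :=
  bm (fun k a c => vi (row (enum_rank (k, a, c)) (vec_mx u))).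
exists gi => [x|u].
  apply: bm_ext => k a c; rewrite entE hg /w mxvecK.
  rewrite -[RHS]vK; congr vi; apply/rowP => j; rewrite !mxE.
  by rewrite enum_rankK.
rewrite hg /w -[RHS]vec_mxK; congr mxvec; apply/matrixP => t j; rewrite !mxE.
have [[[k a] c] kac] : exists p, p = enum_val t by exists (enum_val t).
by rewrite -kac [blk_fun _ _](entE _ k a c) viK !mxE kac enum_valK.
Qed.

Lemma direct_sum_BM n (kap : 'I_n -> K) : bijective kap ->
  direct_sum (fun j => @summand R F K G (kap j)).
Proof.
move=> bk; split.
  move=> j; split.
  - by move=> k g h _; rewrite ent0.
  - by move=> c x y hx hy k g h kj; rewrite entD entZ hx // hy // scaler0 addr0.
  - move=> x y hx; split=> k g h kj; rewrite entM big1 // => m _.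
      by rewrite hx // mul0r.
    by rewrite hx // mulr0.
  - by move=> x hx k g h kj; rewrite ent_star hx // star0.
move=> x; pose cut k : BM K G F := bm (fun k' g h => if k' == k then ent x k' g h else 0).
have sum_cut (s : {ffun 'I_n -> BM K G F}) : (forall j, summand (kap j) (s j)) ->
    forall j g h, ent (\sum_i s i) (kap j) g h = ent (s j) (kap j) g h.
  move=> hs j g h; rewrite ent_sum (bigD1 j) //= [X in _ + X]big1 ?addr0 // => i ij.
  by apply: hs; rewrite (inj_eq (bij_inj bk)) eq_sym.
have [kap' kapK kap'K] := bk.
exists [ffun j => cut (kap j)]; split.
  have hs j : summand (kap j) ([ffun j => cut (kap j)] j).
    by move=> k g h kj; rewrite ffunE entE (negbTE kj).
  split=> //; apply: bm_ext => k g h; rewrite -[k]kap'K sum_cut // ffunE entE.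
  by rewrite eqxx.
move=> s [hs xs]; apply/ffunP => j; rewrite ffunE; apply: bm_ext => k g h.
rewrite entE; case: eqP => [->|/eqP kj]; first by rewrite xs sum_cut.
by rewrite hs.
Qed.

Definition diag_BM (y : F) : BM K G F := bm (fun _ g h => if g == h then y else 0).

Lemma diag_BM_hom : star_hom diag_BM.
Proof.
split.
- move=> c x y; apply: bm_ext => k g h; rewrite entD entZ !entE.
  by case: eqP => // _; rewrite scaler0 addr0.
- move=> x y; apply: bm_ext => k g h; rewrite entM entE (bigD1 g) //= !entE eqxx.
  rewrite [X in _ + X]big1 ?addr0; first by case: eqP; rewrite ?mulr0.
  by move=> m mg; rewrite entE eq_sym (negbTE mg) mul0r.
- by [].
- move=> x; apply: bm_ext => k g h; rewrite ent_star !entE eq_sym.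
  by case: eqP; rewrite ?star0.
Qed.

End BlockSums.

Section AmplifiedMap.
Variables (R : realType) (A F B : cstarType R) (K G : finType).
Variables (f : B -> BM unit G A) (psi : {linear A -> F}).
Hypotheses (hf : star_hom f) (hpsi : cpc psi).

(** The entrywise [psi] after f, repeated in every block: each pair of a tower and a summand
    compresses the same matrix. *)
Definition amplified (b : B) : BM K G F := bm (fun _ g h => psi (ent (f b) tt g h)).

Lemma amplified_exists : exists g : {linear B -> BM K G F}, g =1 amplified /\ cpc g.
Proof.
have [cp ct] := hpsi.
have lin : linear amplified.
  move=> c x y; apply: bm_ext => k a b; rewrite entD entZ !entE (shomD hf) (shomZ hf).
  by rewrite entD entZ linearP.
have [g hg] := linear_exists lin; exists g; split=> //.
have cpg : completely_positive g.
  apply: cp_of_gpos => n x [y hy].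
  (* M_n over M_G(A) is read as the matrices over A indexed by the pairs. *)
  have [|w hw] := @cp_gpos _ _ _ _ cp ('I_n * G)%type
      (fun p q => ent (f (x p.1 q.1)) tt p.2 q.2).
    have -> : (fun p q : 'I_n * G => ent (f (x p.1 q.1)) tt p.2 q.2) =
       fun p q => \sum_(c : 'I_n * G) star (ent (f (y c.1 p.1)) tt c.2 p.2) *
          ent (f (y c.1 q.1)) tt c.2 q.2.
      apply/funext => p; apply/funext => q; rewrite hy (shom_sum hf) ent_sum sum_pairE.
      apply: eq_bigr => k _; rewrite (shomM hf) (shom_star hf) entM.
      by apply: eq_bigr => m _; rewrite ent_star.
    exact: gram_gpos.
  exists (fun k i => bm (fun _ m g => w (k, m) (i, g))) => i j.
  apply: bm_ext => k a b; rewrite hg entE ent_sum [LHS](hw (i, a) (j, b)) sum_pairE.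
  apply: eq_bigr => l _; rewrite entM; apply: eq_bigr => m _.
  by rewrite ent_star !entE.
split=> // b _; rewrite !nmE lecR.
apply: le_trans (cp_nm cpg _) _; rewrite ler_piMl ?nm_ge0 //.
have -> : g 1 = @diag_BM R F K G (psi 1).
  apply: bm_ext => k a c; rewrite hg !entE (shom1 hf) ent1.
  by case: eqP => // _; rewrite linear0.
apply: le_trans (shom_nm (@diag_BM_hom _ _ _ _) _) _.
have := ct 1 I; rewrite !nmE lecR => h.
exact: le_trans h (nm_le1 A).
Qed.

End AmplifiedMap.

Section RegularRepresentation.
Variables (R : realType) (G : finGroupType) (A : cstarType R) (alpha : G -> A -> A).
Hypothesis ha : cstar_action alpha.

Definition reg_pi (a : A) : BM unit G A :=
  bm (fun _ g h => if g == h then alpha g^-1%g a else 0).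
Definition reg_v (s : G) : BM unit G A :=
  bm (fun _ g h => if g == (s * h)%g then 1 else 0).

Lemma reg_vM s (x : BM unit G A) g h : ent (reg_v s * x) tt g h = ent x tt (s^-1 * g)%g h.
Proof.
rewrite entM (bigD1 (s^-1 * g)%g) //= entE mulKVg eqxx mul1r.
rewrite [X in _ + X]big1 ?addr0 // => m mg; rewrite entE; case: eqP => [e|_].
  by rewrite e mulKg eqxx in mg.
by rewrite mul0r.
Qed.

Lemma reg_Mv s (x : BM unit G A) g h : ent (x * reg_v s) tt g h = ent x tt g (s * h)%g.
Proof.
rewrite entM (bigD1 (s * h)%g) //= entE eqxx mulr1.
by rewrite [X in _ + X]big1 ?addr0 // => m mg; rewrite entE (negbTE mg) mulr0.
Qed.

Lemma reg_v_star s : star (reg_v s) = reg_v s^-1%g.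
Proof.
apply: bm_ext => -[] g h; rewrite ent_star !entE.
have -> : (h == (s * g)%g) = (g == (s^-1 * h)%g).
  by apply/eqP/eqP => ->; rewrite ?mulKg ?mulKVg.
by case: eqP; rewrite ?star1 ?star0.
Qed.

Lemma regular_covariant : covariant alpha reg_pi reg_v.
Proof.
have [hom a1 aM] := ha.
split.
- split.
  + move=> c x y; apply: bm_ext => k g h; rewrite entD entZ !entE.
    case: eqP => // _; last by rewrite scaler0 addr0.
    by rewrite (shomD (hom _)) (shomZ (hom _)).
  + move=> x y; apply: bm_ext => k g h; rewrite entM entE (bigD1 g) //= !entE eqxx.
    rewrite [X in _ + X]big1 ?addr0; first by case: eqP => _; rewrite ?mulr0 ?(shomM (hom _)).
    by move=> m mg; rewrite entE eq_sym (negbTE mg) mul0r.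
  + by apply: bm_ext => k g h; rewrite ent1 entE (shom1 (hom _)).
  + move=> x; apply: bm_ext => k g h; rewrite ent_star !entE eq_sym.
    by case: eqP => [->|_]; rewrite ?star0 // (shom_star (hom _)).
- split=> [|s t]; first by apply: bm_ext => -[] g h; rewrite entE ent1 mul1g.
  apply: bm_ext => -[] g h; rewrite reg_vM !entE.
  have -> // : (g == (s * t * h)%g) = ((s^-1 * g)%g == (t * h)%g).
  by apply/eqP/eqP => [->|e]; [rewrite -mulgA mulKg | rewrite -mulgA -e mulKVg].
- move=> s; rewrite reg_v_star; split; apply: bm_ext => -[] g h; rewrite reg_vM entE ent1.
    have -> // : ((s^-1^-1 * g)%g == (s * h)%g) = (g == h).
    by rewrite invgK; apply/eqP/eqP => [/mulgI|->].
  have -> // : ((s^-1 * g)%g == (s^-1 * h)%g) = (g == h).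
  by apply/eqP/eqP => [/mulgI|->].
- move=> s a; apply: bm_ext => -[] g h; rewrite reg_v_star -mulrA reg_vM reg_Mv !entE.
  have -> : ((s^-1 * g)%g == (s^-1 * h)%g) = (g == h).
    by apply/eqP/eqP => [/mulgI|->].
  by case: eqP => // _; rewrite -aM invMg invgK.
Qed.

End RegularRepresentation.

(** * Rokhlin towers *)

Section RokhlinRoots.
Variables (R : realType) (G : finGroupType) (A B : cstarType R).
Variables (alpha : G -> A -> A) (iota : A -> B) (u : G -> B).
Hypotheses (hcov : covariant alpha iota u).

Let hi : star_hom iota. Proof. by case: hcov. Qed.

Lemma cov_u1 : u 1%g = 1. Proof. by case: hcov => _ []. Qed.
Lemma cov_uM g h : u (g * h)%g = u g * u h. Proof. by case: hcov => _ []. Qed.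
Lemma cov_uu g : star (u g) * u g = 1. Proof. by case: hcov => _ _ /(_ g) []. Qed.
Lemma cov_uu' g : u g * star (u g) = 1. Proof. by case: hcov => _ _ /(_ g) []. Qed.

Lemma cov_uV g : u g^-1%g = star (u g).
Proof.
by rewrite -[LHS]mulr1 -(cov_uu' g) mulrA -cov_uM mulVg cov_u1 mul1r.
Qed.

Lemma cov_alpha g a : iota (alpha g a) = u g * iota a * star (u g).
Proof. by case: hcov. Qed.

Lemma nm_isometry (v : B) : star v * v = 1 -> nm v <= 1.
Proof.
move=> h; rewrite -(expr_le1 (n := 2)) ?nm_ge0 // -nm_sq h.
exact: nm_le1.
Qed.

Lemma nm_u g : nm (u g) <= 1. Proof. exact: nm_isometry (cov_uu g). Qed.
Lemma nm_us g : nm (star (u g)) <= 1. Proof. by rewrite nm_star nm_u. Qed.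

Lemma nmM_le (x y : B) (s t : R) : nm x <= s -> nm y <= t -> nm (x * y) <= s * t.
Proof. by move=> hx hy; apply: le_trans (nmM _ _) _; rewrite ler_pM ?nm_ge0. Qed.

(** Equivariance and centrality pass to the roots by [csqrt_modulus], with [u s] and a multiple of
    [iota (c t)] as intertwiners. Orthogonality is direct: the fourth power of the norm of r_g r_h
    is at most the norm of the product of their squares, whence [eta ^+ 4]. *)
Lemma rokhlin_roots (d : nat) (T : finType) (c : T -> A) (eta : R) :
  rokhlin_le alpha d -> 0 < eta -> exists r : 'I_d.+1 -> G -> B,
  [/\ forall l g, star (r l g) = r l g /\ nm (r l g) <= 1,
      forall l g h, g != h -> nm (r l g * r l h) <= eta,
      forall l s g, nm (u s * r l g - r l (s * g)%g * u s) <= eta,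
      forall l g t, nm (r l g * iota (c t) - iota (c t) * r l g) <= eta &
      nm (\sum_l \sum_g r l g * r l g - 1) <= eta].
Proof.
move=> hr eta0.
(* The modulus is stated for intertwiners of norm at most 1, so the c t are divided by M. *)
pose M := 1 + \sum_t nm (c t).
have cM t : nm (c t) <= M.
  rewrite /M (bigD1 t) //= addrCA lerDl addr_ge0 // sumr_ge0 // => i _; exact: nm_ge0.
have M1 : 1 <= M by rewrite /M lerDl sumr_ge0 // => i _; exact: nm_ge0.
have M0 : 0 < M by lra.
have [d1 d10 hd1] := @csqrt_modulus R B eta eta0.
have [d2 d20 hd2] := @csqrt_modulus R B (eta / M) ltac:(by rewrite divr_gt0).
pose de := Num.min (Num.min d1 d2) (Num.min eta (eta ^+ 4)).
have de0 : 0 < de by rewrite !lt_min d10 d20 eta0 exprn_gt0.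
have de1 : de <= d1 by rewrite !ge_min lexx.
have de2 : de <= d2 by rewrite !ge_min lexx orbT.
have de3 : de <= eta by rewrite !ge_min lexx !orbT.
have de4 : de <= eta ^+ 4 by rewrite !ge_min lexx !orbT.
have [|f [hf [f1 f2 f3 f4]]] := hr (c @` [set: T]) de _ de0.
  by apply: finite_image; exact: finite_finset.
pose P l g := iota (f l g).
have pP l g : pos (P l g) by apply: (shom_pos hi); apply/posP; case: (hf l g).
have nP l g : nm (P l g) <= 1.
  by apply: le_trans (shom_nm hi _) _; have [_] := hf l g; rewrite nmE lecR.
have cP l g : nm (1 - P l g) <= 1.
  by have := pos_nm_shrink (pP l g) (nP l g); rewrite scale1r.
pose r l g := csqrt (P l g); exists r.
have rr l g : r l g * r l g = P l g by exact: csqrtK.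
have sr l g : star (r l g) = r l g by apply: csqrt_star; rewrite ?(pos_sa (pP _ _)).
have nr l g : nm (r l g) <= 1.
  by rewrite -(expr_le1 (n := 2)) ?nm_ge0 // -nm_sq sr rr.
split.
- by [].
- move=> l g h gh.
  have h1 : nm (r l h * P l g * r l h) ^+ 2 <= nm (P l g * P l h).
    rewrite -nm_sq !starM sr (pos_sa (pP _ _)).
    have -> : r l h * (P l g * r l h) * (r l h * P l g * r l h) =
       r l h * (P l g * (r l h * r l h)) * (P l g * r l h) by ncring.
    rewrite rr; apply: le_trans (nmM_le (nmM_le (nr l h) (lexx _)) (nmM_le (nP l g) (nr l h))) _.
    by rewrite mul1r !mulr1.
  have h2 : nm (r l g * r l h) ^+ 2 = nm (r l h * P l g * r l h).
    by rewrite -nm_sq starM !sr -rr; congr nm; ncring.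
  have h3 : nm (P l g * P l h) <= eta ^+ 4.
    apply: le_trans de4; have := f1 l g h gh; rewrite nm_ltc => /ltW /(le_trans _); apply.
    by rewrite -(shomM hi); exact: shom_nm.
  rewrite -h2 -exprM in h1.
  have := le_trans h1 h3; rewrite ler_pXn2r ?nnegrE ?nm_ge0 //; exact: ltW.
- move=> l s g; rewrite nmC; apply: hd1 => //; first exact: nm_u.
  have -> : P l (s * g)%g * u s - u s * P l g = - iota (alpha s (f l g) - f l (s * g)%g) * u s.
    rewrite (shomB hi) cov_alpha -/(P _ _) -/(P _ _).
    transitivity (P l (s * g)%g * u s - u s * P l g * (star (u s) * u s)).
      by rewrite cov_uu mulr1.
    ncring.
  apply: le_trans de1; rewrite -[de]mulr1; apply: nmM_le (nm_u s).
  rewrite nmN; apply: le_trans (shom_nm hi _) _.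
  by have := f3 l g s; rewrite nm_ltc => /ltW.
- move=> l g t; have Mn : M != 0 by rewrite gt_eqF.
  have := hd2 (P l g) (P l g) ((M^-1)%:C *: iota (c t)) (cP _ _) (cP _ _).
  have nMi (x : B) : nm ((M^-1)%:C *: x) = nm x / M.
    by rewrite nmZr ger0_norm ?invr_ge0 ?(ltW M0) // mulrC.
  rewrite -!cscaleAr -!cscaleAl -!scalerBr !nMi.
  rewrite !ler_pdivrMr // mul1r divfK // => h; apply: h.
    exact: le_trans (shom_nm hi _) (cM t).
  rewrite -!(shomM hi) -(shomB hi); apply: le_trans (shom_nm hi _) _.
  apply: le_trans (_ : de <= _).
    by have := f4 l g (c t) ltac:(by exists t); rewrite nm_ltc => /ltW.
  apply: le_trans de2 _; rewrite ler_peMr // ltW //.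
- have -> : \sum_l \sum_g r l g * r l g - 1 = iota (\sum_(l < d.+1) \sum_(g : G) f l g - 1).
    rewrite (shomB hi) (shom1 hi) (shom_sum hi); congr (_ - _); apply: eq_bigr => l _.
    by rewrite (shom_sum hi); apply: eq_bigr => g _; rewrite rr.
  apply: le_trans (shom_nm hi _) _; apply: le_trans de3.
  by move: f2; rewrite nm_ltc => /ltW.
Qed.

(** With s = g h^-1, each term is near r_g^2 x_s u_s: one error from e, one from moving r_h across
    u_s, where it becomes r_g, and one from moving r_g across x_s. This is the 2 + X. For fixed g
    the sum over h runs through all s and gives r_g^2 times the element to be recovered. *)
Lemma rokhlin_estimate (L : finType) (r : L -> G -> B) (x : G -> B)
    (e : L -> G -> G -> B) (eta X : R) :
  0 <= eta ->
  (forall l g, star (r l g) = r l g /\ nm (r l g) <= 1) ->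
  (forall l s g, nm (u s * r l g - r l (s * g)%g * u s) <= eta) ->
  (forall l g s, nm (r l g * x s - x s * r l g) <= eta) ->
  nm (\sum_l \sum_g r l g * r l g - 1) <= eta ->
  (forall s, nm (x s) <= X) ->
  (forall l g h, nm (e l g h - star (u g) * x (g * h^-1)%g * u g) <= eta) ->
  nm (\sum_l \sum_g \sum_h r l g * u g * e l g h * (star (u h) * r l h) - \sum_s x s * u s)
    <= eta * (#|L|%:R * #|G|%:R * #|G|%:R * (2 + X) + nm (\sum_s x s * u s)).
Proof.
move=> eta0 hr h1 h2 h3 hX he.
set b := \sum_s x s * u s.
have X0 : 0 <= X by apply: le_trans (hX 1%g); exact: nm_ge0.
pose t l g h := r l g * r l g * (x (g * h^-1)%g * u (g * h^-1)%g).
have term l g h : nm (r l g * u g * e l g h * (star (u h) * r l h) - t l g h) <= eta * (2 + X).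
  set s := (g * h^-1)%g; have rg := (hr l g).2; have rh := (hr l h).2.
  have us : u s = u g * star (u h) by rewrite /s cov_uM cov_uV.
  have sh : (s * h)%g = g by rewrite /s mulgKV.
  have -> : r l g * u g * e l g h * (star (u h) * r l h) - t l g h =
     r l g * u g * (e l g h - star (u g) * x s * u g) * (star (u h) * r l h)
     + (r l g * x s * (u s * r l h - r l (s * h)%g * u s)
     - r l g * (r l g * x s - x s * r l g) * u s).
    rewrite sh /t -/s.
    have -> : r l g * u g * (e l g h - star (u g) * x s * u g) * (star (u h) * r l h) =
       r l g * u g * e l g h * (star (u h) * r l h) -
       r l g * (u g * star (u g)) * x s * ((u g * star (u h)) * r l h).
      ncring.
    rewrite cov_uu' -us; ncring.
  apply: le_trans (nmD _ _) _.
  have -> : eta * (2 + X) = 1 * 1 * eta * (1 * 1) + (1 * X * eta + 1 * eta * 1) by ring.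
  apply: lerD.
    exact: nmM_le (nmM_le (nmM_le rg (nm_u g)) (he l g h)) (nmM_le (nm_us h) rh).
  apply: le_trans (nmB _ _) _; apply: lerD.
    exact: nmM_le (nmM_le rg (hX s)) (h1 l s h).
  exact: nmM_le (nmM_le rg (h2 l g s)) (nm_u s).
have sumt : \sum_l \sum_g \sum_h t l g h = (\sum_l \sum_g r l g * r l g) * b.
  rewrite mulr_suml; apply: eq_bigr => l _; rewrite mulr_suml; apply: eq_bigr => g _.
  rewrite /t -mulr_sumr; congr (_ * _).
  rewrite /b [RHS](reindex (fun h => g * h^-1)%g) //.
  exists (fun s => s^-1 * g)%g => h _; first by rewrite invMg invgK mulgKV.
  by rewrite invMg invgK mulKVg.
have -> : \sum_l \sum_g \sum_h r l g * u g * e l g h * (star (u h) * r l h) - b =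
   \sum_l \sum_g \sum_h (r l g * u g * e l g h * (star (u h) * r l h) - t l g h) +
   ((\sum_l \sum_g r l g * r l g) - 1) * b.
  rewrite [X in X + _ = _](_ : _ =
    \sum_l \sum_g \sum_h (r l g * u g * e l g h * (star (u h) * r l h) - t l g h) +
    \sum_l \sum_g \sum_h t l g h).
    by rewrite sumt mulrBl mul1r addrA.
  rewrite -big_split; apply: eq_bigr => l _; rewrite -big_split; apply: eq_bigr => g _.
  by rewrite -big_split; apply: eq_bigr => h _ /=; rewrite subrK.
apply: le_trans (nmD _ _) _; rewrite mulrDr; apply: lerD; last exact: nmM_le.
have -> : eta * (#|L|%:R * #|G|%:R * #|G|%:R * (2 + X)) =
   \sum_(l : L) \sum_(g : G) \sum_(h : G) eta * (2 + X).
  have sc (T : finType) (w : R) : \sum_(i : T) w = #|T|%:R * w.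
    by rewrite sumr_const mulr_natl.
  rewrite !sc; ring.
apply: le_trans (nm_sum _ _ _) _; apply: ler_sum => l _.
apply: le_trans (nm_sum _ _ _) _; apply: ler_sum => g _.
apply: le_trans (nm_sum _ _ _) _; apply: ler_sum => h _; exact: term.
Qed.

End RokhlinRoots.

(** * Rows made from a Rokhlin tower and an order zero map *)

Section Rows.
Variables (R : realType) (G : finGroupType) (A B F : cstarType R) (K : finType) (n : nat).
Variables (alpha : G -> A -> A) (iota : A -> B) (u : G -> B).
Hypotheses (hcov : covariant alpha iota u).
Variables (b : 'I_n -> F) (lam : F -> 'I_n -> 'I_n -> R[i]).
Local Notation J := (G * 'I_n)%type.

Let hi : star_hom iota. Proof. by case: hcov. Qed.

Definition sandwich (I : finType) (c : I -> I -> R[i]) (Y : I -> B) : B :=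
  \sum_p \sum_q c p q *: (Y p * star (Y q)).

Definition compress (Z : 'I_n -> A) (x : F) : A :=
  \sum_i \sum_j lam x j i *: (Z j * star (Z i)).

Lemma sandwich_rows (r : G -> B) (Z : 'I_n -> A) (x : BM K G F) k :
  (forall g, star (r g) = r g) ->
  sandwich (amp lam x k) (fun p => r p.1 * u p.1 * iota (Z p.2)) =
  \sum_g \sum_h r g * u g * iota (compress Z (ent x k g h)) * (star (u h) * r h).
Proof.
move=> sr; rewrite /sandwich sum_pairE; apply: eq_bigr => g _ /=.
under eq_bigr do rewrite sum_pairE.
rewrite exchange_big; apply: eq_bigr => h _ /=.
rewrite /compress exchange_big /= (shom_sum hi) mulr_sumr mulr_suml; apply: eq_bigr => j _.
rewrite (shom_sum hi) mulr_sumr mulr_suml; apply: eq_bigr => i _.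
rewrite (shomZ hi) (shomM hi) (shom_star hi) !starM sr /amp /=; ncring.
Qed.

Lemma sandwich_perturb (I : finType) (c : I -> I -> R[i]) (Y Y' : I -> B) (M eta : R) :
  eta <= 1 -> (forall q, nm (Y q) <= M) -> (forall q, nm (Y' q - Y q) <= eta) ->
  nm (sandwich c Y' - sandwich c Y) <= (2 * M + 1) * eta * \sum_p \sum_q complex.Re `|c p q|.
Proof.
move=> e1 hM he; rewrite /sandwich -sumrB mulr_sumr.
apply: le_trans (nm_sum _ _ _) _; apply: ler_sum => p _.
rewrite -sumrB mulr_sumr; apply: le_trans (nm_sum _ _ _) _; apply: ler_sum => q _.
rewrite -scalerBr nmZ mulrC; apply: ler_wpM2r; first by rewrite normc_def /= sqrtr_ge0.
have -> : Y' p * star (Y' q) - Y p * star (Y q) =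
  (Y' p - Y p) * star (Y' q) + Y p * star (Y' q - Y q) by rewrite starB; ncring.
have hM' : nm (Y' q) <= M + 1.
  have -> : Y' q = Y q + (Y' q - Y q) by rewrite addrCA subrr addr0.
  by apply: le_trans (nmD _ _) _; apply: lerD => //; exact: le_trans (he q) e1.
have -> : (2 * M + 1) * eta = eta * (M + 1) + M * eta by ring.
apply: le_trans (nmD _ _) _; apply: lerD; apply: nmM_le => //; rewrite nm_star //.
Qed.

Lemma sandwich_scale (I : finType) (c : I -> I -> R[i]) (Y : I -> B) (s : R) :
  sandwich c (fun p => s%:C *: Y p) = (s * s)%:C *: sandwich c Y.
Proof.
rewrite /sandwich scaler_sumr; apply: eq_bigr => p _; rewrite scaler_sumr.
apply: eq_bigr => q _; rewrite starZr -cscaleAl -cscaleAr !scalerA; congr (_ *: _).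
by rewrite rmorphM /=; ring.
Qed.

(** The idealized Gram matrix: distinct group elements are orthogonal, and u_g^* r_g^2 u_g is
    replaced by r_1^2, split to both sides to keep the matrix positive. All diagonal blocks coincide
    and, by [oz_rows], commute with [lam]; hence the whole matrix commutes with M_G(F). *)
Definition row_gram (r : G -> B) (Z : 'I_n -> A) (p q : J) : B :=
  if p.1 == q.1 then r 1%g * star (iota (Z p.2)) * iota (Z q.2) * r 1%g else 0.

Lemma row_gram_gpos (r : G -> B) (Z : 'I_n -> A) : star (r 1%g) = r 1%g ->
  gpos (row_gram r Z).
Proof.
move=> sr.
have [v hv] := @gram_gpos R B J G (fun c p => if c == p.1 then iota (Z p.2) * r 1%g else 0).
exists v => p q; rewrite -hv (bigD1 p.1) //= eqxx big1 ?addr0 => [|g /negbTE ->]; last first.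
  by rewrite star0 mul0r.
rewrite /row_gram; case: eqP => [_|_]; last by rewrite mulr0.
by rewrite starM sr !mulrA.
Qed.

Lemma row_gram_comm (r : G -> B) (Z : 'I_n -> A) (x : BM K G F) k :
  (forall x i j, \sum_k lam x i k *: (star (Z k) * Z j) =
                 \sum_k lam x k j *: (star (Z i) * Z k)) ->
  forall p s, \sum_q amp lam x k p q *: row_gram r Z q s =
              \sum_q amp lam x k q s *: row_gram r Z p q.
Proof.
move=> hZ [g i] [h j].
rewrite [LHS]sum_pairE [RHS]sum_pairE /row_gram /=.
rewrite [LHS](bigD1 h) //= [X in _ + X = _]big1 ?addr0; last first.
  move=> g' g'h; rewrite big1 // => l _; by rewrite (negbTE g'h) scaler0.
rewrite [RHS](bigD1 g) //= [X in _ = _ + X]big1 ?addr0; last first.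
  move=> g' g'h; rewrite big1 // => l _; by rewrite eq_sym (negbTE g'h) scaler0.
rewrite !eqxx /amp /=.
have E (c : 'I_n -> R[i]) (v w : 'I_n -> 'I_n) :
    \sum_l c l *: (r 1%g * star (iota (Z (v l))) * iota (Z (w l)) * r 1%g) =
    r 1%g * iota (\sum_l c l *: (star (Z (v l)) * Z (w l))) * r 1%g.
  rewrite (shom_sum hi) mulr_sumr mulr_suml; apply: eq_bigr => l _.
  by rewrite (shomZ hi) (shomM hi) (shom_star hi) -cscaleAr -cscaleAl !mulrA.
by rewrite (E _ id (fun _ => j)) (E _ (fun _ => i) id) hZ.
Qed.

(** On the diagonal, r_g is moved across u_g twice and becomes r_1, which is then moved past Z_i^*
    and Z_j: four errors of at most z^2 eta each. Off the diagonal near orthogonality gives one. *)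
Lemma row_gram_close (r : G -> B) (Z : 'I_n -> A) (z eta : R) :
  1 <= z -> (forall j, nm (Z j) <= z) ->
  (forall g, star (r g) = r g /\ nm (r g) <= 1) ->
  (forall g h, g != h -> nm (r g * r h) <= eta) ->
  (forall s g, nm (u s * r g - r (s * g)%g * u s) <= eta) ->
  (forall g j, nm (r g * iota (Z j) - iota (Z j) * r g) <= eta) ->
  forall p q : J, nm (star (r p.1 * u p.1 * iota (Z p.2)) * (r q.1 * u q.1 * iota (Z q.2))
    - row_gram r Z p q) <= 4 * z ^+ 2 * eta.
Proof.
move=> z1 hz hr h1 h2 h3 [g i] [h j]; rewrite /row_gram /=.
have eta0 : 0 <= eta by apply: le_trans (h2 1%g 1%g); exact: nm_ge0.
have nZ l : nm (iota (Z l)) <= z by apply: le_trans (shom_nm hi _) (hz l).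
have nZ' l : nm (star (iota (Z l))) <= z by rewrite nm_star.
have z2 : z <= z ^+ 2 by rewrite expr2 ler_peMr //; lra.
have ez : 0 <= z ^+ 2 * eta by rewrite mulr_ge0 ?sqr_ge0.
case: (eqVneq g h) => [<-|gh]; last first.
  rewrite subr0 !starM (hr g).1.
  have -> : star (iota (Z i)) * (star (u g) * r g) * (r h * u h * iota (Z j)) =
     star (iota (Z i)) * (star (u g) * (r g * r h) * u h) * iota (Z j) by ncring.
  apply: le_trans (_ : z * (1 * eta * 1) * z <= _); last first.
    have -> : z * (1 * eta * 1) * z = z ^+ 2 * eta by ring.
    rewrite -mulrA; lra.
  apply: nmM_le (nZ j); apply: nmM_le (nZ' i) _.
  exact: nmM_le (nmM_le (nm_us hcov g) (h1 g h gh)) (nm_u hcov h).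
set v := u g; set s := r 1%g; set t := r g; set p := iota (Z i); set q := iota (Z j).
have st : star t = t by case: (hr g).
have ss : star s = s by case: (hr 1%g).
pose y := v * s - t * v.
have ny : nm y <= eta by have := h2 g 1%g; rewrite mulg1.
have -> : star (t * v * p) * (t * v * q) - s * star p * q * s =
   - (star p * (star (t * v) * y * q)) - star p * (star y * (v * s) * q)
   + (star (s * p - p * s) * (s * q) + s * star p * (s * q - q * s)).
  have -> : star (t * v * p) * (t * v * q) = star p * (star v * (t * t) * v) * q.
    by rewrite !starM st; ncring.
  rewrite /y !starB !starM st ss.
  transitivity (star p * (star v * (t * t) * v) * q - s * star p * q * s
     + (star p * s * s * q - star p * (s * (star v * v) * s) * q)); last by ncring.
  by rewrite (cov_uu hcov) mulr1; ncring.
apply: le_trans (nmD _ _) _.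
have -> : 4 * z ^+ 2 * eta = (z ^+ 2 * eta + z ^+ 2 * eta) + (z ^+ 2 * eta + z ^+ 2 * eta) by ring.
have nv : nm v <= 1 := nm_u hcov g.
have nt : nm t <= 1 by case: (hr g).
have ns : nm s <= 1 by case: (hr 1%g).
have e1 : z * (1 * 1 * eta * z) = z ^+ 2 * eta by ring.
have e2 : z * (eta * (1 * 1) * z) = z ^+ 2 * eta by ring.
have ze : z * eta <= z ^+ 2 * eta by rewrite ler_wpM2r.
apply: lerD; [apply: le_trans (nmB _ _) _ | apply: le_trans (nmD _ _) _]; apply: lerD.
- rewrite nmN -{1}e1; apply: nmM_le (nZ' i) _; apply: nmM_le (nZ j).
  by apply: nmM_le ny; rewrite nm_star; exact: nmM_le.
- rewrite -e2; apply: nmM_le (nZ' i) _; apply: nmM_le (nZ j).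
  by apply: nmM_le; [rewrite nm_star | exact: nmM_le].
- apply: le_trans ze; rewrite mulrC -[eta * z]mulr1 mulrAC -[eta * 1 * z]mulrA.
  apply: nmM_le; first by rewrite nm_star; exact: h3.
  exact: nmM_le ns (nZ j).
- apply: le_trans ze; rewrite -[z * eta]mul1r mulrA.
  by apply: nmM_le; [exact: nmM_le ns (nZ' i) | exact: h3].
Qed.

End Rows.

Lemma le_double_sum (R : realType) (I J : finType) (h : I -> J -> R) i j :
  (forall i j, 0 <= h i j) -> h i j <= \sum_i \sum_j h i j.
Proof.
move=> h0; rewrite (bigD1 i) //= (bigD1 j) //= -addrA lerDl.
by rewrite addr_ge0 ?sumr_ge0 // => i' _; rewrite sumr_ge0.
Qed.

Lemma share_le (R : realType) (n : nat) (t X : R) : 0 <= t -> 0 <= X ->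
  n.+1%:R * (t / (n.+1%:R * (X + 1)) * X) <= t.
Proof.
move=> t0 X0; have X1 : 0 < X + 1 by lra.
have -> : n.+1%:R * (t / (n.+1%:R * (X + 1)) * X) = t * (X / (X + 1)).
  by field; rewrite !gt_eqF.
by rewrite ler_piMr // ler_pdivrMr //; lra.
Qed.

(** * The approximating maps for the crossed product *)

Section Core.
Variables (R : realType) (G : finGroupType) (A B : cstarType R).
Variables (alpha : G -> A -> A) (iota : A -> B) (u : G -> B) (f : B -> BM unit G A).
Hypotheses (ha : cstar_action alpha) (hcov : covariant alpha iota u).
Hypotheses (hf : star_hom f) (f_iota : forall a, f (iota a) = reg_pi alpha a).
Hypothesis f_u : forall g, f (u g) = reg_v A g.
Variables (d : nat) (hrok : rokhlin_le alpha d).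

Let hi : star_hom iota. Proof. by case: hcov. Qed.

Definition crossed_sum (a : G -> A) : B := \sum_s iota (a s) * u s.

Lemma ent_crossed_sum (a : G -> A) g h :
  ent (f (crossed_sum a)) tt g h = alpha g^-1%g (a (g * h^-1)%g).
Proof.
rewrite /crossed_sum (shom_sum hf) ent_sum (bigD1 (g * h^-1)%g) //= big1 ?addr0.
  by rewrite (shomM hf) f_iota f_u reg_Mv entE mulgKV eqxx.
move=> s sg; rewrite (shomM hf) f_iota f_u reg_Mv entE; case: eqP => // e.
by rewrite {1}e mulgK eqxx in sg.
Qed.

Lemma alpha_nm g x : nm (alpha g x) <= nm x.
Proof. by have [h _ _] := ha; exact: shom_nm (h g) x. Qed.

(** C comes before tol, n and F because F is itself produced by an approximation on A to within tol.
    What depends on F enters only through [eps], [eta1] and [eta0], chosen inside. The crude bound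
    by the number of blocks serves the passage to the closure. *)
Lemma core (m : nat) (a : 'I_m -> G -> A) : exists2 C : R, 0 < C &
  forall (tol : R) (n : nat) (F : cstarType R) (psi : {linear A -> F}) (phi : {linear F -> A})
    (I : 'I_n.+1 -> set F),
  0 < tol -> tol <= 1 -> fin_dim F -> cpc psi -> completely_positive phi ->
  decomposes phi I -> (forall i, contractive_on (I i) phi) ->
  (forall t g s, nm (phi (psi (alpha g (a t s))) - alpha g (a t s)) <= tol) ->
  let K := ('I_d.+1 * 'I_n.+1)%type in
  exists (Psi : {linear B -> BM K G F}) (Phi : {linear BM K G F -> B}),
  [/\ cpc Psi, completely_positive Phi,
      forall k, order_zero_on (@summand R F K G k) Phi /\ contractive_on (@summand R F K G k) Phi,
      (contractive_on setT phi -> contractive_on setT Phi) /\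
      forall x, nm (Phi x) <= #|{: K}|%:R * nm x &
      forall t, nm (Phi (Psi (crossed_sum (a t))) - crossed_sum (a t)) <= C * tol].
Proof.
pose X := \sum_t \sum_s nm (a t s).
pose Nb := \sum_t nm (crossed_sum (a t)).
pose D : R := #|'I_d.+1|%:R * #|G|%:R * #|G|%:R.
have aX t s : nm (a t s) <= X.
  by apply: (@le_double_sum R _ _ (fun t s => nm (a t s))) => *; exact: nm_ge0.
have bN t : nm (crossed_sum (a t)) <= Nb.
  rewrite /Nb (bigD1 t) //= lerDl sumr_ge0 // => *; exact: nm_ge0.
have X0 : 0 <= X by rewrite sumr_ge0 // => *; rewrite sumr_ge0 // => *; exact: nm_ge0.
have Nb0 : 0 <= Nb by rewrite sumr_ge0 // => *; exact: nm_ge0.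
clearbody X Nb.
have D0 : 0 <= D by rewrite !mulr_ge0 ?ler0n.
pose E := 2 * (D * (2 + X) + Nb).
have E0 : 0 <= E.
  have h : 0 <= D * (2 + X) by rewrite mulr_ge0 //; lra.
  rewrite /E; lra.
(* E tol is the error of the unperturbed map, 1 tol that of the perturbation, and the rest comes
   from rescaling by [c0]. *)
exists (E + 1 + 2 * (Nb + E + 1)); first lra.
move=> tol n F psi phi I tol0 tol1 fd cpsi cpphi dec ctI happ K.
have [phis [phis_cp phis_oz phis_sum phis_1]] := oz_summands cpphi dec.
have phis_nm1 i : nm (phis i 1) <= 1.
  have [e [Ie [ne ->]]] := phis_1 i.
  by have := ctI i e Ie; rewrite !nmE lecR => /le_trans; apply.
have [N [b [lam fr]]] := frame_exists fd.
(* The n + 1 compressions, at elements of norm at most X, together err by at most tol. *)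
pose eps := tol / (n.+1%:R * (X + 1)).
have n0 : 0 < n.+1%:R :> R by rewrite ltr0n.
have eps0 : 0 < eps by rewrite divr_gt0 // mulr_gt0 //; lra.
have [Z hZ] := @choice _ _ _ (fun i => oz_rows fd (phis_cp i) (phis_oz i) fr eps0).
pose z := 1 + \sum_i \sum_j nm (Z i j).
have zZ i j : nm (Z i j) <= z.
  apply: le_trans (_ : \sum_i \sum_j nm (Z i j) <= _); last by rewrite /z lerDr.
  by apply: (@le_double_sum R _ _ (fun i j => nm (Z i j))) => *; exact: nm_ge0.
have z1 : 1 <= z.
  by rewrite /z lerDl sumr_ge0 // => *; rewrite sumr_ge0 // => *; exact: nm_ge0.
clearbody z.
have z0 : 0 < z by lra.
have [Psi [hPsi cpcPsi]] := @amplified_exists R A F B K G f psi hf cpsi.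
pose asum (x : BM K G F) k := \sum_p \sum_q complex.Re `|amp lam x k p q|.
have asum0 x k : 0 <= asum x k.
  by apply: sumr_ge0 => p _; apply: sumr_ge0 => q _; rewrite normc_def /= sqrtr_ge0.
(* The perturbation is controlled at finitely many elements: at 1, which decides the norm of the
   map, and at the images under [Psi] of the elements to be approximated. *)
pose W := \sum_k asum 1 k + \sum_t \sum_k asum (Psi (crossed_sum (a t))) k.
have W1 : \sum_k asum 1 k <= W.
  by rewrite /W lerDl sumr_ge0 // => t _; apply: sumr_ge0 => k _.
have Wt t : \sum_k asum (Psi (crossed_sum (a t))) k <= W.
  rewrite /W addrC (bigD1 t) //= -addrA lerDl addr_ge0 // sumr_ge0 // => *.
  by apply: sumr_ge0 => k _.
have W0 : 0 <= W by apply: le_trans W1; apply: sumr_ge0 => k _.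
clearbody W.
pose eta1 := Num.min 1 (tol / ((2 * z + 1) * (W + 1))).
have zW : 0 < (2 * z + 1) * (W + 1) by rewrite mulr_gt0; lra.
have eta1_0 : 0 < eta1 by rewrite lt_min ltr01 divr_gt0.
have eta1_1 : eta1 <= 1 by rewrite ge_min lexx.
have eta1_W w : 0 <= w -> w <= W -> (2 * z + 1) * eta1 * w <= tol.
  move=> w0 wW; apply: le_trans (_ : (2 * z + 1) * (tol / ((2 * z + 1) * (W + 1))) * (W + 1) <= _).
    apply: ler_pM => //; last lra.
      by rewrite mulr_ge0 ?(ltW eta1_0) //; lra.
    apply: ler_wpM2l; first lra.
    by rewrite ge_min lexx orbT.
  rewrite le_eqVlt; apply/orP; left; apply/eqP; field; apply/andP; split; rewrite gt_eqF //; lra.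
clearbody eta1.
have [del del0 hdel] := @row_perturb R B (G * 'I_N.+1)%type (1%g, ord0) z eta1 z0 eta1_0.
pose eta0 := Num.min tol (del / (4 * z ^+ 2)).
have zz : 0 < 4 * z ^+ 2 by rewrite mulr_gt0 // exprn_gt0.
have eta0_0 : 0 < eta0 by rewrite lt_min tol0 divr_gt0.
have eta0_tol : eta0 <= tol by rewrite ge_min lexx.
have eta0_del : 4 * z ^+ 2 * eta0 <= del.
  by rewrite mulrC -ler_pdivlMr // ge_min lexx orbT.
clearbody eta0.
(* The towers must nearly commute with the coefficients to be approximated and with the rows Z. *)
pose c (t : 'I_m * G + 'I_n.+1 * 'I_N.+1) : A :=
  match t with inl p => a p.1 p.2 | inr p => Z p.1 p.2 end.
have [r [r1 r2 r3 r4 r5]] := @rokhlin_roots R G A B alpha iota u hcov d _ c eta0 hrok eta0_0.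
have sr l g : star (r l g) = r l g by case: (r1 l g).
pose Y (k : K) (p : G * 'I_N.+1) := r k.1 p.1 * u p.1 * iota (Z k.2 p.2).
have nY k p : nm (Y k p) <= z.
  rewrite -[z]mul1r -[1 * z]mul1r mulrA; apply: nmM_le;
    last exact: le_trans (shom_nm hi _) (zZ _ _).
  by apply: nmM_le; [case: (r1 k.1 p.1) | exact: (nm_u hcov)].
pose good (k : K) (Yk : G * 'I_N.+1 -> B) :=
    (forall q, nm (Yk q - Y k q) <= eta1) /\
    forall e : G * 'I_N.+1 -> G * 'I_N.+1 -> R[i],
      (forall p s, \sum_q e p q *: row_gram iota (r k.1) (Z k.2) q s =
                   \sum_q e q s *: row_gram iota (r k.1) (Z k.2) p q) ->
      forall p s, \sum_q e p q *: (star (Yk q) * Yk s) =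
                  \sum_q e q s *: (star (Yk p) * Yk q).
have hgood k : exists Yk, good k Yk.
  apply: hdel.
  - exact: row_gram_gpos.
  - exact: nY.
  - move=> p q; apply: le_trans eta0_del.
    apply: (row_gram_close hcov z1 (zZ k.2) (r1 k.1) (r2 k.1) (r3 k.1)) => g j.
    exact: (r4 k.1 g (inr (k.2, j))).
have [Y' hY'] := choice hgood.
(* The unscaled map has norm at most 1 + 2 tol where contractivity is claimed: 1 + tol from the sum
   of the r^2, and tol from the perturbation. *)
pose c0 := (1 + 2 * tol)^-1.
have tp : 0 < 1 + 2 * tol by rewrite addr_gt0 // mulr_gt0.
have c00 : 0 < c0 by rewrite invr_gt0.
have c01 : c0 <= 1 by rewrite invf_le1 // lerDl mulr_ge0 // ltW.
have c0t : 1 - c0 <= 2 * tol.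
  have -> : 1 - c0 = 2 * tol * c0 by rewrite /c0; field; rewrite gt_eqF.
  by rewrite ler_piMr // mulr_ge0 // ltW.
have scc : Num.sqrt c0 * Num.sqrt c0 = c0 by rewrite -expr2 sqr_sqrtr // ltW.
pose Y2 (k : K) p := (Num.sqrt c0)%:C *: Y' k p.
have [Phi hPhi] := linear_exists (row_map_linear fr Y2).
have PhiE x : Phi x = c0%:C *: \sum_k sandwich (amp lam x k) (Y' k).
  rewrite hPhi scaler_sumr; apply: eq_bigr => k _.
  by rewrite -scc -sandwich_scale.
have cpPhi : completely_positive Phi by exact: (row_map_cp fr hPhi).
pose T x := \sum_k sandwich (amp lam x k) (Y k).
have pert x k : \sum_k asum x k <= W ->
    nm (sandwich (amp lam x k) (Y' k) - sandwich (amp lam x k) (Y k)) <= tol.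
  move=> xW; apply: le_trans (sandwich_perturb _ eta1_1 (nY k) (hY' k).1) _.
  apply: eta1_W; first exact: asum0.
  by apply: le_trans xW; rewrite (bigD1 k) //= lerDl sumr_ge0.
have pertT x : \sum_k asum x k <= W ->
    nm (\sum_k sandwich (amp lam x k) (Y' k) - T x) <= tol.
  move=> xW; rewrite /T -sumrB; apply: le_trans (nm_sum _ _ _) _.
  apply: le_trans (eta1_W _ _ xW); last by apply: sumr_ge0.
  rewrite mulr_sumr; apply: ler_sum => k _.
  exact: sandwich_perturb (nY k) (hY' k).1.
have TE x : T x = \sum_l \sum_g \sum_h r l g * u g *
    iota (\sum_i compress lam (Z i) (ent x (l, i) g h)) * (star (u h) * r l h).
  rewrite /T sum_pairE; apply: eq_bigr => l _.
  under eq_bigr do rewrite (sandwich_rows hcov lam _ x) //.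
  rewrite exchange_big; apply: eq_bigr => g _ /=.
  rewrite exchange_big; apply: eq_bigr => h _ /=.
  by rewrite (shom_sum hi) mulr_sumr mulr_suml.
have ent11 k g h : compress lam (Z k.2) (ent (1 : BM K G F) k g h) =
    if g == h then compress lam (Z k.2) 1 else 0.
  rewrite ent1; case: eqP => // _; rewrite /compress big1 // => i _; rewrite big1 // => j _.
  by rewrite (lam0 fr) scale0r.
have S1 k : sandwich (amp lam (1 : BM K G F) k) (Y k) =
    \sum_g r k.1 g * u g * iota (compress lam (Z k.2) 1) * (star (u g) * r k.1 g).
  rewrite /Y (sandwich_rows hcov lam _ 1) //; apply: eq_bigr => g _.
  rewrite (bigD1 g) //= ent11 eqxx [X in _ + X]big1 ?addr0 // => h hg.
  by rewrite ent11 eq_sym (negbTE hg) (shom0 hi) mulr0 mul0r.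
pose rr := \sum_l \sum_g r l g * r l g.
have nrr : nm rr <= 1 + tol.
  have -> : rr = 1 + (rr - 1) by rewrite addrCA subrr addr0.
  by apply: le_trans (nmD _ _) _; apply: lerD; [exact: nm_le1 | exact: le_trans r5 eta0_tol].
have prr l g : pos (r l g * r l g) by apply: pos_sa_sq.
have conjpos l g x : pos x -> pos (r l g * u g * iota x * (star (u g) * r l g)).
  move=> px; have -> : r l g * u g * iota x * (star (u g) * r l g) =
    star (star (u g) * r l g) * iota x * (star (u g) * r l g) by rewrite !starM starK sr; ncring.
  by apply: pos_conj; exact: shom_pos.
have conj1 l g x : r l g * r l g - r l g * u g * iota x * (star (u g) * r l g) =
    r l g * u g * iota (1 - x) * (star (u g) * r l g).
  rewrite (shomB hi) (shom1 hi).
  have -> : r l g * u g * (1 - iota x) * (star (u g) * r l g) =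
    r l g * (u g * star (u g)) * r l g - r l g * u g * iota x * (star (u g) * r l g) by ncring.
  by rewrite (cov_uu' hcov) mulr1.
have pcomp i : pos (phis i 1 - compress lam (Z i) 1) by case: (hZ i).
have pos1 (C' : cstarType R) : pos (1 : C').
  by rewrite -[1]scale1r; exact: (pos_scale1 _ ler01).
have p1comp i : pos (1 - compress lam (Z i) 1).
  have -> : 1 - compress lam (Z i) 1 = (1 - phis i 1) + (phis i 1 - compress lam (Z i) 1).
    by rewrite addrA subrK.
  apply: posD => //; have := pos_nm_sub (pos_sa (cp_pos (phis_cp i) (pos1 F))) (phis_nm1 i).
  by rewrite scale1r.
(* The rows outside the block k are set to 0, so that [cp_pos] yields positivity for one block. *)
have pT1 k : pos (sandwich (amp lam (1 : BM K G F) k) (Y k)).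
  have [g hg] := linear_exists (row_map_linear fr (fun k' p => if k' == k then Y k p else 0)).
  have cpg := row_map_cp fr hg.
  have := cp_pos cpg (pos1 (BM K G F)); rewrite hg /row_map (bigD1 k) //= eqxx.
  rewrite [X in _ + X]big1 ?addr0 // => k' /negbTE ->.
  by rewrite big1 // => p _; rewrite big1 // => q _; rewrite mul0r scaler0.
(* The compression of 1 by the row Z is at most phi_i 1 <= 1, so this term lies below the sum of the
   r_g^2 in its tower. *)
have nS1 k : nm (sandwich (amp lam (1 : BM K G F) k) (Y k)) <= 1 + tol.
  apply: le_trans nrr; apply: pos_mono => //.
  rewrite /rr (bigD1 k.1) //= S1 addrAC; apply: posD; last first.
    by apply: pos_sum => l _; apply: pos_sum.
  rewrite -sumrB; apply: pos_sum => g _; rewrite conj1; exact: conjpos.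
(* With phi itself contractive, the compressions of 1 are summed over i before comparison: they stay
   below phi 1 <= 1, and all blocks together below the sum of the r^2. *)
have nT1 : contractive_on setT phi -> nm (T 1) <= 1 + tol.
  move=> ct; have hphi1 : nm (phi 1) <= 1.
    by have := ct 1 Logic.I; rewrite !nmE lecR => /le_trans; apply; exact: nm_le1.
  apply: le_trans nrr; apply: pos_mono; first by apply: pos_sum => k _; exact: pT1.
  have -> : T 1 =
    \sum_l \sum_g r l g * u g * iota (\sum_i compress lam (Z i) 1) * (star (u g) * r l g).
    rewrite /T sum_pairE; apply: eq_bigr => l _.
    under eq_bigr do rewrite S1 /=.
    rewrite exchange_big; apply: eq_bigr => g _ /=.
    by rewrite (shom_sum hi) mulr_sumr mulr_suml.
  rewrite /rr -sumrB; apply: pos_sum => l _; rewrite -sumrB; apply: pos_sum => g _.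
  rewrite conj1; apply: conjpos.
  have -> : 1 - \sum_i compress lam (Z i) 1 =
    (1 - phi 1) + \sum_i (phis i 1 - compress lam (Z i) 1).
    by rewrite sumrB phis_sum addrA subrK.
  apply: posD; last by apply: pos_sum.
  have := pos_nm_sub (pos_sa (cp_pos cpphi (pos1 F))) hphi1.
  by rewrite scale1r.
have scale_le (y y' : B) : nm y <= 1 + tol -> nm (y' - y) <= tol -> nm (c0%:C *: y') <= 1.
  move=> h1 h2; rewrite nmZr ger0_norm ?(ltW c00) // mulrC ler_pdivrMr // mul1r.
  have -> : y' = y + (y' - y) by rewrite addrCA subrr addr0.
  have -> : 1 + 2 * tol = (1 + tol) + tol by ring.
  by apply: le_trans (nmD _ _) _; exact: lerD.
exists Psi, Phi; split => //.
- move=> k; split.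
    move=> x y Ix Iy px py xy; rewrite !hPhi.
    apply: (row_map_oz fr (Y := Y2) (k := k)) => // x' p s.
    have h : \sum_q amp lam x' k p q *: (star (Y' k q) * Y' k s) =
             \sum_q amp lam x' k q s *: (star (Y' k p) * Y' k q).
      by apply: (hY' k).2; apply: (row_gram_comm hcov); case: (hZ k.2).
    have scal (e : R[i]) (v v' : B) (w : R) :
        e *: (star (w%:C *: v) * (w%:C *: v')) = (w * w)%:C *: (e *: (star v * v')).
      rewrite starZr; ncring.
    rewrite /Y2; under eq_bigr do rewrite scal.
    under [RHS]eq_bigr do rewrite scal.
    by rewrite -!scaler_sumr h.
  move=> x Ix; rewrite !nmE lecR.
  (* g is the cut of [Phi] to the block k, defined on the whole algebra so that [cp_nm] reduces its
     norm to the value at 1. *)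
  have [g hg] := linear_exists (row_map_linear fr (fun k' p => if k' == k then Y2 k p else 0)).
  have cpg := row_map_cp fr hg.
  have gE y : g y = c0%:C *: sandwich (amp lam y k) (Y' k).
    rewrite hg /row_map (bigD1 k) //= eqxx.
    rewrite [X in _ + X]big1 ?addr0; first by rewrite -scc -sandwich_scale.
    move=> k' /negbTE ->.
    by rewrite big1 // => p _; rewrite big1 // => q _; rewrite mul0r scaler0.
  have -> : Phi x = g x.
    rewrite PhiE gE (bigD1 k) //= [X in _ + X]big1 ?addr0 // => k' kk'.
    rewrite /sandwich big1 // => p _; rewrite big1 // => q _.
    by rewrite /amp Ix // (lam0 fr) scale0r.
  apply: le_trans (cp_nm cpg x) _; rewrite ler_piMl ?nm_ge0 // gE.
  exact: scale_le (nS1 k) (pert _ _ W1).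
- split=> [ct x _|x].
    rewrite !nmE lecR; apply: le_trans (cp_nm cpPhi x) _.
    rewrite ler_piMl ?nm_ge0 // PhiE; exact: scale_le (nT1 ct) (pertT _ W1).
  apply: le_trans (cp_nm cpPhi x) _; rewrite ler_wpM2r ?nm_ge0 //.
  rewrite PhiE scaler_sumr -sumr_const; apply: le_trans (nm_sum _ _ _) _.
  by apply: ler_sum => k _; exact: scale_le (nS1 k) (pert _ _ W1).
- move=> t; set bt := crossed_sum (a t); set x := Psi bt.
  have err1 : nm (T x - bt) <= E * tol.
    have -> : E * tol = (2 * tol) * (D * (2 + X) + Nb) by rewrite /E; ring.
    have eta2 : eta0 <= 2 * tol.
      by apply: le_trans eta0_tol _; rewrite ler_peMl ?ler1n // ltW.
    have tol2 : 0 <= 2 * tol by rewrite mulr_ge0 // ltW.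
    rewrite TE; apply: le_trans (rokhlin_estimate hcov (L := 'I_d.+1) (r := r)
      (x := fun s => iota (a t s))
      (e := fun l g h => iota (\sum_i compress lam (Z i) (ent x (l, i) g h)))
      (eta := 2 * tol) (X := X) _ r1 _ _ _ _ _) _.
    + by [].
    + by move=> l s g; apply: le_trans (r3 l s g) _.
    + by move=> l g s; apply: le_trans (r4 l g (inl (t, s))) _.
    + exact: le_trans r5 _.
    + by move=> s; apply: le_trans (shom_nm hi _) _.
    + move=> l g h.
      have -> : star (u g) * iota (a t (g * h^-1)%g) * u g = iota (alpha g^-1%g (a t (g * h^-1)%g)).
        by rewrite (cov_alpha hcov) (cov_uV hcov) starK.
      rewrite -(shomB hi); apply: le_trans (shom_nm hi _) _.
      set y := alpha _ _.
      have xe i : ent x (l, i) g h = psi y by rewrite /x hPsi entE ent_crossed_sum.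
      under eq_bigr do rewrite xe.
      have -> : \sum_i compress lam (Z i) (psi y) - y =
         \sum_i (compress lam (Z i) (psi y) - phis i (psi y)) + (phi (psi y) - y).
        by rewrite sumrB phis_sum addrA subrK.
      have ny : nm (psi y) <= X.
        have := cpsi.2 y Logic.I; rewrite !nmE lecR => /le_trans; apply.
        exact: le_trans (alpha_nm _ _) (aX _ _).
      have -> : 2 * tol = tol + tol by ring.
      apply: le_trans (nmD _ _) _; apply: lerD; last exact: happ.
      apply: le_trans (nm_sum _ _ _) _.
      apply: le_trans (_ : \sum_(i < n.+1) eps * X <= _).
        apply: ler_sum => i _; have [h1 _ _] := hZ i.
        by apply: le_trans (h1 _) _; rewrite ler_wpM2l // ltW.
      rewrite sumr_const card_ord -mulr_natl /eps.
      exact: share_le (ltW tol0) X0.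
    by apply: ler_wpM2l => //; rewrite lerD2l; exact: bN.
  rewrite PhiE; set S := \sum_k _.
  have err2 : nm (S - T x) <= tol by exact: pertT (Wt t).
  have hS : nm (S - bt) <= (E + 1) * tol.
    have -> : S - bt = (S - T x) + (T x - bt) by rewrite addrA subrK.
    have -> : (E + 1) * tol = tol + E * tol by ring.
    by apply: le_trans (nmD _ _) _; exact: lerD.
  have E1 : 0 <= E + 1 by rewrite addr_ge0.
  have nS : nm S <= Nb + (E + 1).
    have -> : S = bt + (S - bt) by rewrite addrCA subrr addr0.
    apply: le_trans (nmD _ _) _; apply: lerD; first exact: bN.
    by apply: le_trans hS _; rewrite ler_piMr.
  have -> : c0%:C *: S - bt = (S - bt) - (1 - c0)%:C *: S by ncring.
  have c1 : 0 <= 1 - c0 by rewrite subr_ge0.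
  apply: le_trans (nmB _ _) _; rewrite nmZr ger0_norm //.
  have -> : (E + 1 + 2 * (Nb + E + 1)) * tol = (E + 1) * tol + 2 * tol * (Nb + (E + 1)).
    ring.
  apply: lerD => //; apply: ler_pM => //; exact: nm_ge0.
Qed.

End Core.

(** * The dimension estimates *)

Section Least.
Variable R : realType.

Lemma least_attained (P : nat -> Prop) : (least R P < +oo)%E ->
  exists2 n, P n & least R P = (n%:R%:E)%R.
Proof.
move=> h.
have [n Pn] : exists n, P n.
  apply: contrapT => no; move: h; rewrite /least.
  rewrite (_ : [set _ | _ in _] = set0) ?ereal_inf0 ?ltxx //.
  by apply/seteqP; split=> // x [n /= Pn _]; apply: no; exists n.
have [k /asboolP Pk hk] := ex_minnP (P := fun n => `[< P n >]) (ex_intro _ n (asboolT Pn)).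
exists k => //; apply/eqP; rewrite eq_le; apply/andP; split.
  by apply: ereal_inf_lbound; exists k.
apply: le_ereal_inf_tmp => _ [j /= Pj <-]; rewrite lee_fin ler_nat.
by apply: hk; apply/asboolP.
Qed.

Lemma least_le (P : nat -> Prop) n : P n -> (least R P <= (n%:R%:E)%R)%E.
Proof. by move=> Pn; apply: ereal_inf_lbound; exists n. Qed.

(** Dimension n means n + 1 summands; each of the d + 1 towers carries them all, and [.-1] turns the
    number of blocks back into a dimension. *)
Lemma dim_bound (P Q : nat -> Prop) (d : nat) :
  (forall n, P n -> Q (n.+1 * d.+1).-1) -> (least R P < +oo)%E ->
  (least R Q < +oo)%E /\ (least R Q <= (least R P + 1) * ((d%:R%:E)%R + 1) - 1)%E.
Proof.
move=> h /least_attained [n Pn ->].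
have hQ := least_le (h n Pn).
have e : (((n%:R%:E)%R + 1) * ((d%:R%:E)%R + 1) - 1 = ((n.+1 * d.+1).-1%:R%:E)%R :> \bar R)%E.
  rewrite -!EFinD; congr EFin.
  by rewrite -subn1 natrB ?muln_gt0 // natrM -[n.+1%:R]natr1 -[d.+1%:R]natr1.
split; first by apply: le_lt_trans hQ _; rewrite ltry.
by rewrite e.
Qed.

End Least.

Section Approximation.
Variable R : realType.

(* Both dimensions at once: [dr_le] for [ctr := True], [dimnuc_le] for [ctr := False]. *)
Definition approx_dim (ctr : Prop) (A : cstarType R) (n : nat) : Prop :=
  forall (S : set A) (eps : R), finite_set S -> 0 < eps ->
  exists (F : cstarType R) (psi : {linear A -> F}) (phi : {linear F -> A}),
    [/\ fin_dim F, cpc psi, completely_positive phi,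
        forall b, S b -> `|phi (psi b) - b| < eps%:C &
        (exists I : 'I_n.+1 -> set F,
          decomposes phi I /\ forall i, contractive_on (I i) phi) /\
        (ctr -> contractive_on setT phi)].

Lemma dr_leP (A : cstarType R) n : dr_le A n <-> approx_dim True A n.
Proof.
split=> h S eps fS e0; have [F [psi [phi [h1 h2 h3 h4 h5]]]] := h S eps fS e0;
  exists F, psi, phi.
  case: h3 => h3 h6; split=> //; split=> //.
  by have [I hI] := h5; exists I; split=> // i x _; exact: h6.
by have [[I [hI _]] h6] := h5; split=> //; [split=> //; exact: h6 | exists I].
Qed.

Lemma dimnuc_leP (A : cstarType R) n : dimnuc_le A n <-> approx_dim False A n.
Proof.
split=> h S eps fS e0; have [F [psi [phi [h1 h2 h3 h4 h5]]]] := h S eps fS e0;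
  exists F, psi, phi; split=> //.
by case: h5.
Qed.

(** Universality applied to the regular covariant pair yields the map f to M_G(A); density reduces
    the approximation to finite sums of the form [crossed_sum]. *)
Lemma crossed_product_approx (gT : finGroupType) (A B : cstarType R)
    (alpha : gT -> A -> A) (iota : A -> B) (u : gT -> B) (d n : nat) (ctr : Prop) :
  cstar_action alpha -> crossed_product alpha iota u -> rokhlin_le alpha d ->
  approx_dim ctr A n -> approx_dim ctr B (n.+1 * d.+1).-1.
Proof.
move=> ha [hcov univ dens] hrok hA S eps fS e0.
have [f [hf f_iota f_u]] := univ _ _ _ (regular_covariant ha).
have density (x : B) (e : R) : 0 < e -> exists a, nm (x - crossed_sum iota u a) <= e.
  move=> ep; have : closure [set \sum_(g : gT) iota (a g) * u g | a in [set: gT -> A]] x.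
    by rewrite dens.
  have nb : nbhs x (ball x e%:C) by apply: nbhsx_ballx; rewrite ltcR.
  move=> /(_ _ nb) [_ [[a _ <-]]]; rewrite -ball_normE /ball_ /= => h.
  by exists a; apply: ltW; rewrite -nm_ltc.
have [s sE] := (finite_seqP _).1 fS.
pose m := size s; pose N : R := #|{: 'I_d.+1 * 'I_n.+1}|%:R.
have N0 : 0 <= N by rewrite ler0n.
(* [Phi] has norm at most N, so replacing an element by its approximant costs at most (N + 1) e1 =
   eps / 4; together with [tC] the total is eps / 2. *)
pose e1 := eps / (4 * (N + 1)).
have e10 : 0 < e1 by rewrite divr_gt0 //; lra.
have [a hsa] := choice (fun i : 'I_m => density (nth 0 s i) e1 e10).
have [C C0 hC] := core ha hcov hf f_iota f_u hrok a.
pose tol := Num.min 1 (eps / (4 * C)).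
have t0 : 0 < tol by rewrite lt_min ltr01 divr_gt0 // mulr_gt0.
have t1 : tol <= 1 by rewrite ge_min lexx.
have tC : C * tol <= eps / 4.
  apply: le_trans (_ : C * (eps / (4 * C)) <= _).
    by rewrite ler_wpM2l ?(ltW C0) // ge_min lexx orbT.
  by rewrite le_eqVlt; apply/orP; left; apply/eqP; field; rewrite gt_eqF.
(* The entries of f at a finite sum are translates of its coefficients under alpha, so these are
   approximated in A. *)
have [|F [psi [phi [fd cpsi cpphi happ [[I [dec ctI]] ctr']]]]] :=
    hA ((fun p : gT * 'I_m * gT => alpha p.1.1 (a p.1.2 p.2)) @` setT) tol _ t0.
  by apply: finite_image; exact: finite_finset.
have [|Psi [Phi [cPsi cpPhi hsum [hct hnm] hap]]] :=
    hC tol n F psi phi I t0 t1 fd cpsi cpphi dec ctI.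
  move=> t g h; apply: ltW; rewrite -nm_ltc; apply: happ.
  by exists (g, t, h).
pose K := ('I_d.+1 * 'I_n.+1)%type.
have cK : (n.+1 * d.+1).-1.+1 = #|{: K}| by rewrite card_prod !card_ord mulnC.
pose kap (j : 'I_(n.+1 * d.+1).-1.+1) : K := enum_val (cast_ord cK j).
have bk : bijective kap.
  exists (fun k => cast_ord (esym cK) (enum_rank k)) => x.
    by rewrite /kap enum_valK cast_ordK.
  by rewrite /kap cast_ordKV enum_rankK.
exists (BM K gT F), Psi, Phi; split=> //.
- exact: fin_dim_BM.
- move=> x; rewrite sE /= => xs; rewrite nm_ltc.
  have ix : (index x s < m)%N by rewrite index_mem.
  have := hsa (Ordinal ix); rewrite /= nth_index // => h1.
  have h2 := hap (Ordinal ix); set y := crossed_sum _ _ _ in h1 h2.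
  have -> : Phi (Psi x) - x = Phi (Psi (x - y)) + (Phi (Psi y) - y) - (x - y).
    by rewrite linearB linearB addrA subrK opprB addrA subrK.
  apply: le_lt_trans (nmB _ _) _.
  have h3 : nm (Phi (Psi (x - y))) <= N * e1.
    apply: le_trans (hnm _) _; apply: ler_wpM2l => //.
    have := cPsi.2 (x - y) Logic.I; rewrite !nmE lecR => /le_trans; exact.
  have h4 := nmD (Phi (Psi (x - y))) (Phi (Psi y) - y).
  have h5 : N * e1 + e1 = eps / 4.
    by rewrite /e1; field; rewrite gt_eqF //; lra.
  apply: le_lt_trans (lerD (le_trans h4 (lerD h3 (le_trans h2 tC))) h1) _.
  rewrite addrAC h5; lra.
- split; last by move=> hc; apply: hct; exact: ctr'.
  exists (fun j => @summand R F K gT (kap j)); split.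
    by split; [exact: direct_sum_BM | move=> j; case: (hsum (kap j))].
  by move=> j; case: (hsum (kap j)).
Qed.

End Approximation.

Theorem theorem2p3 (R : realType) (gT : finGroupType) (A : cstarType R)
    (alpha : gT -> A -> A) (halpha : cstar_action alpha)
    (B : cstarType R) (iota : A -> B) (u : gT -> B)
    (hB : crossed_product alpha iota u)
    (d : nat) (hd : rokhlin_dim alpha = (d%:R%:E)%R) :
  ((dr A < +oo)%E ->
     (dr B < +oo)%E /\
     (dr B <= (dr A + 1) * (d%:R%:E + 1) - 1)%E) /\
  ((dimnuc A < +oo)%E ->
     (dimnuc B < +oo)%E /\
     (dimnuc B <= (dimnuc A + 1) * (d%:R%:E + 1) - 1)%E).
Proof.
have hrok : rokhlin_le alpha d.
  have [|k hk] := @least_attained R (rokhlin_le alpha); first by rewrite -/(rokhlin_dim _) hd ltry.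
  rewrite -/(rokhlin_dim alpha) hd => -[/eqP]; rewrite eqr_nat => /eqP ->.
  exact: hk.
split; apply: dim_bound => n.
  by move/dr_leP/(crossed_product_approx halpha hB hrok)/dr_leP.
by move/dimnuc_leP/(crossed_product_approx halpha hB hrok)/dimnuc_leP.
Qed.
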